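(* Let $\rho:B\twoheadrightarrow\Gamma$ be a Fell bundle over an étale groupoid $\Gamma$. Then $\mathcal{C}^\rho_{\mathsf r}=\mathrm{cl}_{\mathsf b}(\mathcal{C}^\rho_{\mathsf c})$, the closure of $\mathcal{C}^\rho_{\mathsf c}$ with respect to the norm $\|\cdot\|_{\mathsf b}$, is a C*-subalgebra of the big C*-algebra $\mathcal{B}^\rho$.
   Context: Groupoids. For a groupoid $\Gamma$, $\mathsf{s}(\gamma)=\gamma^{-1}\gamma$, $\mathsf{r}(\gamma)=\gamma\gamma^{-1}$, $\Gamma^0\subseteq\Gamma$ is the set of units, and $\Gamma^2$ is the set of composable pairs ($(\alpha,\beta)\in\Gamma^2$ iff $\mathsf{s}(\alpha)=\mathsf{r}(\beta)$). For $x\in\Gamma^0$, $\Gamma x=\{\gamma:\mathsf{s}(\gamma)=x\}$. An étale groupoid is a groupoid with a topology making product and inverse continuous and such that $\mathsf{s}$ is an open map. No Hausdorff, local compactness or countability assumption is made, even on $\Gamma^0$. A slice is a subset on which $\mathsf{s}$ and $\mathsf{r}$ are injective. A subset $K\subseteq\Gamma$ is biclosed if $\mathsf{s}[K]$ and $\mathsf{r}[K]$ are closed in $\Gamma^0$; it is bicompact if it is a biclosed compact subset of an open slice. Fell bundles. A semigroupoid is a set with a partial binary operation such that $(ab)c$ is defined iff $a(bc)$ is, in which case they are equal; a *-semigroupoid also has an involution with $a^{**}=a$ and $(ab)^*=b^*a^*$ whenever $ab$ is defined. A Banach bundle is an open continuous surjection $\rho:B\twoheadrightarrow X$ of topological spaces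 such that each fibre $B_x=\rho^{-1}\{x\}$ is a complex Banach space (zero $0_x$); for each $\lambda\in\mathbb{C}$, $b\mapsto\lambda b$ is continuous on $B$; addition is continuous on $\{(a,b):\rho(a)=\rho(b)\}$; the norm is upper semicontinuous on $B$; and $\rho(b_\lambda)\to x$, $\|b_\lambda\|\to0$ imply $b_\lambda\to0_x$ for nets. A Fell bundle is a Banach bundle $\rho:B\twoheadrightarrow\Gamma$ such that: (1) $B$ is a *-semigroupoid with continuous product and involution, products are bilinear and $*$ is antilinear; (2) the norm is submultiplicative, $\Gamma$ is an étale groupoid, $ab$ is defined iff $(\rho(a),\rho(b))\in\Gamma^2$, in which case $\rho(ab)=\rho(a)\rho(b)$, and $\rho(a^* )=\rho(a)^{-1}$; (3) for all $b\in B$, $\|b^*b\|=\|b\|^2$ and there is $a\in B_{\rho(b^*b)}$ with $a^*a=b^*b$. Sections. $\mathcal{S}^\rho$ is the vector space (pointwise operations) of all, possibly discontinuous, sections $a:\Gamma\to B$, $\rho\circ a=\mathrm{id}_\Gamma$. Put $\mathrm{supp}(a)=\{\gamma:a(\gamma)\ne0_\gamma\}$ and $a^*(\gamma)=a(\gamma^{-1})^*$. The convolution $ab(\gamma)=\sum_{\gamma=\alpha\beta}a(\alpha)b(\beta)$ is ''defined'' if for every $\gamma\in\Gamma$ the net of finite partial sums converges in norm in $B_\gamma$. $\mathcal{F}^\rho$ denotes the finitely supported sections. Define $[0,\infty]$-valued norms by $$\|a\|_2=\sup_{x\in\Gamma^0}\ \sup_{F\subseteq\Gamma x\text{ finite}}\Big\|\sum_{\gamma\in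 F}a(\gamma)^*a(\gamma)\Big\|^{1/2},\qquad \|a\|_{\mathsf b}=\sup_{f\in\mathcal{F}^\rho}\frac{\|af\|_2}{\|f\|_2}\quad(0/0=0).$$ Let $\mathcal{S}^\rho_{\mathsf b}=\{a\in\mathcal{S}^\rho:\|a\|_{\mathsf b}<\infty\}$. The big C*-algebra is $\mathcal{B}^\rho=\{a\in\mathcal{S}^\rho_{\mathsf b}:a^*a\text{ and }aa^*\text{ are defined}\}$, with convolution product, involution $a\mapsto a^*$ and norm $\|\cdot\|_{\mathsf b}$. For $Y\subseteq\Gamma$, $\mathcal{C}^\rho(Y)$ is the set of $a\in\mathcal{S}^\rho$ with $\mathrm{supp}(a)\subseteq Y$ such that $a$, as a function on $\Gamma$, is continuous at every point of $Y$. Finally $\mathcal{C}^\rho_{\mathsf c}=\mathrm{span}\{a\in\mathcal{C}^\rho(K):K\subseteq\Gamma\text{ is bicompact}\}$. *)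

(* Defs.v *)
From HB Require Import structures.
From mathcomp Require Import all_boot all_order all_algebra.
From mathcomp Require Import finmap.
From mathcomp Require Import all_classical all_reals all_analysis.
From mathcomp Require Import complex.

Set Implicit Arguments.
Unset Strict Implicit.
Unset Printing Implicit Defensive.

Import Order.TTheory GRing.Theory Num.Theory.
Import numFieldNormedType.Exports.

Local Open Scope classical_set_scope.
Local Open Scope ring_scope.

(* A partial product is given by a total function which is only meaningful on
   the composable pairs.  The axioms are those of Hahn for a groupoid; that
   the pairs (g^-1, g) are composable follows from [egpd_invK]. *)
Record etale_groupoid := EtaleGroupoid {
  egpd_sort :> topologicalType;
  gmul : egpd_sort -> egpd_sort -> egpd_sort;
  ginv : egpd_sort -> egpd_sort;
  src := fun g => gmul (ginv g) g;
  rng := fun g => gmul g (ginv g);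
  composable := fun g h => src g = rng h;
  egpd_invK : forall g, ginv (ginv g) = g;
  egpd_mulA : forall g h k, composable g h -> composable h k ->
    [/\ composable (gmul g h) k, composable g (gmul h k) &
        gmul (gmul g h) k = gmul g (gmul h k)];
  egpd_mulVK : forall g h, composable g h -> gmul (ginv g) (gmul g h) = h;
  egpd_mulKV : forall g h, composable g h -> gmul (gmul g h) (ginv h) = g;
  egpd_mul_cont :
    {within [set p : egpd_sort * egpd_sort | composable p.1 p.2],
      continuous (fun p => gmul p.1 p.2)};
  egpd_inv_cont : continuous ginv;
  egpd_src_open : forall U : set egpd_sort, open U -> open (src @` U)
}.

Arguments gmul {_} _ _.
Arguments ginv {_} _.
Arguments src {_} _ /.
Arguments rng {_} _ /.
Arguments composable {_} _ _ /.

Section EtaleGroupoid.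
Variable G : etale_groupoid.

Definition units : set G := [set g | src g = g].

Definition slice (O : set G) : Prop := set_inj O src /\ set_inj O rng.

Definition closed_in_units (A : set G) : Prop :=
  exists2 C : set G, closed C & A = C `&` units.

Definition biclosed (K : set G) : Prop :=
  closed_in_units (src @` K) /\ closed_in_units (rng @` K).

Definition bicompact (K : set G) : Prop :=
  [/\ biclosed K, compact K & exists O : set G, [/\ open O, slice O & K `<=` O]].

End EtaleGroupoid.

Record fibre_at (B X : Type) (rho : B -> X) (x : X) := FibreAt {
  fibre_pt : B;
  fibre_ptP : rho fibre_pt = x
}.

Record fibred_banach (R : realType) (X : topologicalType) := FibredBanach {
  btotal : topologicalType;
  bproj : btotal -> X;
  fibre_class : forall x, CompleteNormedModule R[i] (fibre_at bproj x)
}.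

Section FibredBanach.
Variables (R : realType) (X : topologicalType) (B : fibred_banach R X).

Definition fibre (x : X) : completeNormedModType R[i] :=
  CompleteNormedModule.Pack (fibre_class B x).

Definition fibre_coe (x : X) (v : fibre x) : btotal B := fibre_pt v.

(* The point b, seen in the fibre over x; 0 if b is not over x. *)
Definition fib (x : X) (b : btotal B) : fibre x :=
  if pselect (bproj b = x) is left e then FibreAt e else 0.

(* The norm of a complex normed space takes its values in the nonnegative
   elements of R[i]. *)
Definition vnorm (x : X) (v : fibre x) : R := complex.Re `|v|.

Definition bnorm (b : btotal B) : R := vnorm (fib (bproj b) b).

Definition bscale (l : R[i]) (b : btotal B) : btotal B :=
  fibre_coe (l *: fib (bproj b) b).

(* Only meaningful if a and b are in the same fibre. *)
Definition badd (a b : btotal B) : btotal B :=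
  fibre_coe (fib (bproj a) a + fib (bproj a) b).

(* In the last clause, nets in the total space are replaced by filters. *)
Record is_banach_bundle : Prop := IsBanachBundle {
  bb_surj : set_surj setT setT (@bproj R X B);
  bb_cont : continuous (@bproj R X B);
  bb_open : forall U : set (btotal B), open U -> open (@bproj R X B @` U);
  bb_scale_cont : forall l : R[i], continuous (bscale l);
  bb_add_cont :
    {within [set p : btotal B * btotal B | bproj p.1 = bproj p.2],
      continuous (fun p => badd p.1 p.2)};
  bb_norm_usc : forall r : R, open [set b | bnorm b < r];
  bb_zero_cvg : forall (F : set_system (btotal B)) (x : X), ProperFilter F ->
    @bproj R X B @ F --> x -> bnorm @ F --> (0 : R) ->
    F --> fibre_coe (0 : fibre x)
}.

Lemma fibE (x : X) (b : btotal B) : bproj b = x -> fibre_coe (fib x b) = b.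
Proof. by rewrite /fib; case: pselect. Qed.

Lemma proj_fibre_coe (x : X) (v : fibre x) : bproj (fibre_coe v) = x.
Proof. by case: v. Qed.

Lemma fibre_coe_inj (x : X) : injective (@fibre_coe x).
Proof.
move=> [b e] [b' e'] /= bb'; rewrite /fibre_coe /= in bb'.
by subst b'; rewrite (Prop_irrelevance e e').
Qed.

Lemma fibre_coeK (x : X) (v : fibre x) : fib x (fibre_coe v) = v.
Proof. by apply: fibre_coe_inj; rewrite fibE// proj_fibre_coe. Qed.

End FibredBanach.

Arguments fib {R X} B x b.

(* [dom a b] means that the product of a and b is defined. *)
Definition is_semigroupoid (T : Type) (dom : T -> T -> Prop)
    (mul : T -> T -> T) : Prop :=
  forall a b c,
    (dom a b /\ dom (mul a b) c <-> dom b c /\ dom a (mul b c)) /\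
    (dom a b -> dom (mul a b) c -> mul (mul a b) c = mul a (mul b c)).

Definition is_star_semigroupoid (T : Type) (dom : T -> T -> Prop)
    (mul : T -> T -> T) (star : T -> T) : Prop :=
  [/\ is_semigroupoid dom mul,
      forall a, star (star a) = a &
      forall a b, dom a b ->
        dom (star b) (star a) /\ star (mul a b) = mul (star b) (star a)].

Record fell_bundle (R : realType) (G : etale_groupoid) := FellBundle {
  fell_bb :> fibred_banach R G;
  fmul : btotal fell_bb -> btotal fell_bb -> btotal fell_bb;
  fstar : btotal fell_bb -> btotal fell_bb;
  fdom := fun a b : btotal fell_bb => composable (bproj a) (bproj b);
  fell_banach_bundle : is_banach_bundle fell_bb;
  fell_star_semigroupoid : is_star_semigroupoid fdom fmul fstar;
  fell_mul_cont :
    {within [set p | fdom p.1 p.2], continuous (fun p => fmul p.1 p.2)};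
  fell_star_cont : continuous fstar;
  fell_proj_mul : forall a b, fdom a b ->
    bproj (fmul a b) = gmul (bproj a) (bproj b);
  fell_proj_star : forall a, bproj (fstar a) = ginv (bproj a);
  fell_mul_linear_l : forall g h, composable g h -> forall w : fibre fell_bb h,
    linear (fun v : fibre fell_bb g =>
      fib fell_bb (gmul g h) (fmul (fibre_coe v) (fibre_coe w)));
  fell_mul_linear_r : forall g h, composable g h -> forall v : fibre fell_bb g,
    linear (fun w : fibre fell_bb h =>
      fib fell_bb (gmul g h) (fmul (fibre_coe v) (fibre_coe w)));
  fell_star_antilinear : forall g,
    linear_for (Num.conj \; *:%R) (fun v : fibre fell_bb g =>
      fib fell_bb (ginv g) (fstar (fibre_coe v)));
  fell_norm_mul : forall a b, fdom a b ->
    bnorm (fmul a b) <= bnorm a * bnorm b;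
  fell_norm_star_mul : forall b, bnorm (fmul (fstar b) b) = bnorm b ^+ 2;
  fell_positive : forall b, exists2 a,
    bproj a = bproj (fmul (fstar b) b) & fmul (fstar a) a = fmul (fstar b) b
}.

Arguments fmul {R G _} _ _.
Arguments fstar {R G _} _.

Definition fell_section (R : realType) (G : etale_groupoid)
  (B : fell_bundle R G) : Type := forall g : G, fibre B g.

Section FellSection.
Variables (R : realType) (G : etale_groupoid) (B : fell_bundle R G).
Local Notation section := (fell_section B).

HB.instance Definition _ := gen_eqMixin section.
HB.instance Definition _ := gen_choiceMixin section.

Definition section_zero : section := fun=> 0.
Definition section_opp (a : section) : section := fun g => - a g.
Definition section_add (a b : section) : section := fun g => a g + b g.
Definition section_scale (l : R[i]) (a : section) : section :=
  fun g => l *: a g.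

Fact section_addA : associative section_add.
Proof. by move=> a b c; apply: functional_extensionality_dep => g; exact: addrA. Qed.
Fact section_addC : commutative section_add.
Proof. by move=> a b; apply: functional_extensionality_dep => g; exact: addrC. Qed.
Fact section_add0 : left_id section_zero section_add.
Proof. by move=> a; apply: functional_extensionality_dep => g; exact: add0r. Qed.
Fact section_addN : left_inverse section_zero section_opp section_add.
Proof. by move=> a; apply: functional_extensionality_dep => g; exact: addNr. Qed.

HB.instance Definition _ := GRing.isZmodule.Build section
  section_addA section_addC section_add0 section_addN.

Fact section_scaleA (l m : R[i]) (a : section) :
  section_scale l (section_scale m a) = section_scale (l * m) a.
Proof. by apply: functional_extensionality_dep => g; exact: scalerA. Qed.
Fact section_scale1 : left_id 1 section_scale.
Proof. by move=> a; apply: functional_extensionality_dep => g; exact: scale1r. Qed.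
Fact section_scaleDr : right_distributive section_scale +%R.
Proof. by move=> l a b; apply: functional_extensionality_dep => g; exact: scalerDr. Qed.
Fact section_scaleDl (a : section) :
  {morph section_scale^~ a : l m / l + m}.
Proof. by move=> l m; apply: functional_extensionality_dep => g; exact: scalerDl. Qed.

HB.instance Definition _ := GRing.Zmodule_isLmodule.Build R[i] section
  section_scaleA section_scale1 section_scaleDr section_scaleDl.

Definition section_fun (a : section) : G -> btotal B := fun g => fibre_coe (a g).

Definition supp (a : section) : set G := [set g | a g != 0].

Definition section_star (a : section) : section :=
  fun g => fib B g (fstar (section_fun a (ginv g))).

Definition factorizations (g : G) : set (G * G) :=
  [set p | composable p.1 p.2 /\ gmul p.1 p.2 = g].

Definition conv_partial (a b : section) (g : G) (F : {fset G * G}) : fibre B g :=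
  \sum_(p <- F | p \in factorizations g)
    fib B g (fmul (section_fun a p.1) (section_fun b p.2)).

(* Finite subsets of I, directed by inclusion. *)
Definition finite_subsets {I : choiceType} : set_system {fset I} :=
  filter_from setT (fun A => [set F | (A `<=` F)%fset]).

Definition conv_defined (a b : section) : Prop :=
  forall g, cvg (conv_partial a b g @ finite_subsets).

(* Only meaningful if [conv_defined a b]. *)
Definition convolution (a b : section) : section :=
  fun g => lim (conv_partial a b g @ finite_subsets).

(* Supremum in [0, +oo]; it is 0 for the empty set. *)
Definition esup0 (A : set (\bar R)) : \bar R := ereal_sup (0%E |` A).

Definition norm2 (a : section) : \bar R :=
  esup0 [set
    esup0 [set
      (Num.sqrt (vnorm (\sum_(g <- F)
         fib B x (fmul (fstar (section_fun a g)) (section_fun a g)))))%:E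
    | F in [set F : {fset G} | forall g, g \in F -> src g = x]]
  | x in @units G].

(* In \bar R, 0^-1 = +oo and 0 * +oo = 0, so that 0 / 0 = 0. *)
Definition normb (a : section) : \bar R :=
  esup0 [set (norm2 (convolution a f) / norm2 f)%E
        | f in [set f : section | finite_set (supp f)]].

Definition big_cstar : set section :=
  [set a | [/\ (normb a < +oo)%E, conv_defined (section_star a) a &
               conv_defined a (section_star a)]].

Definition closure_b (A : set section) : set section :=
  [set a | forall e : R, 0 < e -> exists2 c, A c & (normb (a - c)%R < e%:E)%E].

(* Norm-closed *-subalgebras of D, where D is a C*-algebra of sections under
   the pointwise linear structure, [convolution], [section_star] and [normb]. *)
Record is_cstar_subalgebra (D A : set section) : Prop := IsCstarSubalgebra {
  csub_sub : A `<=` D;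
  csub_zero : A 0;
  csub_add : forall a b, A a -> A b -> A (a + b);
  csub_scale : forall (l : R[i]) a, A a -> A (l *: a);
  csub_mul : forall a b, A a -> A b -> conv_defined a b /\ A (convolution a b);
  csub_star : forall a, A a -> A (section_star a);
  csub_closed : D `&` closure_b A `<=` A
}.

Definition cont_on (Y : set G) : set section :=
  [set a | supp a `<=` Y /\ {in Y, continuous (section_fun a)}].

Definition linear_span (V : lmodType R[i]) (A : set V) : set V :=
  [set v | exists (n : nat) (l : 'I_n -> R[i]) (u : 'I_n -> V),
     (forall i, A (u i)) /\ v = \sum_(i < n) l i *: u i].

Definition cont_c : set section :=
  linear_span [set a | exists2 K : set G, bicompact K & cont_on K a].

Definition reduced_cstar : set section := closure_b cont_c.

End FellSection.

Arguments big_cstar {R G} B.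
Arguments reduced_cstar {R G} B.

(* Main.v *)
From HB Require Import structures.
From mathcomp Require Import all_boot all_order all_algebra.
From mathcomp Require Import finmap.
From mathcomp Require Import all_classical all_reals all_analysis.
From mathcomp Require Import complex ring lra.
Require Import Defs.

(* Every C*-algebraic estimate reduces to the Cauchy-Schwarz inequality
   |sum a_i^* b_i|^2 <= |sum a_i^* a_i| |sum b_i^* b_i| in the fibres, which needs sums
   of elements d^* d to be positive in the C*-algebra over a unit.  No spectral theory is
   used for that: an element t of the unitization is called positive when |s - t| <= s
   for some s >= 0, positive elements have approximate square roots that are polynomials
   in t, and Kaplansky's argument then shows that a^* a is positive.

   Given Cauchy-Schwarz, |a|_2 <= |a|_b, the involution is isometric and the product is
   submultiplicative for |.|_b; moreover a column of a product over a factor that is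
   |.|_2-approximated by sections with finite columns is Cauchy, hence convolutions of
   elements of the closure are defined.  A section supported on an open slice acts with
   b-norm at most its supremum, by log-convexity of the column norms of (a^* a)^k f, and
   this supremum is finite since the norm of the bundle is upper semicontinuous.  On a
   product of open slices the factorization of an element is unique and depends
   continuously on it, so the product of two generators is again a generator. *)

Set Implicit Arguments.
Unset Strict Implicit.
Unset Printing Implicit Defensive.

Import Order.TTheory GRing.Theory Num.Theory.
Import numFieldNormedType.Exports.

Local Open Scope classical_set_scope.
Local Open Scope ring_scope.
Local Open Scope complex_scope.

(** * Two limiting arguments in the reals *)

(** The terms a_g^* a_g of a column all lie in the fibre over the common source, but the a_g
    themselves lie over different arrows. The positivity axiom of a Fell bundle trades each a_g for
    an element of that one fibre with the same square, so Kaplansky's argument is needed in a single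
    C*-algebra only. That algebra may lack a unit, and positivity compares with scalars, hence the
    unitization; the commutative facts are reached by evaluating polynomials at one self-adjoint
    element.

    The sections that test |.|_b have finite support, so a column of a f is computed by finite sums.
    Infinite sums occur only in a b with both factors in the closure, and elements of the closure
    are never described pointwise: all that is used of them is that they are |.|_b-close to the span
    of the generators.

    The estimate of f^* a^* a f by |a|^2 f^* f would usually come from a square root of |a|^2 - a^*
    a. Log-convexity replaces that root, because it needs nothing beyond Cauchy-Schwarz.

    Points of the unit space need not be separated, so closedness has to be carried along
    explicitly: this is the role of biclosed sets when products of supports are formed. *)

Lemma le_of_le_addM (R : realType) (x y K : R) :
  (forall d, 0 < d -> d <= 1 -> x <= y + d * K) -> x <= y.
Proof.
move=> H; have [//|yx] := leP x y.
have K0 : 0 < K.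
  have := H 1 ltr01 (lexx _); rewrite mul1r; lra.
pose d := Num.min 1 ((x - y) / (2 * K)).
have q0 : 0 < (x - y) / (2 * K) by rewrite divr_gt0 ?subr_gt0// mulr_gt0.
have d0 : 0 < d by rewrite lt_min ltr01.
have d1 : d <= 1 by rewrite ge_min lexx.
have dq : d <= (x - y) / (2 * K) by rewrite ge_min lexx orbT.
have := H d d0 d1.
have : d * K <= (x - y) / (2 * K) * K by rewrite ler_wpM2r// ltW.
have -> : (x - y) / (2 * K) * K = (x - y) / 2 by field; apply: lt0r_neq0.
lra.
Qed.

(** If x > 1, Bernoulli's inequality for half of the exponent, squared, gives quadratic growth,
    which beats the linear bound. Only exponents 2^k are tested, because these are the powers for
    which iterating the C*-identity yields N (y^n) = N y^n. *)
Lemma le1_of_pow_le (R : realType) (x K : R) : 0 <= x ->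
  (forall k, x ^+ (2 ^ k) <= K * (2 ^ k).+1%:R) -> x <= 1.
Proof.
move=> x0 H; have [//|x1] := leP x 1.
pose d := x - 1; have d0 : 0 < d by rewrite subr_gt0.
have bern n : 1 + n%:R * d <= x ^+ n.
  elim: n => [|n IH]; first by rewrite mul0r addr0 expr0.
  rewrite exprSr; apply: (le_trans _ (ler_wpM2r x0 IH)).
  have : 0 <= n%:R * d * d by rewrite !mulr_ge0 ?ler0n// ltW.
  rewrite -natr1 /d; nra.
have K0 : 0 < K.
  have := H 0%N; rewrite expn0 expr1; lra.
have [m Hm] : exists m : nat, 8 * K < m%:R * d ^+ 2.
  have /archi_boundP := ltW (divr_gt0 (mulr_gt0 (ltr0n R 8) K0) (exprn_gt0 2 d0)).
  set m := Num.bound _ => Hm; exists m.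
  by rewrite -ltr_pdivrMr ?exprn_gt0.
have := H m.+1; rewrite expnS mulnC exprM.
set n := (2 ^ m)%N => Hn.
have mn : (m <= n)%N by rewrite ltnW// ltn_expl.
have n1 : (1 <= n)%N by rewrite expn_gt0.
have nd : (n%:R * d) ^+ 2 <= (x ^+ n) ^+ 2.
  have nd0 : 0 <= n%:R * d by rewrite mulr_ge0// ltW.
  apply: lerXn2r; rewrite ?nnegrE ?exprn_ge0//.
  by apply: le_trans (bern n); lra.
have : (n%:R * d) ^+ 2 <= K * ((n * 2).+1)%:R by apply: le_trans nd Hn.
rewrite -natr1 natrM exprMn.
have mn' : m%:R <= n%:R :> R by rewrite ler_nat.
have n1' : 1 <= n%:R :> R by rewrite ler1n.
have : m%:R * d ^+ 2 <= n%:R * d ^+ 2 by rewrite ler_wpM2r// sqr_ge0.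
have D0 : 0 < d ^+ 2 by rewrite exprn_gt0.
move: D0 Hm; set D := d ^+ 2 => D0 Hm Hmn Hle.
have : 8 * K < n%:R * D by lra.
move: n1' Hle; set N : R := n%:R => n1' Hle HN.
nra.
Qed.

(** * Positivity for a C*-seminorm *)

(** A seminorm, because both kinds of instances can have null vectors: the unitization of a fibre
    that already has a unit, and polynomials measured through their value at a fixed element. *)
Record cstar_seminorm (R : realType) (A : algType R[i]) (star : A -> A)
    (N : A -> R) : Prop := CstarSeminorm {
  csnK : involutive star;
  csnD : {morph star : x y / x + y};
  csnM : forall x y, star (x * y) = star y * star x;
  csnZ : forall (l : R[i]) x, star (l *: x) = l^*%C *: star x;
  csn_leD : forall x y, N (x + y) <= N x + N y;
  csn_normZ : forall (l : R[i]) x, N (l *: x) = complex.Re `|l| * N x;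
  csn_leM : forall x y, N (x * y) <= N x * N y;
  csn_cstar : forall x, N (star x * x) = N x ^+ 2
}.

Definition rconst (R : realType) (A : algType R[i]) : R -> A :=
  in_alg A \o real_complex R.
HB.instance Definition _ (R : realType) (A : algType R[i]) :=
  GRing.RMorphism.on (@rconst R A).
Arguments rconst {R A} _.

Section CstarSeminorm.
Variables (R : realType) (A : algType R[i]) (star : A -> A) (N : A -> R).
Hypothesis hN : cstar_seminorm star N.
Local Notation "r %:S" := (rconst r) (at level 1, format "r %:S").

Definition sadj (x : A) := star x = x.

Lemma rconstM (r : R) (x : A) : r%:S * x = r%:C *: x.
Proof. by rewrite /rconst /= mulr_algl. Qed.

Lemma rconst_comm (r : R) (x : A) : r%:S * x = x * r%:S.
Proof. by rewrite /rconst /= mulr_algl mulr_algr. Qed.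

Lemma csn_rM (r : R) (x : A) : N (r%:S * x) = `|r| * N x.
Proof. by rewrite rconstM (csn_normZ hN) normc_def /= expr0n addr0 sqrtr_sqr. Qed.

Lemma csn0 : N 0 = 0.
Proof. by rewrite -[0](scale0r (0 : A)) (csn_normZ hN) normr0 mul0r. Qed.

Lemma csnN x : N (- x) = N x.
Proof. by rewrite -scaleN1r (csn_normZ hN) normrN1 mul1r. Qed.

Lemma csn_ge0 x : 0 <= N x.
Proof.
have := csn_leD hN x (- x); rewrite subrr csn0 csnN; lra.
Qed.

Lemma csn_leB x y : N (x - y) <= N x + N y.
Proof. by rewrite -(csnN y); exact: csn_leD hN _ _. Qed.

Lemma csn_swap x y : N (x - y) = N (y - x).
Proof. by rewrite -csnN opprB. Qed.

Lemma csn_le_dist x y : N x <= N y + N (x - y).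
Proof. by rewrite -[X in N X <= _](subrKC y x); exact: csn_leD hN _ _. Qed.

Lemma star1 : star 1 = 1.
Proof. by rewrite -[LHS]mulr1 -[X in _ * X](csnK hN) -(csnM hN) mulr1 (csnK hN). Qed.

Lemma star_rconst (r : R) : star r%:S = r%:S.
Proof. by rewrite /rconst /= (csnZ hN) star1 /= oppr0. Qed.

Lemma csn1_le : N 1 <= 1.
Proof.
have := csn_cstar hN 1; rewrite star1 mulr1 => h.
have := csn_ge0 1; nra.
Qed.

Lemma csn_rconst (r : R) : N r%:S <= `|r|.
Proof.
rewrite -[r%:S]mulr1 csn_rM ler_piMr//; exact: csn1_le.
Qed.

Lemma csn_star x : N (star x) = N x.
Proof.
have le y : N y <= N (star y).
  have := csn_leM hN (star y) y; rewrite (csn_cstar hN).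
  have := csn_ge0 y; have := csn_ge0 (star y).
  move: (N y) (N (star y)) => a b b0 a0; rewrite expr2.
  have [->//|an0] := eqVneq a 0.
  by rewrite ler_pM2r// lt0r an0.
by apply/le_anti; rewrite le andbT -[X in _ <= N X](csnK hN) le.
Qed.

Lemma csn_sqr y : sadj y -> N (y ^+ 2) = N y ^+ 2.
Proof. by move=> ys; rewrite -(csn_cstar hN) ys expr2. Qed.

Lemma star0 : star 0 = 0.
Proof. by apply: (addIr (star 0)); rewrite -(csnD hN) !add0r. Qed.

Lemma star_sub x y : star (x - y) = star x - star y.
Proof.
by apply: (addIr (star y)); rewrite -(csnD hN) !subrK.
Qed.

Lemma sadj1 : sadj 1. Proof. exact: star1. Qed.
Lemma sadj0 : sadj 0. Proof. exact: star0. Qed.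
Lemma sadjD x y : sadj x -> sadj y -> sadj (x + y).
Proof. by rewrite /sadj (csnD hN) => -> ->. Qed.
Lemma sadjB x y : sadj x -> sadj y -> sadj (x - y).
Proof. by rewrite /sadj star_sub => -> ->. Qed.
Lemma sadj_rconst r : sadj r%:S. Proof. exact: star_rconst. Qed.
Lemma sadjM x y : GRing.comm x y -> sadj x -> sadj y -> sadj (x * y).
Proof. by rewrite /sadj (csnM hN) => + -> ->; exact: esym. Qed.
Lemma sadjX x n : sadj x -> sadj (x ^+ n).
Proof.
move=> xs; elim: n => [|n IH]; first exact: sadj1.
by rewrite exprS; apply: sadjM => //; exact: commrX.
Qed.
Lemma sadj_rM r x : sadj x -> sadj (r%:S * x).
Proof. move=> xs; apply: sadjM => //; [exact: rconst_comm|exact: sadj_rconst]. Qed.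

Lemma csn_pow2 y k : sadj y -> N (y ^+ (2 ^ k)) = N y ^+ (2 ^ k).
Proof.
move=> ys; elim: k => [|k IH]; first by rewrite expn0 !expr1.
by rewrite expnS mulnC !exprM csn_sqr ?IH//; exact: sadjX.
Qed.

Lemma csn_leX y n : (0 < n)%N -> N (y ^+ n) <= N y ^+ n.
Proof.
elim: n => // -[_ _|n IH _]; first by rewrite !expr1.
rewrite exprS [leRHS]exprS; apply: le_trans (csn_leM hN _ _) _.
by rewrite ler_wpM2l ?csn_ge0// IH.
Qed.

(* Positivity of a self-adjoint t: the spectrum of t lies in [0, 2s]. *)
Definition cpos (t : A) : Prop := exists2 s, 0 <= s & N (s%:S - t) <= s.

(** Raising s0 to s costs at most s - s0. This allows a witness to be shifted by 1, which is how the
    bounds for 1 - c^* c and 1 - c c^* are compared later. *)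
Lemma cpos_bound t : cpos t ->
  exists2 s0, 0 <= s0 & forall s, s0 <= s -> N (s%:S - t) <= s.
Proof.
move=> [s0 s00 h]; exists s0 => // s ss.
have -> : s%:S - t = (s - s0)%:S + (s0%:S - t) by rewrite rmorphB /= addrA subrK.
apply: le_trans (csn_leD hN _ _) _.
have := csn_rconst (s - s0); rewrite ger0_norm ?subr_ge0//; lra.
Qed.

Lemma cposD t u : cpos t -> cpos u -> cpos (t + u).
Proof.
move=> [s s0 h] [s' s'0 h']; exists (s + s'); first exact: addr_ge0.
have -> : (s + s')%:S - (t + u) = (s%:S - t) + (s'%:S - u).
  by rewrite rmorphD /= opprD addrACA.
apply: le_trans (csn_leD hN _ _) _; exact: lerD.
Qed.

Lemma cposZ r t : 0 <= r -> cpos t -> cpos (r%:S * t).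
Proof.
move=> r0 [s s0 h]; exists (r * s); first exact: mulr_ge0.
rewrite rmorphM /= -mulrBr csn_rM ger0_norm//; exact: ler_wpM2l.
Qed.

Lemma cpos_rconst r : 0 <= r -> cpos r%:S.
Proof. by move=> r0; exists r => //; rewrite subrr csn0. Qed.

Lemma cpos_sum (I : Type) (s : seq I) (F : I -> A) :
  (forall i, cpos (F i)) -> cpos (\sum_(i <- s) F i).
Proof.
move=> h; apply: (big_ind cpos) => // [|x y].
  by have := @cpos_rconst 0 (lexx _); rewrite rmorph0.
exact: cposD.
Qed.

End CstarSeminorm.

(** * Order in commutative algebras, through approximate square roots *)

Section CommCstarSeminorm.
Variables (R : realType) (K : comAlgType R[i]) (star : K -> K) (N : K -> R).
Hypothesis hN : cstar_seminorm star N.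
Local Notation "r %:S" := (rconst r) (at level 1, format "r %:S").

Lemma csn_sqr_leD (h k : K) : sadj star h -> sadj star k ->
  N (h ^+ 2) <= N (h ^+ 2 + k ^+ 2).
Proof.
(* h is the real part of the normal element h + i k. *)
move=> hs ks; pose n := h + 'i%C%:A * k.
have ii : ('i%C%:A : K) ^+ 2 = - 1.
  by rewrite expr2 mulr_algl scalerA -expr2 sqr_i scaleN1r.
have sn : star n = h - 'i%C%:A * k.
  rewrite /n (csnD hN) (csnM hN) hs ks (csnZ hN) (star1 hN) mulrC.
  congr (_ + _); rewrite -mulNr; congr (_ * _); rewrite -scaleNr; congr (_ *: _).
  by apply/eqP; rewrite eq_complex /= oppr0 !eqxx.
have -> : h ^+ 2 + k ^+ 2 = star n * n.
  rewrite sn /n.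
  transitivity (h ^+ 2 - ('i%C%:A ^+ 2) * k ^+ 2); last ring.
  by rewrite ii mulN1r opprK.
rewrite (csn_cstar hN) (csn_sqr hN)//.
rewrite lerXn2r ?nnegrE ?(csn_ge0 hN)//.
have -> : h = 2^-1%:S * (n + star n).
  have h2 : (2^-1)%:S * (2 : K) = 1.
    by rewrite -(rmorph_nat (@rconst R K)) -rmorphM /= mulVf// rmorph1.
  transitivity ((2^-1)%:S * 2 * h); first by rewrite h2 mul1r.
  by rewrite sn /n; move: (rconst _) ('i%C%:A : K) => x I; ring.
rewrite (csn_rM hN) ger0_norm ?invr_ge0//.
have := csn_leD hN n (star n); rewrite (csn_star hN); lra.
Qed.

Lemma csn_approx_sqrt1 (t : K) (r d : R) : sadj star t -> N t <= r -> r < 1 ->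
  0 < d -> exists2 l, sadj star l & N (1 - t - l ^+ 2) <= d.
Proof.
move=> ts tr r1 d0.
have r0 : 0 <= r by apply: le_trans tr; exact: csn_ge0 hN _.
(* q n converges geometrically to 1 - sqrt (1 - t). *)
pose q := fix q n := if n is m.+1 then 2^-1%:S * (t + q m ^+ 2) else 0 : K.
have qS m : q m.+1 = 2^-1%:S * (t + q m ^+ 2) by [].
have qs n : sadj star (q n).
  elim: n => [|n IH]; first exact: sadj0 hN.
  by apply: (sadj_rM hN); apply: (sadjD hN) => //; apply: (sadjX hN).
have qr n : N (q n) <= r.
  elim: n => [|n IH]; first by rewrite (csn0 hN).
  rewrite /= (csn_rM hN) ger0_norm ?invr_ge0//.
  have := csn_leD hN t (q n ^+ 2); rewrite (csn_sqr hN (qs n)).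
  have := csn_ge0 hN (q n); nra.
have qd n : N (q n.+1 - q n) <= r ^+ n.
  elim: n => [|n IH].
    rewrite subr0 expr0; exact: le_trans (qr 1%N) (ltW r1).
  (* A difference of squares; half the sum of two iterates has seminorm at most r, which is the
     contraction factor. *)
  have -> : q n.+2 - q n.+1 = 2^-1%:S * ((q n.+1 - q n) * (q n.+1 + q n)).
    rewrite (qS n.+1) [X in _ - X = _]qS; move: (q n.+1) (q n) => x y; ring.
  rewrite (csn_rM hN) ger0_norm ?invr_ge0// exprSr.
  have := csn_leM hN (q n.+1 - q n) (q n.+1 + q n).
  have := csn_leD hN (q n.+1) (q n).
  have h1 := qr n.+1; have h2 := qr n; move=> h3 h4.
  have := csn_ge0 hN (q n.+1 - q n); have := csn_ge0 hN (q n.+1 + q n).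
  move: IH h1 h2 h3 h4; move: (N (q n.+1 - q n)) (N (q n.+1 + q n)).
  move: (N (_ * _)) (N (q n.+1)) (N (q n)) (r ^+ n) => a b c e f g ???????.
  have : f * g <= e * (2 * r).
    by apply: ler_pM => //; lra.
  lra.
have [n rn] : exists n, 2 * r ^+ n <= d.
  have /cvgrPdist_lt/(_ (d / 2)) : (fun n => r ^+ n) @ \oo --> (0 : R).
    by apply: cvg_expr; rewrite ger0_norm.
  rewrite divr_gt0// => /(_ isT) [n _ /(_ n (leqnn _))] /=.
  rewrite sub0r normrN ger0_norm ?exprn_ge0// => h; exists n; lra.
exists (1 - q n); first by apply: (sadjB hN) => //; exact: sadj1 hN.
(* By the recursion 2 q (n+1) = t + (q n)^2, the residual is minus twice the next increment. *)
have -> : 1 - t - (1 - q n) ^+ 2 = (- 2)%:S * (q n.+1 - q n).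
  have h2 : 2%:S * (2^-1)%:S = 1 :> K by rewrite -rmorphM /= mulfV// rmorph1.
  transitivity (2%:S * q n - 2%:S * (2^-1)%:S * (t + q n ^+ 2)); last first.
    by rewrite qS; move: (q n) => x; ring.
  by rewrite h2; move: (q n) => x; ring.
rewrite (csn_rM hN) normrN ger0_norm//.
by apply: le_trans rn; rewrite ler_pM2l.
Qed.

Lemma csn_approx_sqrt (t : K) (d : R) : sadj star t -> cpos N t -> 0 < d ->
  exists2 l, sadj star l & N (t - l ^+ 2) <= d.
Proof.
(* Enlarging s to S makes the seminorm of u at most s / S < 1, as the iteration requires. Since t =
   S (1 - u) - e, half of the allowed error d pays for this shift and the other half for the
   approximate root of 1 - u. *)
move=> ts [s s0 h] d0; pose e := d / 2; pose S := s + e.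
have e0 : 0 < e by rewrite divr_gt0.
have S0 : 0 < S by rewrite ltr_wpDl.
pose u := S^-1%:S * (s%:S - t).
have [||||l ls hl] := @csn_approx_sqrt1 u (s / S) (e / S).
- by apply: (sadj_rM hN); apply: (sadjB hN) => //; exact: sadj_rconst hN _.
- rewrite (csn_rM hN) gtr0_norm ?invr_gt0// mulrC ler_wpM2r// invr_ge0; exact: ltW.
- by rewrite ltr_pdivrMr// mul1r /S ltrDl.
- exact: divr_gt0.
exists ((Num.sqrt S)%:S * l); first exact: (sadj_rM hN).
have -> : t - ((Num.sqrt S)%:S * l) ^+ 2 = S%:S * (1 - u - l ^+ 2) - e%:S.
  have h1 : S%:S * u = s%:S - t.
    by rewrite /u mulrA -rmorphM /= mulfV ?gt_eqF// rmorph1 mul1r.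
  have h2 : (Num.sqrt S)%:S ^+ 2 = S%:S :> K.
    by rewrite -rmorphXn /= sqr_sqrtr// ltW.
  transitivity (S%:S - S%:S * u - S%:S * l ^+ 2 - e%:S); last ring.
  rewrite h1 exprMn h2 /S rmorphD /=; ring.
apply: le_trans (csn_leB hN _ _) _.
have := csn_rconst hN e; rewrite (csn_rM hN) !gtr0_norm// => he.
have : S * N (1 - u - l ^+ 2) <= S * (e / S) by rewrite ler_pM2l.
rewrite mulrCA mulfV ?gt_eqF// mulr1 /e; rewrite /e in he; lra.
Qed.

(** With t = k^2 / S there is an approximate root l of 1 - t, and t is itself a square, so
    [csn_sqr_leD] gives N (l^2) <= N (l^2 + t), where l^2 + t is close to 1. Thus N (1 - t) <= 1. *)
Lemma csn_sqr_pos (k : K) (S : R) : sadj star k -> N k ^+ 2 < S ->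
  N (S%:S - k ^+ 2) <= S.
Proof.
move=> ks kS; have S0 : 0 < S by apply: le_lt_trans kS; exact: sqr_ge0.
pose t := S^-1%:S * k ^+ 2.
have ts : sadj star t by apply: (sadj_rM hN); exact: (sadjX hN).
have tE : t = ((Num.sqrt S^-1)%:S * k) ^+ 2.
  by rewrite exprMn -rmorphXn /= sqr_sqrtr// invr_ge0 ltW.
have Nt : N t <= N k ^+ 2 / S.
  by rewrite /t (csn_rM hN) (csn_sqr hN)// gtr0_norm ?invr_gt0// mulrC.
have Nt1 : N k ^+ 2 / S < 1 by rewrite ltr_pdivrMr// mul1r.
have le1 : N (1 - t) <= 1.
  apply: (@le_of_le_addM _ _ _ 2) => d d0 _.
  have [l ls hl] := csn_approx_sqrt1 ts Nt Nt1 d0.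
  have h1 : N (l ^+ 2) <= N (l ^+ 2 + t).
    by rewrite tE; apply: csn_sqr_leD => //; exact: (sadj_rM hN).
  have h2 : N (l ^+ 2 + t) <= 1 + d.
    have -> : l ^+ 2 + t = 1 - (1 - t - l ^+ 2) by ring.
    apply: le_trans (csn_leB hN _ _) _; apply: lerD => //; exact: csn1_le hN.
  have := csn_le_dist hN (1 - t) (l ^+ 2); lra.
have -> : S%:S - k ^+ 2 = S%:S * (1 - t).
  by rewrite mulrBr mulr1 /t mulrA -rmorphM /= mulfV ?gt_eqF// rmorph1 mul1r.
by rewrite (csn_rM hN) gtr0_norm// ler_piMr// ltW.
Qed.

Lemma cpos_sqr (k : K) : sadj star k -> cpos N (k ^+ 2).
Proof.
move=> ks; exists (N k ^+ 2 + 1); first by rewrite addr_ge0// sqr_ge0.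
by apply: csn_sqr_pos => //; rewrite ltrDl.
Qed.

Lemma cpos_sqrM (k t : K) : sadj star k -> sadj star t -> cpos N t ->
  cpos N (k ^+ 2 * t).
Proof.
(* For every approximate root l of t with precision d <= 1, S exceeds N (k l)^2. So S can be fixed
   before d tends to 0 and k^2 t is compared with the square of k l. *)
move=> ks ts tp; pose S := N k ^+ 2 * (N t + 1) + 1.
have S0 : 0 <= S.
  by rewrite addr_ge0// mulr_ge0 ?sqr_ge0// addr_ge0// (csn_ge0 hN).
exists S => //; apply: (@le_of_le_addM _ _ _ (N k ^+ 2)) => d d0 d1.
have [l ls hl] := csn_approx_sqrt ts tp d0.
have -> : S%:S - k ^+ 2 * t = (S%:S - (k * l) ^+ 2) - k ^+ 2 * (t - l ^+ 2) by ring.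
apply: le_trans (csn_leB hN _ _) _; apply: lerD.
  apply: csn_sqr_pos; first by apply: (sadjM hN) => //; exact: mulrC.
  have Nl : N l ^+ 2 <= N t + 1.
    rewrite -(csn_sqr hN ls); have := csn_le_dist hN (l ^+ 2) t.
    rewrite (csn_swap hN); lra.
  have : N (k * l) ^+ 2 <= (N k * N l) ^+ 2.
    by rewrite lerXn2r ?nnegrE ?mulr_ge0 ?(csn_ge0 hN) ?(csn_leM hN).
  rewrite exprMn.
  have : N k ^+ 2 * N l ^+ 2 <= N k ^+ 2 * (N t + 1) by rewrite ler_wpM2l ?sqr_ge0.
  rewrite /S; lra.
apply: le_trans (csn_leM hN _ _) _; rewrite (csn_sqr hN ks) mulrC.
by rewrite ler_wpM2r// sqr_ge0.
Qed.

Lemma csn_le_cpos (y : K) (e : R) : 0 <= e -> sadj star y ->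
  cpos N (e%:S - y) -> cpos N (e%:S + y) -> N y <= e.
Proof.
move=> e0 ys p1 p2.
have es := sadj_rconst hN e.
(* With e - y ~ l^2 and e + y ~ m^2 one has e^2 ~ y^2 + (l m)^2. *)
suff : N y ^+ 2 <= e ^+ 2 by rewrite ler_pXn2r// nnegrE (csn_ge0 hN).
set u := e%:S - y in p1; set v := e%:S + y in p2.
apply: (@le_of_le_addM _ _ _ (N v + N u + 1)) => d d0 d1.
have us : sadj star u by exact: sadjB hN _ _ es ys.
have vs : sadj star v by exact: sadjD hN _ _ es ys.
have [l ls hl] := csn_approx_sqrt us p1 d0.
have [m ms hm] := csn_approx_sqrt vs p2 d0.
have lms : sadj star (l * m) by apply: (sadjM hN) => //; exact: mulrC.
rewrite -(csn_sqr hN ys); apply: le_trans (csn_sqr_leD ys lms) _.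
have -> : y ^+ 2 + (l * m) ^+ 2 =
    (e ^+ 2)%:S - ((u - l ^+ 2) * v + l ^+ 2 * (v - m ^+ 2)).
  by rewrite /u /v rmorphXn /=; ring.
apply: le_trans (csn_leB hN _ _) _; apply: lerD.
  by apply: le_trans (csn_rconst hN _) _; rewrite ger0_norm// sqr_ge0.
apply: le_trans (csn_leD hN _ _) _.
have Nl : N (l ^+ 2) <= N u + 1.
  have := csn_le_dist hN (l ^+ 2) u; rewrite (csn_swap hN (l ^+ 2)); lra.
have h1 : N ((u - l ^+ 2) * v) <= d * N v.
  apply: le_trans (csn_leM hN _ _) _; rewrite ler_wpM2r//; exact: csn_ge0 hN _.
have h2 : N (l ^+ 2 * (v - m ^+ 2)) <= (N u + 1) * d.
  apply: le_trans (csn_leM hN _ _) _; rewrite ler_pM//; exact: csn_ge0 hN _.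
lra.
Qed.

(** Passing from n to n + 1 adds (1 - w)^2 w^n, which is a square when n is even and a square times
    the positive element w when n is odd. *)
Lemma cpos_poly (w : K) (n : nat) : sadj star w -> cpos N w ->
  cpos N (1 - (1 - w) * w ^+ n).
Proof.
move=> ws wp; elim: n => [|n IH].
  by have -> : 1 - (1 - w) * w ^+ 0 = w by rewrite expr0; ring.
have -> : 1 - (1 - w) * w ^+ n.+1 =
    (1 - (1 - w) * w ^+ n) + (1 - w) ^+ 2 * w ^+ n by rewrite exprS; ring.
apply: (cposD hN) => //.
have w1s : sadj star (1 - w) by apply: (sadjB hN) => //; exact: sadj1 hN.
have -> : (1 - w) ^+ 2 * w ^+ n = ((1 - w) * w ^+ n./2) ^+ 2 * w ^+ odd n.
  rewrite exprMn -(exprM w) muln2 -[RHS]mulrA; congr (_ * _).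
  by rewrite -exprD addnC odd_double_half.
have ks : sadj star ((1 - w) * w ^+ n./2).
  by apply: (sadjM hN) => //; [exact: mulrC|exact: (sadjX hN)].
case: odd; first by rewrite expr1; apply: cpos_sqrM.
by rewrite expr0 mulr1; exact: cpos_sqr.
Qed.

End CommCstarSeminorm.

(** * Noncommutative algebras: positivity of a^* a *)

Section CstarPositivity.
Variables (R : realType) (A : algType R[i]) (star : A -> A) (N : A -> R).
Hypothesis hN : cstar_seminorm star N.
Local Notation "r %:S" := (rconst r) (at level 1, format "r %:S").

Section PolynomialCalculus.
Variable h : A.
Hypothesis hs : sadj star h.

(** The commutative results are applied to polynomials, with the seminorm pulled back along
    evaluation at h. No subalgebra generated by h has to be formed, and conjugating coefficients is
    the right involution because h is self-adjoint. *)
Let pstar (p : {poly R[i]}) : {poly R[i]} := map_poly (@conjc R) p.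
Let pN (p : {poly R[i]}) : R := N (horner_alg h p).

Lemma star_horner_alg p : star (horner_alg h p) = horner_alg h (pstar p).
Proof.
rewrite /pstar; elim/poly_ind: p => [|p c IH].
  by rewrite !rmorph0 (star0 hN).
rewrite !rmorphD /= !rmorphM /= map_polyX map_polyC /= !horner_algX !horner_algC.
rewrite (csnD hN) (csnM hN) hs IH (csnZ hN) (star1 hN); congr (_ + _).
by have := congr1 (horner_alg h) (mulrC 'X (pstar p)); rewrite !rmorphM /= !horner_algX.
Qed.

Lemma horner_cstar_seminorm : cstar_seminorm pstar pN.
Proof.
split.
- by move=> p; rewrite /pstar -map_poly_comp map_poly_id// => x _; exact: conjcK.
- by move=> p q; rewrite /pstar rmorphD.
- by move=> p q; rewrite /pstar rmorphM mulrC.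
- by move=> l p; rewrite /pstar map_polyZ.
- by move=> p q; rewrite /pN rmorphD; exact: csn_leD hN _ _.
- by move=> l p; rewrite /pN linearZ /= mulr_algl; exact: csn_normZ hN _ _.
- by move=> p q; rewrite /pN rmorphM; exact: csn_leM hN _ _.
- move=> p; rewrite /pN (rmorphM (horner_alg h)) /= -star_horner_alg; exact: csn_cstar hN _.
Qed.

Lemma horner_rconst r : horner_alg h (rconst r) = r%:S.
Proof. by rewrite /rconst /= linearZ /= !rmorph1 mulr1. Qed.

Lemma pstarX : sadj pstar 'X.
Proof. by rewrite /sadj /pstar map_polyX. Qed.

Lemma cpos_horner p : cpos pN p -> cpos N (horner_alg h p).
Proof.
by move=> [s s0 H]; exists s => //; rewrite -horner_rconst -rmorphB.
Qed.

Lemma horner_cpos p : cpos N (horner_alg h p) -> cpos pN p.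
Proof.
by move=> [s s0 H]; exists s => //; rewrite /pN rmorphB /= horner_rconst.
Qed.

Lemma sqr_cpos : cpos N (h ^+ 2).
Proof.
rewrite -(horner_algX h) -rmorphXn; apply: cpos_horner.
exact: (cpos_sqr horner_cstar_seminorm pstarX).
Qed.

Lemma norm_le_cpos e : 0 <= e -> cpos N (e%:S - h) -> cpos N (e%:S + h) -> N h <= e.
Proof.
move=> e0; rewrite -(horner_algX h) -horner_rconst -rmorphB -rmorphD.
move=> /horner_cpos p1 /horner_cpos p2.
exact: (csn_le_cpos horner_cstar_seminorm e0 pstarX).
Qed.

Lemma poly_cpos n : cpos N h -> cpos N (1 - (1 - h) * h ^+ n).
Proof.
rewrite -(horner_algX h) => /horner_cpos p1.
rewrite -rmorphXn -(rmorph1 (horner_alg h)) -rmorphB -rmorphM -rmorphB.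
apply: cpos_horner.
exact: (cpos_poly horner_cstar_seminorm n pstarX).
Qed.

End PolynomialCalculus.

Lemma sqrD_sub_sqrB (x y : A) : (x + y) ^+ 2 - (x - y) ^+ 2 = (x * y + y * x) *+ 2.
Proof.
have sqE (u v : A) : (u + v) ^+ 2 = (u * u + v * v) + (u * v + v * u).
  by rewrite expr2 mulrDl !mulrDr [v * u + _]addrC addrACA.
rewrite !sqE mulrNN mulrN mulNr -opprD.
by rewrite opprB [(x * y + y * x) - _]addrC addrACA subrr add0r mulr2n.
Qed.

Lemma sadj_starM (c : A) : sadj star (star c * c).
Proof. by rewrite /sadj (csnM hN) (csnK hN). Qed.

(* (s + c c* )^n = s^n + c e_n c*, where e_n only involves c* c. *)
Lemma norm_swap_le (c : A) (s : R) : 0 <= s -> N (s%:S + star c * c) <= s + 1 ->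
  N (s%:S + c * star c) <= s + 1.
Proof.
move=> s0 h; set z := s%:S + c * star c; set M := s + 1.
have zs : sadj star z.
  apply: (sadjD hN); first exact: sadj_rconst hN _.
  by rewrite /sadj (csnM hN) (csnK hN).
have M1 : 1 <= M by rewrite lerDr.
have M0 : 0 < M by apply: lt_le_trans M1.
have [e [zE eN]] : exists e : nat -> A,
    (forall n, z ^+ n = (s ^+ n)%:S + c * e n * star c) /\
    (forall n, N (e n) <= n%:R * M ^+ n).
  (* The recursion is read off from (s^m + c e_m c^* ) (s + c c^* ): every term other than s^(m+1)
     begins with c and ends with c^*. *)
  pose e := fix e n := if n is m.+1 then (s ^+ m)%:S + e m * (s%:S + star c * c)
                       else 0 : A.
  exists e; split=> n.
    elim: n => [|n IH]; first by rewrite !expr0 mulr0 mul0r addr0 rmorph1.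
    rewrite exprSr IH /z [e n.+1]/= exprSr rmorphM /=.
    rewrite mulrDl !mulrDr !mulrDl -!addrA; congr (_ + _).
    congr (_ + (_ + _)); last by rewrite !mulrA.
      by rewrite mulrA rconst_comm.
    by rewrite [in RHS]mulrA -[RHS]mulrA rconst_comm !mulrA.
  elim: n => [|n IH]; first by rewrite mul0r (csn0 hN).
  apply: le_trans (csn_leD hN _ _) _.
  have h1 : N (s ^+ n)%:S <= M ^+ n.+1.
    apply: le_trans (csn_rconst hN _) _; rewrite ger0_norm ?exprn_ge0//.
    apply: (@le_trans _ _ (M ^+ n)); last exact: ler_weXn2l.
    by rewrite lerXn2r ?nnegrE ?(ltW M0)// lerDl.
  have h2 : N (e n * (s%:S + star c * c)) <= n%:R * M ^+ n * M.
    apply: le_trans (csn_leM hN _ _) _; apply: ler_pM => //; exact: csn_ge0 hN _.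
  by rewrite -natr1 mulrDl mul1r addrC lerD// exprSr mulrA.
suff : N z / M <= 1 by rewrite ler_pdivrMr// mul1r.
(* For n = 2^k the C*-identity gives N z^n = N (z^n), and the expansion bounds this by M^n (1 + n N
   c^2). After division by M^n the growth is only linear in n. *)
apply: (@le1_of_pow_le _ _ (1 + N c ^+ 2)).
  by rewrite divr_ge0 ?(csn_ge0 hN)// ltW.
move=> k; set n := (2 ^ k)%N.
rewrite exprMn exprVn ler_pdivrMr ?exprn_gt0// -(csn_pow2 hN)// -/n zE.
apply: le_trans (csn_leD hN _ _) _.
have h1 : N (s ^+ n)%:S <= M ^+ n.
  apply: le_trans (csn_rconst hN _) _; rewrite ger0_norm ?exprn_ge0//.
  by rewrite lerXn2r ?nnegrE ?(ltW M0)// lerDl.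
have h2 : N (c * e n * star c) <= N c ^+ 2 * (n%:R * M ^+ n).
  apply: le_trans (csn_leM hN _ _) _; rewrite (csn_star hN) expr2 mulrAC.
  rewrite ler_wpM2r ?(csn_ge0 hN)//.
  apply: le_trans (csn_leM hN _ _) _; rewrite ler_wpM2l ?(csn_ge0 hN)//.
have P0 : 0 <= M ^+ n by rewrite exprn_ge0// ltW.
apply: le_trans (lerD h1 h2) _; rewrite -natr1.
have n0 : 0 <= n%:R :> R by [].
have Q0 : 0 <= N c ^+ 2 * M ^+ n by rewrite mulr_ge0// sqr_ge0.
have : 0 <= n%:R * M ^+ n by rewrite mulr_ge0.
move: Q0; move: (M ^+ n) (N c ^+ 2) (n%:R : R) => P Q m; nra.
Qed.

(* Kaplansky: with w = 1 - a* a and c = a w^m one has c* c = (1 - w) w^(2m) <= 1,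
   hence c c* <= 1, while c* c + c c* is a sum of two squares; so the powers of w
   stay bounded. *)
Lemma norm_one_sub_le (a : A) : N a < 1 -> N (1 - star a * a) <= 1.
Proof.
move=> a1; set w := 1 - star a * a.
have ws : sadj star w by apply: (sadjB hN); [exact: sadj1 hN|exact: sadj_starM].
have wp : cpos N w.
  exists 1 => //; rewrite rmorph1 /w subKr (csn_cstar hN).
  have := csn_ge0 hN a; nra.
have key m : N ((1 - w) * w ^+ (m * 2)) <= 1.
  pose c := a * w ^+ m.
  have cc : star c * c = (1 - w) * w ^+ (m * 2).
    rewrite /c (csnM hN) (sadjX hN _ ws) /w subKr -/w muln2 -addnn exprD.
    rewrite !mulrA; congr (_ * _); rewrite -mulrA.
    have <- : 1 - w = star a * a by rewrite /w subKr.
    apply: esym; apply: commrX; apply: commr_sym; apply: commrB => //.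
    exact: commr1.
  have p1 : cpos N (1 - star c * c) by rewrite cc; exact: poly_cpos.
  have p2 : cpos N (1 - c * star c).
    have [s0 s00 hs0] := cpos_bound hN p1.
    exists (s0 + 1); first by rewrite addr_ge0.
    have := hs0 (s0 + 1); rewrite lerDl ler01 => /(_ isT).
    have E u : (s0 + 1)%:S - (1 - u) = s0%:S + u.
      by rewrite rmorphD rmorph1 opprB [u - 1]addrC addrA addrK.
    rewrite !E.
    exact: norm_swap_le.
  have p3 : cpos N (star c * c + c * star c).
    pose x := c + star c; pose y := 'i%C *: (c - star c).
    have xs : sadj star x by rewrite /sadj /x (csnD hN) (csnK hN) addrC.
    have ys : sadj star y.
      rewrite /sadj /y (csnZ hN) (star_sub hN) (csnK hN).
      have -> : ('i%C)^*%C = - 'i%C :> R[i] by apply/eqP; rewrite eq_complex /= oppr0 !eqxx.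
      by rewrite scaleNr -scalerN opprB.
    have -> : star c * c + c * star c = 2^-1%:S * (x ^+ 2 + y ^+ 2).
      have -> : y ^+ 2 = - (c - star c) ^+ 2.
        by rewrite /y exprZn sqr_i scaleN1r.
      have -> : x ^+ 2 - (c - star c) ^+ 2 = 2%:S * (star c * c + c * star c).
        by rewrite rmorph_nat mulr_natl sqrD_sub_sqrB addrC.
      by rewrite mulrA -rmorphM /= mulVf// rmorph1 mul1r.
    apply: (cposZ hN); rewrite ?invr_ge0//.
    by apply: (cposD hN); exact: sqr_cpos.
  rewrite -cc; apply: norm_le_cpos => //; first exact: sadj_starM.
    by rewrite rmorph1.
  (* The lower bound -1 <= c^* c is where the estimate for c c^* enters; the upper bound is [p1]. *)
  have -> : 1%:S + star c * c = (1 - c * star c) + (star c * c + c * star c).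
    by rewrite rmorph1 addrA addrAC [_ + c * star c]subrK.
  exact: (cposD hN).
rewrite leNgt; apply/negP => x1; have x0 := lt_trans ltr01 x1.
have d0 : 0 < N w - 1 by rewrite subr_gt0.
(* By [key], w^n and w^(n+1) differ by at most 1 in seminorm. Hence N w^(n+1) <= N w^n + 1, which
   bounds N w^n by the inverse of N w - 1. *)
have bound k : N w ^+ (2 ^ k.+1) <= (N w - 1)^-1.
  set n := (2 ^ k.+1)%N.
  have [m nE] : exists m, n = m.+2.
    exists (n - 2)%N; rewrite -addn2 subnK//.
    by rewrite /n expnS leq_pmulr// expn_gt0.
  have nn : (n.+1 + n.-1 = 2 ^ k.+2)%N.
    by rewrite expnS mul2n -addnn -/n nE /= addSnnS.
  (* n + 1 is not a power of two, so the lower bound for N (w^(n+1)) is obtained by dividing N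
     (w^(2n)) = N w^(2n) by the bound for the complementary factor w^(n-1). That exponent has to be
     positive, since [csn_leX] excludes 0; hence n = m + 2. *)
  have le1 : N w ^+ n.+1 <= N (w ^+ n.+1).
    have := csn_leM hN (w ^+ n.+1) (w ^+ n.-1).
    rewrite -exprD nn (csn_pow2 hN)//.
    move=> le2; have le3 : N (w ^+ n.-1) <= N w ^+ n.-1 by apply: (csn_leX hN); rewrite nE.
    have P0 : 0 < N w ^+ n.-1 by rewrite exprn_gt0.
    rewrite -(ler_pM2r P0) -exprD nn.
    by apply: le_trans le2 _; rewrite ler_wpM2l ?(csn_ge0 hN).
  have := key (2 ^ k)%N; rewrite mulnC -expnS -/n => k1.
  have k2 : N (w ^+ n.+1) <= N w ^+ n + 1.
    have -> : w ^+ n.+1 = w ^+ n - (1 - w) * w ^+ n.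
      by rewrite mulrBl mul1r subKr exprS.
    apply: le_trans (csn_leB hN _ _) _; apply: lerD => //.
    by apply: (csn_leX hN); rewrite nE.
  rewrite -[leRHS]mul1r ler_pdivlMr//; move: (le_trans le1 k2).
  by rewrite exprSr mulrBr mulr1 lerBlDl addrC.
suff : N w <= 1 by rewrite leNgt x1.
apply: (@le1_of_pow_le _ _ (N w + (N w - 1)^-1)); first exact: ltW.
move=> k; have i0 : 0 < (N w - 1)^-1 by rewrite invr_gt0.
apply: (@le_trans _ _ (N w + (N w - 1)^-1)); last first.
  by rewrite ler_peMr ?ler1n// addr_ge0// ltW.
case: k => [|k]; first by rewrite expn0 expr1 lerDl ltW.
by apply: le_trans (bound k) _; rewrite lerDr ltW.
Qed.

Lemma cpos_starM (a : A) : cpos N (star a * a).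
Proof.
pose r := (N a + 1)^-1.
have N0 : 0 < N a + 1 by rewrite ltr_wpDl ?(csn_ge0 hN).
have r0 : 0 < r by rewrite invr_gt0.
have lt1 : N (r%:S * a) < 1.
  by rewrite (csn_rM hN) gtr0_norm// mulrC ltr_pdivrMr// mul1r ltrDl.
have -> : star a * a = ((N a + 1) ^+ 2)%:S * (star (r%:S * a) * (r%:S * a)).
  rewrite (csnM hN) (star_rconst hN) -rconst_comm -mulrA (mulrA (star a) r%:S).
  rewrite -(rconst_comm r (star a)) -mulrA !mulrA -!rmorphM /=.
  by rewrite expr2 mulrK ?unitfE ?gt_eqF// mulfV ?gt_eqF// rmorph1 mul1r.
apply: (cposZ hN); first exact: sqr_ge0.
by exists 1; rewrite // rmorph1; exact: norm_one_sub_le.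
Qed.

(** For 0 <= y <= V, both N V - y and N V + y are positive, which bounds N y. Here N V - V is
    positive with witness N V, because subtracting it from N V leaves V. *)
Lemma cstar_norm_le_sum (I J : Type) (r : seq I) (s : seq J) (a : I -> A) (b : J -> A) :
  N (\sum_(i <- r) star (a i) * a i) <=
  N (\sum_(i <- r) star (a i) * a i + \sum_(j <- s) star (b j) * b j).
Proof.
set y := \sum_(i <- r) _; set V := y + _.
have yp : cpos N y by apply: (cpos_sum hN) => i; exact: cpos_starM.
apply: norm_le_cpos; [|exact: csn_ge0 hN _| |].
- apply: (big_ind (sadj star)) => [|u v us vs|i _]; first exact: sadj0 hN.
    exact: (sadjD hN us vs).
  exact: sadj_starM.
- have -> : (N V)%:S - y = ((N V)%:S - V) + \sum_(j <- s) star (b j) * b j.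
    by rewrite /V opprD addrA subrK.
  apply: (cposD hN).
    by exists (N V); rewrite ?(csn_ge0 hN)// subKr.
  by apply: (cpos_sum hN) => i; exact: cpos_starM.
- by apply: (cposD hN) => //; exact: (cpos_rconst hN (csn_ge0 hN _)).
Qed.

End CstarPositivity.

(** * Algebra of a Fell bundle *)

Section GroupoidTheory.
Variable G : etale_groupoid.
Implicit Types g h k x : G.

Lemma src_inv g : src (ginv g) = rng g.
Proof. by rewrite /src egpd_invK. Qed.

Lemma rng_inv g : rng (ginv g) = src g.
Proof. by rewrite /rng egpd_invK. Qed.

Lemma composableVg g : composable (ginv g) g.
Proof. exact: src_inv. Qed.

Lemma composablegV g : composable g (ginv g).
Proof. by rewrite /composable rng_inv. Qed.

Lemma src_rng g : src (rng g) = rng g.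
Proof. by have [] := egpd_mulA (composablegV g) (composableVg g). Qed.

Lemma src_src g : src (src g) = src g.
Proof. by rewrite -(rng_inv g) src_rng. Qed.

Lemma rng_src g : rng (src g) = src g.
Proof. by have [_ /esym] := egpd_mulA (composablegV g) (composableVg g). Qed.

Lemma rng_rng g : rng (rng g) = rng g.
Proof. by rewrite -(src_inv g) rng_src. Qed.

Lemma gmul_src g : gmul g (src g) = g.
Proof. by rewrite /src -[X in gmul X _](egpd_invK g) egpd_mulVK//; exact: src_inv. Qed.

Lemma gmul_rng g : gmul (rng g) g = g.
Proof.
by have [_ _ ->] := egpd_mulA (composablegV g) (composableVg g); exact: gmul_src.
Qed.

Lemma units_src g : units (src g). Proof. exact: src_src. Qed.
Lemma units_rng g : units (rng g). Proof. exact: src_rng. Qed.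

Lemma rng_unit x : units x -> rng x = x.
Proof. by move=> ux; rewrite -ux rng_src. Qed.

Lemma inv_unit x : units x -> ginv x = x.
Proof.
move=> ux; rewrite -[LHS]gmul_src src_inv (rng_unit ux); exact: ux.
Qed.

Lemma src_mul g h : composable g h -> src (gmul g h) = src h.
Proof.
by move=> gh; have [-> _ _] := egpd_mulA gh (composablegV h); exact: rng_inv.
Qed.

Lemma rng_mul g h : composable g h -> rng (gmul g h) = rng g.
Proof.
by move=> gh; have [_ <- _] := egpd_mulA (composableVg g) gh; exact: src_inv.
Qed.

Lemma composable_inv g h : composable g h -> composable (ginv h) (ginv g).
Proof. by rewrite /composable src_inv rng_inv. Qed.

Lemma gmulA g h k : composable g h -> composable h k ->
  gmul (gmul g h) k = gmul g (gmul h k).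
Proof. by move=> gh hk; have [] := egpd_mulA gh hk. Qed.

Lemma inv_mul g h : composable g h -> ginv (gmul g h) = gmul (ginv h) (ginv g).
Proof.
move=> gh; have hg := composable_inv gh.
have c : composable (gmul g h) (gmul (ginv h) (ginv g)).
  by rewrite /composable src_mul// rng_mul// rng_inv.
have c' : composable (gmul g h) (ginv h) by rewrite /composable src_mul// rng_inv.
have := egpd_mulVK c; rewrite -(gmulA c' hg).
rewrite egpd_mulKV// => <-.
by rewrite -/(rng g) -(rng_mul gh) -src_inv gmul_src.
Qed.

Lemma gmulVK g h : src g = src h -> gmul (gmul g (ginv h)) h = g.
Proof.
by move=> gh; rewrite -[X in gmul _ X](egpd_invK h) egpd_mulKV//; rewrite /composable rng_inv.
Qed.

Lemma gmulV_l g h : rng g = rng h -> gmul g (gmul (ginv g) h) = h.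
Proof.
by move=> gh; rewrite -[X in gmul X _]egpd_invK egpd_mulVK// /composable src_inv.
Qed.

Lemma composable_mulV g h : src g = src h -> composable g (ginv h).
Proof. by rewrite /composable rng_inv. Qed.

Lemma composable_Vmul g h : rng g = rng h -> composable (ginv g) h.
Proof. by rewrite /composable src_inv. Qed.

Lemma src_mulV g h : src g = src h -> src (gmul g (ginv h)) = rng h.
Proof. by move=> gh; rewrite src_mul ?src_inv//; exact: composable_mulV. Qed.

Lemma rng_mulV g h : src g = src h -> rng (gmul g (ginv h)) = rng g.
Proof. by move=> gh; rewrite rng_mul//; exact: composable_mulV. Qed.

End GroupoidTheory.

Lemma Re_norm_ge0 (R : realType) (l : R[i]) : 0 <= complex.Re `|l|.
Proof. by rewrite normc_def /= sqrtr_ge0. Qed.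

Lemma norm_real_complex (R : realType) (l : R[i]) : `|l| = (complex.Re `|l|)%:C.
Proof. by rewrite normc_def. Qed.

Section FibreNorm.
Variables (R : realType) (X : topologicalType) (B : fibred_banach R X).

Lemma vnormE x (v : fibre B x) : `|v| = (vnorm v)%:C.
Proof.
have := normr_ge0 v; rewrite /vnorm; case: `|v| => a b /=.
by rewrite lecE /= => /andP[/eqP -> _].
Qed.

Lemma vnorm_ge0 x (v : fibre B x) : 0 <= vnorm v.
Proof. by have := normr_ge0 v; rewrite vnormE lecR. Qed.

Lemma vnorm_leD x (v w : fibre B x) : vnorm (v + w) <= vnorm v + vnorm w.
Proof. by have := ler_normD v w; rewrite !vnormE -rmorphD /= lecR. Qed.

Lemma vnormZ x (l : R[i]) (v : fibre B x) : vnorm (l *: v) = complex.Re `|l| * vnorm v.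
Proof.
have := normrZ l v; rewrite !vnormE norm_real_complex -rmorphM /= => /eqP.
by rewrite eq_complex /= => /andP[/eqP -> _].
Qed.

Lemma vnormZr x (r : R) (v : fibre B x) : vnorm (r%:C *: v) = `|r| * vnorm v.
Proof. by rewrite vnormZ normc_def /= expr0n addr0 sqrtr_sqr. Qed.

Lemma vnorm0 x : vnorm (0 : fibre B x) = 0.
Proof. by rewrite /vnorm normr0. Qed.

Lemma vnorm_eq0 x (v : fibre B x) : vnorm v = 0 -> v = 0.
Proof. by move=> v0; apply/normr0_eq0; rewrite vnormE v0. Qed.

Lemma vnormN x (v : fibre B x) : vnorm (- v) = vnorm v.
Proof. by rewrite /vnorm normrN. Qed.

Lemma vnorm_sum x (I : Type) (s : seq I) (P : pred I) (F : I -> fibre B x) :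
  vnorm (\sum_(i <- s | P i) F i) <= \sum_(i <- s | P i) vnorm (F i).
Proof.
elim/big_ind2: _ => [|a b c d h1 h2|//]; first by rewrite vnorm0.
by apply: le_trans (vnorm_leD _ _) _; exact: lerD.
Qed.

Lemma bnorm_coe x (v : fibre B x) : bnorm (fibre_coe v) = vnorm v.
Proof.
case: v => b e; subst x; rewrite /bnorm; congr vnorm.
by apply: fibre_coe_inj; rewrite fibE.
Qed.

End FibreNorm.

Section FellAlgebra.
Variables (R : realType) (G : etale_groupoid) (B : fell_bundle R G).
Implicit Types g h k m n x : G.
Local Notation fibre := (fibre B).

(* The fibre k in which a product or an adjoint is taken is a free parameter, so that
   equations in the groupoid need no transport; only the values at the right k
   are meaningful. *)
Definition fprod k g h (v : fibre g) (w : fibre h) : fibre k :=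
  fib B k (fmul (fibre_coe v) (fibre_coe w)).

Definition fadj k g (v : fibre g) : fibre k := fib B k (fstar (fibre_coe v)).

Definition fip k g h (v : fibre g) (w : fibre h) : fibre k :=
  fib B k (fmul (fstar (fibre_coe v)) (fibre_coe w)).

Let fell_mulA : is_semigroupoid (@fdom R G B) (@fmul R G B).
Proof. by have [] := fell_star_semigroupoid B. Qed.
Let fell_starK (b : btotal B) : fstar (fstar b) = b.
Proof. by have [_ ->] := fell_star_semigroupoid B. Qed.

Lemma bproj_coe g (v : fibre g) : bproj (fibre_coe v) = g.
Proof. exact: proj_fibre_coe. Qed.

Lemma fdom_coe g h (v : fibre g) (w : fibre h) :
  composable g h -> fdom (fibre_coe v) (fibre_coe w).
Proof. by rewrite /fdom !bproj_coe. Qed.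

Lemma coe_fprod k g h (v : fibre g) (w : fibre h) :
  composable g h -> gmul g h = k ->
  fibre_coe (fprod k v w) = fmul (fibre_coe v) (fibre_coe w).
Proof.
move=> gh <-; rewrite fibE// fell_proj_mul ?bproj_coe//; exact: fdom_coe.
Qed.

Lemma coe_fadj k g (v : fibre g) : ginv g = k ->
  fibre_coe (fadj k v) = fstar (fibre_coe v).
Proof. by move=> <-; rewrite fibE// fell_proj_star bproj_coe. Qed.

Lemma fipE k g h (v : fibre g) (w : fibre h) :
  fip k v w = fprod k (fadj (ginv g) v) w.
Proof. by rewrite /fip /fprod coe_fadj. Qed.

Lemma fprodDl k g h (v v' : fibre g) (w : fibre h) :
  composable g h -> gmul g h = k ->
  fprod k (v + v') w = fprod k v w + fprod k v' w.
Proof.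
move=> gh <-; have := fell_mul_linear_l gh w 1 v v'; rewrite !scale1r; exact.
Qed.

Lemma fprodDr k g h (v : fibre g) (w w' : fibre h) :
  composable g h -> gmul g h = k ->
  fprod k v (w + w') = fprod k v w + fprod k v w'.
Proof.
move=> gh <-; have := fell_mul_linear_r gh v 1 w w'; rewrite !scale1r; exact.
Qed.

Lemma fprod0l k g h (w : fibre h) :
  composable g h -> gmul g h = k -> fprod k (0 : fibre g) w = 0.
Proof.
by move=> gh e; apply: (addIr (fprod k (0 : fibre g) w)); rewrite -fprodDl// !add0r.
Qed.

Lemma fprod0r k g h (v : fibre g) :
  composable g h -> gmul g h = k -> fprod k v (0 : fibre h) = 0.
Proof.
by move=> gh e; apply: (addIr (fprod k v (0 : fibre h))); rewrite -fprodDr// !add0r.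
Qed.

Lemma fprodZl k g h (l : R[i]) (v : fibre g) (w : fibre h) :
  composable g h -> gmul g h = k -> fprod k (l *: v) w = l *: fprod k v w.
Proof.
move=> gh e; have := fell_mul_linear_l gh w l v 0; subst k.
by rewrite addr0 -/(fprod _ 0 w) fprod0l// addr0.
Qed.

Lemma fprodZr k g h (l : R[i]) (v : fibre g) (w : fibre h) :
  composable g h -> gmul g h = k -> fprod k v (l *: w) = l *: fprod k v w.
Proof.
move=> gh e; have := fell_mul_linear_r gh v l w 0; subst k.
by rewrite addr0 -/(fprod _ v 0) fprod0r// addr0.
Qed.

Lemma fprodNl k g h (v : fibre g) (w : fibre h) :
  composable g h -> gmul g h = k -> fprod k (- v) w = - fprod k v w.
Proof. by move=> gh e; rewrite -scaleN1r fprodZl// scaleN1r. Qed.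

Lemma fprod_suml (I : Type) (s : seq I) (P : pred I) k g h (F : I -> fibre g)
    (w : fibre h) : composable g h -> gmul g h = k ->
  fprod k (\sum_(i <- s | P i) F i) w = \sum_(i <- s | P i) fprod k (F i) w.
Proof.
move=> gh e; apply: (big_morph (fun v => fprod k v w)) => [v v'|].
  exact: fprodDl.
exact: fprod0l.
Qed.

Lemma fprod_sumr (I : Type) (s : seq I) (P : pred I) k g h (v : fibre g)
    (F : I -> fibre h) : composable g h -> gmul g h = k ->
  fprod k v (\sum_(i <- s | P i) F i) = \sum_(i <- s | P i) fprod k v (F i).
Proof.
move=> gh e; apply: (big_morph (fprod k v)) => [w w'|].
  exact: fprodDr.
exact: fprod0r.
Qed.

Lemma fprodA k m n g h l (u : fibre g) (v : fibre h) (w : fibre l) :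
  composable g h -> composable h l -> gmul g h = m -> gmul h l = n ->
  fprod k (fprod m u v) w = fprod k u (fprod n v w).
Proof.
move=> gh hl e e'; rewrite /fprod (coe_fprod _ _ gh e) (coe_fprod _ _ hl e').
congr (fib B k); have [_ ->//] := fell_mulA (fibre_coe u) (fibre_coe v) (fibre_coe w).
  exact: fdom_coe.
rewrite /fdom fell_proj_mul; last exact: fdom_coe.
by rewrite !bproj_coe; have [] := egpd_mulA gh hl.
Qed.

Lemma fadjK g k (v : fibre g) : ginv g = k -> fadj g (fadj k v) = v.
Proof.
by move=> e; rewrite /fadj coe_fadj// fell_starK fibre_coeK.
Qed.

Lemma fadj_prod k l m n g h (v : fibre g) (w : fibre h) :
  composable g h -> gmul g h = m -> ginv h = n -> ginv g = l ->
  fadj k (fprod m v w) = fprod k (fadj n w) (fadj l v).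
Proof.
move=> gh e e' e''; rewrite /fadj /fprod coe_fprod// !fibE; last 2 first.
- by rewrite fell_proj_star bproj_coe.
- by rewrite fell_proj_star bproj_coe.
congr (fib B k); have [_ _ /(_ (fibre_coe v) (fibre_coe w))] := fell_star_semigroupoid B.
by move=> /(_ (fdom_coe v w gh))[].
Qed.

Lemma fadjD k g (v w : fibre g) : ginv g = k -> fadj k (v + w) = fadj k v + fadj k w.
Proof.
by move=> <-; have := @fell_star_antilinear R G B g 1 v w; rewrite /= conjC1 !scale1r.
Qed.

Lemma fadj0 k g : ginv g = k -> fadj k (0 : fibre g) = 0.
Proof.
by move=> e; apply: (addIr (fadj k (0 : fibre g))); rewrite -fadjD// !add0r.
Qed.

Lemma fadjZ k g (l : R[i]) (v : fibre g) : ginv g = k ->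
  fadj k (l *: v) = l^*%C *: fadj k v.
Proof.
move=> e; have := @fell_star_antilinear R G B g l v 0; subst k.
by rewrite addr0 /= -/(fadj (ginv g) 0) fadj0// addr0.
Qed.

Lemma fadj_sum (I : Type) (s : seq I) (P : pred I) k g (F : I -> fibre g) :
  ginv g = k -> fadj k (\sum_(i <- s | P i) F i) = \sum_(i <- s | P i) fadj k (F i).
Proof.
move=> e; apply: (big_morph (fun v : fibre g => fadj k v)) => [v w|]; [exact: fadjD|exact: fadj0].
Qed.

Lemma vnorm_fprod k g h (v : fibre g) (w : fibre h) :
  composable g h -> gmul g h = k -> vnorm (fprod k v w) <= vnorm v * vnorm w.
Proof.
move=> gh e; rewrite -!bnorm_coe coe_fprod//; apply: fell_norm_mul; exact: fdom_coe.
Qed.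

Lemma vnorm_fip x g (v : fibre g) : src g = x -> vnorm (fip x v v) = vnorm v ^+ 2.
Proof.
move=> e; rewrite -!bnorm_coe -fell_norm_star_mul fipE coe_fprod ?coe_fadj//.
exact: composableVg.
Qed.

Lemma vnorm_fadj k g (v : fibre g) : ginv g = k -> vnorm (fadj k v) = vnorm v.
Proof.
have le y h (w : fibre h) : ginv h = y -> vnorm w <= vnorm (fadj y w).
  move=> e; have := vnorm_fip w (erefl (src h)); rewrite fipE => eN.
  have := vnorm_fprod (fadj (ginv h) w) w (composableVg h) (erefl (src h)).
  rewrite eN e; have := vnorm_ge0 w; have := vnorm_ge0 (fadj y w).
  move: (vnorm w) (vnorm (fadj y w)) => a b b0 a0; rewrite expr2; have [->|an0] := eqVneq a 0.
    by [].
  by rewrite ler_pM2r// lt0r an0.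
move=> e; apply/le_anti; rewrite le// andbT.
by rewrite -[X in _ <= vnorm X](fadjK v e); apply: le; rewrite -e egpd_invK.
Qed.

End FellAlgebra.

Arguments fprodA {R G B k m n g h l} u v w.
Arguments fadj_prod {R G B k l m n g h} v w.

Section InnerProduct.
Variables (R : realType) (G : etale_groupoid) (B : fell_bundle R G).
Implicit Types g h k x : G.
Local Notation fibre := (fibre B).

Lemma fipDl k g h (v v' : fibre g) (w : fibre h) : rng g = rng h ->
  gmul (ginv g) h = k -> fip k (v + v') w = fip k v w + fip k v' w.
Proof. by move=> gh e; rewrite !fipE fadjD// fprodDl//; exact: composable_Vmul. Qed.

Lemma fipDr k g h (v : fibre g) (w w' : fibre h) : rng g = rng h ->
  gmul (ginv g) h = k -> fip k v (w + w') = fip k v w + fip k v w'.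
Proof. by move=> gh e; rewrite !fipE fprodDr//; exact: composable_Vmul. Qed.

Lemma fipZl k g h (l : R[i]) (v : fibre g) (w : fibre h) : rng g = rng h ->
  gmul (ginv g) h = k -> fip k (l *: v) w = l^*%C *: fip k v w.
Proof. by move=> gh e; rewrite !fipE fadjZ// fprodZl//; exact: composable_Vmul. Qed.

Lemma fipZr k g h (l : R[i]) (v : fibre g) (w : fibre h) : rng g = rng h ->
  gmul (ginv g) h = k -> fip k v (l *: w) = l *: fip k v w.
Proof. by move=> gh e; rewrite !fipE fprodZr//; exact: composable_Vmul. Qed.

Lemma fipNr k g h (v : fibre g) (w : fibre h) : rng g = rng h ->
  gmul (ginv g) h = k -> fip k v (- w) = - fip k v w.
Proof. by move=> gh e; rewrite -scaleN1r fipZr// scaleN1r. Qed.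

Lemma fipNl k g h (v : fibre g) (w : fibre h) : rng g = rng h ->
  gmul (ginv g) h = k -> fip k (- v) w = - fip k v w.
Proof.
move=> gh e; rewrite !fipE -scaleN1r fadjZ// fprodZl ?rmorphN1 ?scaleN1r//.
exact: composable_Vmul.
Qed.

Lemma fip0r k g h (v : fibre g) : rng g = rng h ->
  gmul (ginv g) h = k -> fip k v (0 : fibre h) = 0.
Proof. by move=> gh e; rewrite !fipE fprod0r//; exact: composable_Vmul. Qed.

Lemma fadj_fip k k' g h (v : fibre g) (w : fibre h) : rng g = rng h ->
  gmul (ginv g) h = k -> ginv k = k' -> fadj k' (fip k v w) = fip k' w v.
Proof.
move=> gh e <-; rewrite !fipE; have c := composable_Vmul gh.
rewrite (fadj_prod (n := ginv h) (l := g))//; last exact: egpd_invK.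
by rewrite fadjK.
Qed.

Lemma fip_prodl k l n g h m (a : fibre g) (v : fibre h) (b : fibre m) :
  composable g h -> gmul g h = n -> rng g = rng m -> gmul (ginv g) m = l ->
  fip k (fprod n a v) b = fip k v (fip l a b).
Proof.
move=> gh e gm e'; rewrite !fipE.
have cgm := composable_Vmul gm.
rewrite (fadj_prod (n := ginv h) (l := ginv g))//.
rewrite (fprodA (n := l))//; first exact: composable_inv.
by rewrite -e inv_mul.
Qed.

Lemma fip_prodr k l n g h m (a : fibre g) (b : fibre h) (v : fibre m) :
  composable h m -> gmul h m = n -> rng g = rng h -> gmul (ginv g) h = l ->
  fip k a (fprod n b v) = fprod k (fip l a b) v.
Proof.
move=> hm e gh e'; rewrite !fipE (fprodA (n := n))//.
exact: composable_Vmul.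
Qed.

End InnerProduct.
Arguments fip_prodl {R G B k l n g h m} a v b.
Arguments fip_prodr {R G B k l n g h m} a b v.

(** Adjoins the scalars that [cpos] needs. The proof that x is a unit is a parameter of the type
    because the ring structure declared on it depends on that proof. *)
Definition unitization (R : realType) (G : etale_groupoid) (B : fell_bundle R G)
  (x : G) (ux : units x) : Type := (R[i]^o * fibre B x)%type.

Section Unitization.
Variables (R : realType) (G : etale_groupoid) (B : fell_bundle R G).
Variables (x : G) (ux : units x).
Local Notation U := (unitization B ux).
Local Notation V := (fibre B x).

HB.instance Definition _ := GRing.Lmodule.copy U (R[i]^o * V)%type.

Let cxx : composable x x. Proof. by rewrite /composable (rng_unit ux). Qed.
Let mxx : gmul x x = x. Proof. by rewrite -[X in gmul _ X]ux gmul_src. Qed.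
Let ixx : ginv x = x. Proof. exact: inv_unit. Qed.
Local Notation "v ** w" := (fprod x (v : V) (w : V) : V) (at level 40).

Definition unitization_mul (p q : U) : U :=
  (p.1 * q.1, (p.1 : R[i]) *: q.2 + (q.1 : R[i]) *: p.2 + p.2 ** q.2).
Definition unitization_one : U := (1, 0).

Let vmulDl (a b c : V) : (a + b) ** c = a ** c + b ** c.
Proof. exact: fprodDl. Qed.
Let vmulDr (a b c : V) : c ** (a + b) = c ** a + c ** b.
Proof. exact: fprodDr. Qed.
Let vmulZl (l : R[i]) (a b : V) : (l *: a) ** b = l *: (a ** b).
Proof. exact: fprodZl. Qed.
Let vmulZr (l : R[i]) (a b : V) : a ** (l *: b) = l *: (a ** b).
Proof. exact: fprodZr. Qed.
Let vmul0l (a : V) : 0 ** a = 0. Proof. exact: fprod0l. Qed.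
Let vmul0r (a : V) : a ** 0 = 0. Proof. exact: fprod0r. Qed.

Fact unitization_mulA : associative unitization_mul.
Proof.
move=> [l a] [m b] [n c]; congr (_, _) => /=; first exact: mulrA.
rewrite !vmulDl !vmulDr !vmulZl !vmulZr !scalerDr !scalerA (fprodA (n := x))// !addrA.
rewrite [n * l]mulrC [n * m]mulrC; f_equal.
rewrite -!addrA; do 2 f_equal; rewrite addrCA; f_equal.
by rewrite addrA addrC.
Qed.
Fact unitization_mul1 : left_id unitization_one unitization_mul.
Proof.
by move=> [l a]; congr (_, _) => /=; rewrite ?mul1r// scale1r scaler0 vmul0l !addr0.
Qed.
Fact unitization_1mul : right_id unitization_one unitization_mul.
Proof.
by move=> [l a]; congr (_, _) => /=; rewrite ?mulr1// scale1r scaler0 vmul0r addr0 add0r.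
Qed.
Fact unitization_mulDl : left_distributive unitization_mul +%R.
Proof.
move=> [l a] [m b] [n c]; congr (_, _) => /=; first exact: mulrDl.
by rewrite vmulDl scalerDl scalerDr [RHS]addrACA; f_equal; exact: addrACA.
Qed.
Fact unitization_mulDr : right_distributive unitization_mul +%R.
Proof.
move=> [l a] [m b] [n c]; congr (_, _) => /=; first exact: mulrDr.
by rewrite vmulDr scalerDl scalerDr [RHS]addrACA; f_equal; exact: addrACA.
Qed.
Fact unitization_1neq0 : unitization_one != 0.
Proof. by rewrite xpair_eqE oner_eq0. Qed.

HB.instance Definition _ := GRing.Zmodule_isNzRing.Build U unitization_mulA
  unitization_mul1 unitization_1mul unitization_mulDl unitization_mulDr
  unitization_1neq0.

Fact unitization_scaleAl (l : R[i]) (p q : U) : l *: (p * q) = (l *: p) * q.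
Proof.
case: p q => [m a] [n b]; congr (_, _) => /=; first exact: mulrA.
by rewrite vmulZl !scalerDr !scalerA [n * l]mulrC.
Qed.
HB.instance Definition _ := GRing.Lmodule_isLalgebra.Build R[i] U unitization_scaleAl.
Fact unitization_scaleAr (l : R[i]) (p q : U) : l *: (p * q) = p * (l *: q).
Proof.
case: p q => [m a] [n b]; congr (_, _) => /=; first by rewrite mulrCA.
by rewrite vmulZr !scalerDr !scalerA [m * l]mulrC.
Qed.
HB.instance Definition _ := GRing.Lalgebra_isAlgebra.Build R[i] U unitization_scaleAr.

Definition unitization_star (p : U) : U := ((p.1 : R[i])^*%C, fadj x p.2).

Definition unitization_act (p : U) (y : V) : V := (p.1 : R[i]) *: y + p.2 ** y.

(* Only a seminorm: it vanishes at (1, - e) if e is a unit of the fibre. *)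
Definition unitization_norm (p : U) : R :=
  sup [set vnorm (unitization_act p y) | y in [set y | vnorm y <= 1]].

Let act_le (p : U) (y : V) :
  vnorm (unitization_act p y) <= (complex.Re `|p.1 : R[i]| + vnorm p.2) * vnorm y.
Proof.
rewrite mulrDl; apply: le_trans (vnorm_leD _ _) _; rewrite vnormZ lerD2l.
exact: vnorm_fprod.
Qed.

Let act_sup (p : U) :
  has_sup [set vnorm (unitization_act p y) | y in [set y | vnorm y <= 1]].
Proof.
split; first by exists (vnorm (unitization_act p 0)), 0 => //=; rewrite vnorm0.
exists (complex.Re `|p.1 : R[i]| + vnorm p.2) => _ [y /= y1 <-].
apply: le_trans (act_le p y) _; apply: ler_piMr => //.
by rewrite addr_ge0 ?vnorm_ge0//; exact: Re_norm_ge0.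
Qed.

Let norm_ge0 (p : U) : 0 <= unitization_norm p.
Proof.
apply: le_trans (vnorm_ge0 (unitization_act p 0)) _.
by apply: (sup_ubound (act_sup p).2); exists 0 => //=; rewrite vnorm0.
Qed.

Let actZ (p : U) (l : R[i]) (y : V) :
  unitization_act p (l *: y) = l *: unitization_act p y.
Proof. by rewrite /unitization_act vmulZr scalerDr !scalerA mulrC. Qed.

Let act_norm (p : U) (y : V) :
  vnorm (unitization_act p y) <= unitization_norm p * vnorm y.
Proof.
have [y0|y0] := eqVneq (vnorm y) 0.
  by apply: le_trans (act_le p y) _; rewrite y0 !mulr0.
have yp : 0 < vnorm y by rewrite lt0r y0 vnorm_ge0.
rewrite -ler_pdivrMr//.
apply: (sup_ubound (act_sup p).2); exists ((vnorm y)^-1%:C *: y).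
  by rewrite /= vnormZr gtr0_norm ?invr_gt0// mulVf.
by rewrite actZ vnormZr gtr0_norm ?invr_gt0// mulrC.
Qed.

Let norm_le (p : U) (M : R) : 0 <= M ->
  (forall y, vnorm (unitization_act p y) <= M * vnorm y) -> unitization_norm p <= M.
Proof.
move=> M0 H; apply: ge_sup; first exact: (act_sup p).1.
by move=> _ [y /= y1 <-]; apply: le_trans (H y) _; rewrite ler_piMr.
Qed.

Let actM (p q : U) (y : V) :
  unitization_act (p * q) y = unitization_act p (unitization_act q y).
Proof.
case: p q => [l a] [m b]; rewrite /unitization_act /=.
rewrite !vmulDl !vmulDr !vmulZl !vmulZr scalerDr !scalerA (fprodA (n := x))//.
by rewrite -!addrA.
Qed.

Let fip_act (p : U) (y z : V) :
  fip x (unitization_act p y) z = fip x y (unitization_act (unitization_star p) z).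
Proof.
have e : gmul (ginv x) x = x by rewrite ixx.
rewrite /unitization_act fipDl// fipDr// fipZl// fipZr//; f_equal.
rewrite (fip_prodl (l := x))// [in RHS]/= [fip x p.2 z]fipE.
by rewrite /fadj ixx.
Qed.

(** Elements act on the fibre by left multiplication and carry the operator norm. The C*-identity
    comes from |p y|^2 = |y^* (p^* p y)| <= |p^* p| |y|^2, where [fip_act] moves p across the inner
    product. *)
Lemma unitization_cstar_seminorm : cstar_seminorm unitization_star unitization_norm.
Proof.
have leC p : unitization_norm p ^+ 2 <= unitization_norm (unitization_star p * p).
  set C := unitization_norm (_ * _).
  have C0 : 0 <= C by exact: norm_ge0.
  suff : unitization_norm p <= Num.sqrt C.
    by move=> h; rewrite -(sqr_sqrtr C0) lerXn2r ?nnegrE ?sqrtr_ge0.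
  apply: norm_le; first exact: sqrtr_ge0.
  move=> y; rewrite -(ler_pXn2r (ltn0Sn 1)) ?nnegrE ?mulr_ge0 ?vnorm_ge0 ?sqrtr_ge0//.
  rewrite exprMn sqr_sqrtr// -(vnorm_fip (x:=x))// fip_act -actM fipE.
  have c : composable (ginv x) x by rewrite ixx.
  apply: le_trans (vnorm_fprod _ _ c _) _; first by rewrite ixx.
  by rewrite vnorm_fadj// mulrC expr2 mulrA ler_wpM2r ?vnorm_ge0// act_norm.
have starK : involutive unitization_star.
  by move=> [l a]; congr (_, _) => /=; [exact: conjcK|rewrite fadjK].
have leM p q : unitization_norm (p * q) <= unitization_norm p * unitization_norm q.
  apply: norm_le; first by rewrite mulr_ge0.
  move=> y; rewrite actM; apply: le_trans (act_norm _ _) _.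
  by rewrite -mulrA ler_wpM2l.
have leS p : unitization_norm p <= unitization_norm (unitization_star p).
  have := le_trans (leC p) (leM _ _); have := norm_ge0 (unitization_star p).
  move: (unitization_norm _) (unitization_norm p) (norm_ge0 p) => a b b0 a0.
  have [->//|bn0] := eqVneq b 0.
  by rewrite expr2 ler_pM2r// lt0r bn0.
split => //.
- by move=> [l a] [m b]; congr (_, _) => /=; [exact: rmorphD|exact: fadjD].
- move=> [l a] [m b]; congr (_, _) => /=; first by rewrite rmorphM mulrC.
  rewrite !fadjD// !fadjZ// (fadj_prod (n := x) (l := x))//.
  by rewrite [_ *: fadj x b + _]addrC.
- by move=> l [m b]; congr (_, _) => /=; [exact: rmorphM|exact: fadjZ].
- move=> p q; apply: norm_le; first exact: addr_ge0.
  move=> y; have -> : unitization_act (p + q) y = unitization_act p y + unitization_act q y.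
    by rewrite /unitization_act vmulDl scalerDl addrACA.
  by rewrite mulrDl; apply: le_trans (vnorm_leD _ _) _; apply: lerD.
- have leZ (l : R[i]) p : unitization_norm (l *: p) <= complex.Re `|l| * unitization_norm p.
    have l0 : 0 <= complex.Re `|l| by exact: Re_norm_ge0.
    apply: norm_le; first by rewrite mulr_ge0.
    move=> y; have -> : unitization_act (l *: p) y = l *: unitization_act p y.
      by rewrite /unitization_act vmulZl scalerDr !scalerA.
    by rewrite vnormZ -mulrA ler_wpM2l.
  move=> l p; apply/le_anti; rewrite leZ andTb.
  have [->|l0] := eqVneq l 0; first by rewrite normr0 mul0r.
  have := leZ l^-1 (l *: p); rewrite scalerA mulVf// scale1r.
  have lp : 0 < complex.Re `|l| by rewrite -ltcR -norm_real_complex normr_gt0.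
  have -> : complex.Re `|l^-1| = (complex.Re `|l|)^-1.
    by rewrite normfV norm_real_complex -fmorphV.
  by rewrite ler_pdivlMl.
- move=> p; apply/le_anti; rewrite leC andbT expr2.
  apply: le_trans (leM _ _) _; rewrite ler_wpM2r//.
  by have := leS (unitization_star p); rewrite starK.
Qed.

(** The lower bound is found by letting v act on v^*, since |v v^*| = |v|^2. *)
Lemma unitization_norm_fibre (v : V) : unitization_norm (0, v) = vnorm v.
Proof.
apply/le_anti/andP; split.
  apply: norm_le; first exact: vnorm_ge0.
  by move=> y; rewrite /unitization_act scale0r add0r vnorm_fprod.
have := act_norm (0, v) (fadj x v).
rewrite /unitization_act /= scale0r add0r vnorm_fadj//.
have -> : v ** fadj x v = fip x (fadj x v) (fadj x v) by rewrite fipE ixx fadjK.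
rewrite vnorm_fip// vnorm_fadj//.
have := vnorm_ge0 v; have := norm_ge0 (0, v).
move: (vnorm v) (unitization_norm _) => a b b0 a0.
have [->//|an0] := eqVneq a 0.
by rewrite expr2 ler_pM2r// lt0r an0.
Qed.

Lemma unitization_starM (v : V) :
  unitization_star (0, v) * (0, v) = (0, fip x v v).
Proof.
congr (_, _) => /=; first by rewrite mulr0.
by rewrite oppr0 !scale0r !add0r fipE /fadj ixx.
Qed.

Lemma vnorm_le_sum_unit (I J : Type) (r : seq I) (s : seq J) (a : I -> V) (b : J -> V) :
  vnorm (\sum_(i <- r) fip x (a i) (a i)) <=
  vnorm (\sum_(i <- r) fip x (a i) (a i) + \sum_(j <- s) fip x (b j) (b j)).
Proof.
have E (K : Type) (t : seq K) (c : K -> V) :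
    \sum_(i <- t) unitization_star (0, c i) * (0, c i) =
    (0, \sum_(i <- t) fip x (c i) (c i)) :> U.
  elim/big_rec2: _ => [//|i y1 y2 _ ->].
  by rewrite unitization_starM; congr (_, _); rewrite /= addr0.
have := cstar_norm_le_sum unitization_cstar_seminorm r s
  (fun i => (0, a i) : U) (fun j => (0, b j) : U).
rewrite !E unitization_norm_fibre.
have -> : ((0, \sum_(i <- r) fip x (a i) (a i)) : U) +
    (0, \sum_(j <- s) fip x (b j) (b j)) =
    (0, \sum_(i <- r) fip x (a i) (a i) + \sum_(j <- s) fip x (b j) (b j)).
  by congr (_, _); rewrite /= addr0.
by rewrite unitization_norm_fibre.
Qed.

End Unitization.

(** * Cauchy-Schwarz for families over different arrows *)

Section CauchySchwarz.
Variables (R : realType) (G : etale_groupoid) (B : fell_bundle R G).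
Implicit Types g h k x : G.
Local Notation fibre := (fibre B).

Lemma fip_sumr (I : Type) (s : seq I) (P : pred I) k g h (v : fibre g)
    (F : I -> fibre h) : rng g = rng h -> gmul (ginv g) h = k ->
  fip k v (\sum_(i <- s | P i) F i) = \sum_(i <- s | P i) fip k v (F i).
Proof.
move=> gh e; rewrite fipE fprod_sumr//; last exact: composable_Vmul.
by apply: eq_bigr => i _; rewrite fipE.
Qed.

Lemma fip_suml (I : Type) (s : seq I) (P : pred I) k g h (F : I -> fibre g)
    (w : fibre h) : rng g = rng h -> gmul (ginv g) h = k ->
  fip k (\sum_(i <- s | P i) F i) w = \sum_(i <- s | P i) fip k (F i) w.
Proof.
move=> gh e; rewrite fipE fadj_sum// fprod_suml//; last exact: composable_Vmul.
by apply: eq_bigr => i _; rewrite fipE.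
Qed.

(** The single point where [fell_positive] enters. It makes v^* v the square of an element of the
    fibre over x, so that squares coming from different arrows can be added inside one
    C*-algebra. *)
Lemma fip_unit_repr x g (v : fibre g) : src g = x ->
  exists w : fibre x, fip x v v = fip x w w.
Proof.
move=> gx; have [b eb bb] := fell_positive (fibre_coe v).
have bx : bproj b = x.
  rewrite eb fell_proj_mul ?fell_proj_star ?bproj_coe// /fdom fell_proj_star bproj_coe.
  exact: composableVg.
exists (fib B x b); rewrite /fip fibE//.
by rewrite bb.
Qed.

Lemma vnorm_le_sum (I J : eqType) (r : seq I) (s : seq J) (al : I -> G) (be : J -> G)
    (c : forall i, fibre (al i)) (d : forall j, fibre (be j)) x :
  (forall i, i \in r -> src (al i) = x) -> (forall j, j \in s -> src (be j) = x) ->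
  units x ->
  vnorm (\sum_(i <- r) fip x (c i) (c i)) <=
  vnorm (\sum_(i <- r) fip x (c i) (c i) + \sum_(j <- s) fip x (d j) (d j)).
Proof.
move=> rx sx ux.
have repr (K : eqType) (t : seq K) (ga : K -> G) (e : forall i, fibre (ga i)) :
    (forall i, i \in t -> src (ga i) = x) -> exists e' : K -> fibre x,
    forall i, i \in t -> fip x (e i) (e i) = fip x (e' i) (e' i).
  move=> tx; have /choice[e' ee'] : forall i, exists w : fibre x,
      i \in t -> fip x (e i) (e i) = fip x w w.
    move=> i; have [/tx bx|_] := boolP (i \in t); last by exists 0.
    by have [w ->] := fip_unit_repr (e i) bx; exists w.
  by exists e'.
have [c' cc'] := repr _ _ _ c rx; have [d' dd'] := repr _ _ _ d sx.
by rewrite (eq_big_seq _ cc') (eq_big_seq _ dd'); exact: vnorm_le_sum_unit.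
Qed.

(** The optimal choice is e = 1 / a. For a = 0 the hypothesis reads 2 e n <= c, which e = (c + 1) /
    n refutes unless n = 0. *)
Lemma le_of_quadratic (a c n : R) : 0 <= a -> 0 <= c -> 0 <= n ->
  (forall e, 0 < e -> 2 * e * n <= e ^+ 2 * (n * a) + c) -> n <= a * c.
Proof.
move=> a0 c0 n0 H; have [a00|an0] := eqVneq a 0.
  subst a; rewrite mul0r leNgt; apply/negP => np.
  have e0 : 0 < (c + 1) / n by rewrite divr_gt0// ltr_wpDl.
  have := H _ e0; rewrite -mulrA divfK ?gt_eqF// mulr0 mulr0 add0r; lra.
have ap : 0 < a by rewrite lt0r an0.
have := H a^-1; rewrite invr_gt0 => /(_ ap).
have -> : a^-1 ^+ 2 * (n * a) = n / a by field; exact: lt0r_neq0.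
rewrite -mulrA [a^-1 * n]mulrC => h.
by rewrite -ler_pdivrMl// mulrC; lra.
Qed.

(* Positivity of the sum of |e a_i X - b_i|^2 for X = sum a_i^* b_i and e > 0. *)
Lemma fip_cauchy_schwarz (I : eqType) (s : seq I) (al be : I -> G)
    (a : forall i, fibre (al i)) (b : forall i, fibre (be i)) g y z :
  (forall i, i \in s -> rng (al i) = rng (be i) /\ gmul (ginv (al i)) (be i) = g) ->
  rng g = y -> src g = z ->
  vnorm (\sum_(i <- s) fip g (a i) (b i)) ^+ 2 <=
  vnorm (\sum_(i <- s) fip y (a i) (a i)) * vnorm (\sum_(i <- s) fip z (b i) (b i)).
Proof.
move=> H <- <-; set X := \sum_(i <- s) fip g _ _; set Aa := \sum_(i <- s) fip (rng g) _ _.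
set Bb := \sum_(i <- s) fip (src g) _ _.
have Hsrcb i : i \in s -> src (be i) = src g.
  by case/H => e <-; rewrite src_mul//; exact: composable_Vmul.
have Hsrca i : i \in s -> src (al i) = rng g.
  by case/H => e <-; rewrite rng_mul ?rng_inv//; exact: composable_Vmul.
have Hab i : i \in s -> gmul (al i) g = be i.
  by case/H => e <-; rewrite gmulV_l.
have eg : gmul (ginv g) g = src g by [].
have cg i : i \in s -> composable (al i) g by move/Hsrca.
have iu : ginv (src g) = src g by apply: inv_unit; exact: units_src.
rewrite -(vnorm_fip (x := src g))//.
apply: le_of_quadratic => [||| e e0]; try exact: vnorm_ge0.
pose aX i := fprod (be i) (a i) X.
pose d i := (e%:C *: aX i - b i).
pose xAx := fip (src g) X (fprod g Aa X).
have S1 : \sum_(i <- s) fip (src g) (aX i) (aX i) = xAx.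
  rewrite /xAx fprod_suml//; last 2 first.
  - by rewrite /composable src_rng.
  - exact: gmul_rng.
  rewrite fip_sumr//; apply: eq_big_seq => i /[dup] is_ /H[e1 e2].
  rewrite /aX (fip_prodl (l := g))//; [|exact: cg|exact: Hab].
  by rewrite (fip_prodr (l := rng g))//; [exact: cg|exact: Hab|exact: Hsrca].
have S2 : \sum_(i <- s) fip (src g) (aX i) (b i) = fip (src g) X X.
  rewrite {2}/X fip_sumr//; apply: eq_big_seq => i /[dup] is_ /H[e1 e2].
  by rewrite /aX (fip_prodl (l := g))//; [exact: cg|exact: Hab].
have S3 : \sum_(i <- s) fip (src g) (b i) (aX i) = fip (src g) X X.
  rewrite -[RHS](fadj_fip (k := src g))// -S2 fadj_sum//.
  by apply: eq_big_seq => i is_; rewrite fadj_fip//; exact: Hsrcb.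
have S4 : (e ^+ 2)%:C *: xAx + Bb =
    (2 * e)%:C *: fip (src g) X X + \sum_(i <- s) fip (src g) (d i) (d i).
  have -> : \sum_(i <- s) fip (src g) (d i) (d i) =
      (e ^+ 2)%:C *: xAx - e%:C *: fip (src g) X X - e%:C *: fip (src g) X X + Bb.
    rewrite -S1 -{1}S2 -S3 !scaler_sumr -!sumrB -big_split /=.
    apply: eq_big_seq => i /Hsrcb bx.
    rewrite /d fipDl// fipNl// !fipDr// !fipNr// !fipZl// !fipZr//.
    by rewrite !conjc_real opprB addrA [X in X = _]addrAC scalerA expr2 rmorphM.
  rewrite mulr_natl mulr2n rmorphD scalerDl addrA; f_equal.
  by rewrite [RHS]addrC -[X in _ = X + _]addrA -opprD subrK.
have D1 i : i \in s -> src (be i) = src g by exact: Hsrcb.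
(* Writing 2 e X^* X as the square of sqrt(2 e) X makes both terms on the right of [S4] sums of
   squares. Then [vnorm_le_sum], with a one-term family over g, discards the squares of the d i. *)
have fX : fip (src g) ((Num.sqrt (2 * e))%:C *: X) ((Num.sqrt (2 * e))%:C *: X) =
    (2 * e)%:C *: fip (src g) X X.
  rewrite fipZl// fipZr// conjc_real scalerA -rmorphM /= -expr2 sqr_sqrtr//.
  by rewrite mulr_ge0// ltW.
have := @vnorm_le_sum unit I [:: tt] s (fun=> g) be
  (fun=> (Num.sqrt (2 * e))%:C *: X) d (src g) (fun _ _ => erefl) D1 (units_src g).
rewrite big_seq1.
have e2 : 0 <= 2 * e by rewrite mulr_ge0// ltW.
rewrite fX -S4 vnormZr (ger0_norm e2) => le1; apply: le_trans le1 _.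
apply: le_trans (vnorm_leD _ _) _; rewrite lerD2r vnormZr ger0_norm ?sqr_ge0//.
rewrite ler_wpM2l ?sqr_ge0// /xAx fipE.
apply: le_trans (vnorm_fprod _ _ _ _) _ => //; first exact: composableVg.
rewrite vnorm_fadj// (vnorm_fip (x := src g))// expr2 -mulrA ler_wpM2l ?vnorm_ge0//.
rewrite mulrC; apply: vnorm_fprod; first by rewrite /composable src_rng.
exact: gmul_rng.
Qed.

End CauchySchwarz.

(** * Convolution and the two norms *)

Section FibreTopology.
Variables (R : realType) (X : topologicalType) (B : fibred_banach R X).

Lemma gt0_complexE (e : R[i]) : 0 < e -> e = (complex.Re e)%:C /\ 0 < complex.Re e.
Proof. by case: e => a b; rewrite ltcE /= => /andP[/eqP -> ?]. Qed.

Lemma fibre_cvgP x (T : Type) (F : set_system T) {FF : Filter F}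
    (f : T -> fibre B x) (l : fibre B x) :
  f @ F --> l <-> forall e : R, 0 < e -> \forall t \near F, vnorm (f t - l) < e.
Proof.
split=> [/cvgrPdist_lt H e e0|H].
  have := H e%:C; rewrite ltcR => /(_ e0); apply: filterS => t.
  by rewrite vnormE ltcR -vnormN opprB.
apply/cvgrPdist_lt => e /gt0_complexE[-> e0].
apply: filterS (H _ e0) => t.
by rewrite vnormE ltcR -vnormN opprB.
Qed.

End FibreTopology.

#[export] Instance finite_subsets_proper (I : choiceType) :
  ProperFilter (@finite_subsets I).
Proof.
apply: filter_from_proper; last by move=> A _; exists A => /=; exact: fsubset_refl.
apply: filter_from_filter; first by exists fset0.
move=> A A' _ _; exists (A `|` A')%fset => // F /=.
by rewrite fsubUset => /andP[].
Qed.

Section Convolution.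
Variables (R : realType) (G : etale_groupoid) (B : fell_bundle R G).
Implicit Types g h x d : G.
Implicit Types a b c f : fell_section B.
Local Notation fibre := (fibre B).

(* The summand of [convolution a b g] of the factorization (g d^-1, d). *)
Definition conv_term a b g d : fibre g :=
  if src d == src g then fprod g (a (gmul g (ginv d))) (b d) else 0.

(** The limit of [conv_partial] along [finite_subsets], reindexed by the right factor, which
    determines the left one. Arrows with the wrong source contribute 0, so D may be any finite set
    of arrows. *)
Definition conv_sum a b g (l : fibre g) : Prop := forall e : R, 0 < e ->
  exists D0 : {fset G}, forall D : {fset G}, (D0 `<=` D)%fset ->
    vnorm (\sum_(d <- D) conv_term a b g d - l) < e.

Arguments conv_sum a b g l : clear implicits.

Lemma conv_partialE a b g (F : {fset G * G}) (D : {fset G}) :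
  (forall d, src d = src g -> (d \in D) = ((gmul g (ginv d), d) \in F)) ->
  conv_partial a b g F = \sum_(d <- D) conv_term a b g d.
Proof.
move=> H; rewrite /conv_partial -[LHS]big_filter.
under [RHS]eq_bigr do rewrite /conv_term.
rewrite -big_mkcond -[RHS]big_filter.
transitivity (\sum_(p <- [seq (gmul g (ginv d), d) | d <- [seq d <- D | src d == src g]])
   fib B g (fmul (section_fun a p.1) (section_fun b p.2))); last by rewrite big_map.
apply: perm_big; apply: uniq_perm.
- by rewrite filter_uniq ?fset_uniq.
- by rewrite map_inj_uniq ?filter_uniq ?fset_uniq// => d d' [].
move=> [u v]; rewrite mem_filter; apply/andP/mapP => [[]|[d]].
  rewrite inE => -[/= uv ug] uvF.
  have vg : src v = src g by rewrite -ug src_mul.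
  have uE : u = gmul g (ginv v) by rewrite -ug egpd_mulKV.
  exists v; last by rewrite -uE.
  by rewrite mem_filter; apply/andP; split; [exact/eqP|rewrite H// -uE].
rewrite mem_filter => /andP[/eqP dg dD] [-> ->]; split; last by rewrite -H.
by rewrite inE; split; [exact: src_mulV|exact: gmulVK].
Qed.

Lemma conv_sum_cvg a b g l : conv_sum a b g l ->
  conv_partial a b g @ finite_subsets --> l.
Proof.
move=> H; apply/fibre_cvgP => e /H[D0 HD].
exists [fset (gmul g (ginv d), d) | d in D0]%fset => // F /= D0F.
pose D := (D0 `|` [fset p.2 | p in F & p.1 == gmul g (ginv p.2)])%fset.
rewrite (@conv_partialE _ _ _ _ D); first by apply: HD; exact: fsubsetUl.
move=> d dg; apply/idP/idP.
  rewrite inE => /orP[dD0|/imfsetP[[u v] /=]].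
    by apply: (fsubsetP D0F); apply/imfsetP; exists d.
  by rewrite inE /= => /andP[uvF /eqP ug] ->; rewrite -ug.
move=> dF; rewrite inE; apply/orP; right; apply/imfsetP.
by exists (gmul g (ginv d), d); rewrite //= !inE /= dF eqxx.
Qed.

Lemma cvg_conv_sum a b g l : conv_partial a b g @ finite_subsets --> l ->
  conv_sum a b g l.
Proof.
move=> /fibre_cvgP H e /H[F0 _ HF].
exists [fset p.2 | p in F0]%fset => D D0D.
pose F := (F0 `|` [fset (gmul g (ginv d), d) | d in D])%fset.
rewrite -(@conv_partialE _ _ _ F); first by apply: HF => /=; exact: fsubsetUl.
move=> d dg; apply/idP/idP.
  by move=> dD; rewrite inE; apply/orP; right; apply/imfsetP; exists d.
rewrite inE => /orP[dF0|/imfsetP[d' d'D [_ ->//]]].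
by apply: (fsubsetP D0D); apply/imfsetP; exists (gmul g (ginv d), d).
Qed.

Lemma conv_defined_sum a b : conv_defined a b ->
  forall g, conv_sum a b g (convolution a b g).
Proof. by move=> ab g; apply: cvg_conv_sum; exact: ab. Qed.

Lemma convolution_unique a b g l : conv_sum a b g l -> convolution a b g = l.
Proof.
move=> H; apply: cvg_lim; [exact: norm_hausdorff|exact: conv_sum_cvg].
Qed.

Lemma conv_sum_eq a b c : (forall g, conv_sum a b g (c g)) ->
  conv_defined a b /\ convolution a b = c.
Proof.
move=> H; split; last first.
  by apply: functional_extensionality_dep => g; exact: convolution_unique.
by move=> g; apply/cvg_ex; exists (c g); exact: conv_sum_cvg.
Qed.

Lemma conv_sum_fin a b g (D : {fset G}) :
  (forall d, d \notin D -> src d = src g -> conv_term a b g d = 0) ->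
  conv_sum a b g (\sum_(d <- D) conv_term a b g d).
Proof.
move=> H e e0; exists D => D' DD'.
rewrite -(big_fset_incl _ DD') ?subrr ?vnorm0// => d _ dD.
have [dg|dg] := eqVneq (src d) (src g); first exact: H.
by rewrite /conv_term (negbTE dg).
Qed.

Lemma conv_termDl a a' b g d :
  conv_term (a + a') b g d = conv_term a b g d + conv_term a' b g d.
Proof.
rewrite /conv_term; case: eqP => [dg|_]; last by rewrite addr0.
by rewrite fprodDl// ?gmulVK// /composable src_mulV.
Qed.

Lemma conv_termDr a b b' g d :
  conv_term a (b + b') g d = conv_term a b g d + conv_term a b' g d.
Proof.
rewrite /conv_term; case: eqP => [dg|_]; last by rewrite addr0.
by rewrite fprodDr// ?gmulVK// /composable src_mulV.
Qed.

Lemma conv_termZl (l : R[i]) a b g d :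
  conv_term (l *: a) b g d = l *: conv_term a b g d.
Proof.
rewrite /conv_term; case: eqP => [dg|_]; last by rewrite scaler0.
by rewrite fprodZl// ?gmulVK// /composable src_mulV.
Qed.

Lemma conv_termZr (l : R[i]) a b g d :
  conv_term a (l *: b) g d = l *: conv_term a b g d.
Proof.
rewrite /conv_term; case: eqP => [dg|_]; last by rewrite scaler0.
by rewrite fprodZr// ?gmulVK// /composable src_mulV.
Qed.

Lemma conv_term0l a b g d : a (gmul g (ginv d)) = 0 -> conv_term a b g d = 0.
Proof.
move=> a0; rewrite /conv_term; case: eqP => // dg.
by rewrite a0 fprod0l// ?gmulVK// /composable src_mulV.
Qed.

Lemma conv_term0r a b g d : b d = 0 -> conv_term a b g d = 0.
Proof.
move=> b0; rewrite /conv_term; case: eqP => // dg.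
by rewrite b0 fprod0r// ?gmulVK// /composable src_mulV.
Qed.

Lemma conv_sumD a b a' b' a'' b'' g l l' : conv_sum a b g l -> conv_sum a' b' g l' ->
  (forall d, conv_term a'' b'' g d = conv_term a b g d + conv_term a' b' g d) ->
  conv_sum a'' b'' g (l + l').
Proof.
move=> H H' E e e0; have e2 : 0 < e / 2 by rewrite divr_gt0.
have [D0 HD] := H _ e2; have [D0' HD'] := H' _ e2.
exists (D0 `|` D0')%fset => D; rewrite fsubUset => /andP[/HD h /HD' h'].
under eq_bigr do rewrite E; rewrite big_split /= opprD addrACA.
by apply: le_lt_trans (vnorm_leD _ _) _; lra.
Qed.

Lemma conv_sumZ a b a' b' (k : R[i]) g l : conv_sum a b g l ->
  (forall d, conv_term a' b' g d = k *: conv_term a b g d) ->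
  conv_sum a' b' g (k *: l).
Proof.
move=> H E e e0; have k0 := Re_norm_ge0 k.
have k1 : 0 < complex.Re `|k| + 1 by rewrite ltr_wpDl.
have [D0 HD] := H _ (divr_gt0 e0 k1).
exists D0 => D /HD h; under eq_bigr do rewrite E.
rewrite -scaler_sumr -scalerBr vnormZ.
move: h; rewrite ltr_pdivlMr// => h; apply: le_lt_trans h.
by rewrite mulrC ler_wpM2l ?vnorm_ge0// lerDl.
Qed.

End Convolution.

Arguments conv_sum {R G B} a b g l.
Arguments conv_term {R G B} a b g d.

Lemma perm_sub_cat (T : eqType) (s t : seq T) : uniq s -> uniq t ->
  {subset t <= s} -> perm_eq s (t ++ [seq x <- s | x \notin t]).
Proof.
move=> us ut ts; apply: uniq_perm => //.
  rewrite cat_uniq ut filter_uniq// andbT/=.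
  by apply/hasPn => x; rewrite mem_filter => /andP[].
move=> x; rewrite mem_cat mem_filter.
by have [/ts ->|] := boolP (x \in t).
Qed.

Lemma esup0_le (R : realType) (A : set (\bar R)) (c : R) : 0 <= c ->
  ((esup0 A <= c%:E)%E <-> forall y, A y -> (y <= c%:E)%E).
Proof.
move=> c0; split=> [/ereal_supP H y Ay|H].
  by apply: H; right.
by apply/ereal_supP => y [->|/H//]; rewrite lee_fin.
Qed.

Lemma esup0_ge0 (R : realType) (A : set (\bar R)) : (0 <= esup0 A)%E.
Proof. by apply: le_ereal_sup_tmp; exists 0%E => //; left. Qed.

(** * Norms of finite columns *)

Section ColumnNorm.
Variables (R : realType) (G : etale_groupoid) (B : fell_bundle R G).
Implicit Types g h x d : G.
Implicit Types s t : seq G.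
Implicit Types a b c f : fell_section B.
Local Notation fibre := (fibre B).
Local Notation "s '\insrc' x" := (forall g, g \in s -> src g = x) (at level 70).

(** The Hilbert-module norm of a finite column over x, meaningful when all arrows of s have source
    x. Sequences are used so that columns can be filtered and mapped; uniqueness becomes a
    hypothesis where it matters. *)
Definition col_norm a x s : R := Num.sqrt (vnorm (\sum_(g <- s) fip x (a g) (a g))).

Lemma col_norm_ge0 a x s : 0 <= col_norm a x s.
Proof. exact: sqrtr_ge0. Qed.

Lemma col_norm_sqr a x s : col_norm a x s ^+ 2 = vnorm (\sum_(g <- s) fip x (a g) (a g)).
Proof. by rewrite sqr_sqrtr// vnorm_ge0. Qed.

Lemma fip_sum_le a b x s : units x -> s \insrc x ->
  vnorm (\sum_(g <- s) fip x (a g) (b g)) <= col_norm a x s * col_norm b x s.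
Proof.
move=> ux sx.
rewrite -(ler_pXn2r (ltn0Sn 1)) ?nnegrE ?mulr_ge0 ?vnorm_ge0 ?col_norm_ge0//.
rewrite exprMn !col_norm_sqr.
by apply: (@fip_cauchy_schwarz _ _ _ _ s id id a b) => //; [move=> g /sx gx; split|exact: rng_unit].
Qed.

Lemma col_normD a b x s : units x -> s \insrc x ->
  col_norm (a + b) x s <= col_norm a x s + col_norm b x s.
Proof.
move=> ux sx; rewrite -(ler_pXn2r (ltn0Sn 1)) ?nnegrE ?addr_ge0 ?col_norm_ge0//.
rewrite col_norm_sqr.
have -> : \sum_(g <- s) fip x ((a + b) g) ((a + b) g) =
    (\sum_(g <- s) fip x (a g) (a g) + \sum_(g <- s) fip x (a g) (b g)) +
    (\sum_(g <- s) fip x (b g) (a g) + \sum_(g <- s) fip x (b g) (b g)).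
  rewrite -!big_split /=; apply: eq_big_seq => g /sx gx.
  by rewrite -[(a + b) g]/(a g + b g) fipDl// !fipDr.
have h1 := vnorm_leD (\sum_(g <- s) fip x (a g) (a g) + \sum_(g <- s) fip x (a g) (b g))
  (\sum_(g <- s) fip x (b g) (a g) + \sum_(g <- s) fip x (b g) (b g)).
have h2 := vnorm_leD (\sum_(g <- s) fip x (a g) (a g)) (\sum_(g <- s) fip x (a g) (b g)).
have h3 := vnorm_leD (\sum_(g <- s) fip x (b g) (a g)) (\sum_(g <- s) fip x (b g) (b g)).
have h4 := fip_sum_le a b ux sx; have h5 := fip_sum_le b a ux sx.
rewrite sqrrD mulr2n !col_norm_sqr; lra.
Qed.

Lemma col_normZ (l : R[i]) a x s : s \insrc x ->
  col_norm (l *: a) x s = complex.Re `|l| * col_norm a x s.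
Proof.
move=> sx; rewrite /col_norm.
have -> : \sum_(g <- s) fip x ((l *: a) g) ((l *: a) g) =
    l^*%C *: (l *: \sum_(g <- s) fip x (a g) (a g)).
  rewrite !scaler_sumr; apply: eq_big_seq => g /sx gx.
  by rewrite -[(l *: a) g]/(l *: a g) fipZl// fipZr.
have l0 := Re_norm_ge0 l.
rewrite !vnormZ normcJ mulrA -expr2 sqrtrM ?sqr_ge0// sqrtr_sqr ger0_norm//.
Qed.

Lemma perm_col_norm a x s t : perm_eq s t -> col_norm a x s = col_norm a x t.
Proof. by move=> st; rewrite /col_norm (perm_big _ st). Qed.

Lemma col_norm_sub a x s t : units x -> uniq s -> uniq t -> {subset t <= s} ->
  s \insrc x -> col_norm a x t <= col_norm a x s.
Proof.
move=> ux us ut ts sx; rewrite (perm_col_norm _ _ (perm_sub_cat us ut ts)).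
rewrite /col_norm big_cat /= ler_wsqrtr//.
apply: (@vnorm_le_sum _ _ _ _ _ _ _ id id a a) => //; first by move=> g /ts/sx.
by move=> g; rewrite mem_filter => /andP[_ /sx].
Qed.

Lemma col_norm_le_sum a x s : s \insrc x ->
  col_norm a x s <= \sum_(g <- s) vnorm (a g).
Proof.
move=> sx.
have S0 (t : seq G) : 0 <= \sum_(g <- t) vnorm (a g).
  by apply: sumr_ge0 => g _; exact: vnorm_ge0.
rewrite -(ler_pXn2r (ltn0Sn 1)) ?nnegrE ?col_norm_ge0// col_norm_sqr.
apply: le_trans (vnorm_sum _ _ _) _.
have -> : \sum_(g <- s) vnorm (fip x (a g) (a g)) = \sum_(g <- s) vnorm (a g) ^+ 2.
  by apply: eq_big_seq => g /sx gx; rewrite vnorm_fip.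
elim: s {sx} => [|g s IH]; first by rewrite !big_nil expr0n.
rewrite !big_cons sqrrD; have := S0 s; have := vnorm_ge0 (a g).
move: IH; move: (\sum_(_ <- _) _) (\sum_(_ <- _) _) (vnorm (a g)) => u v w.
by rewrite mulr2n => IHu w0 v0; have := mulr_ge0 w0 v0; lra.
Qed.

Lemma col_norm1 a g : col_norm a (src g) [:: g] = vnorm (a g).
Proof. by rewrite /col_norm big_seq1 vnorm_fip// sqrtr_sqr ger0_norm// vnorm_ge0. Qed.

Definition norm2_bound a (D : R) : Prop :=
  forall x s, uniq s -> s \insrc x -> units x -> col_norm a x s <= D.

Lemma norm2_leP a D : 0 <= D -> (norm2 a <= D%:E)%E <-> norm2_bound a D.
Proof.
move=> D0; rewrite /norm2 (esup0_le _ D0); split=> [H x s us sx ux|H y].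
  pose F : {fset G} := [fset g in s]%fset.
  have : (esup0 [set (Num.sqrt (vnorm (\sum_(g <- F)
         fib B x (fmul (fstar (section_fun a g)) (section_fun a g)))))%:E
    | F in [set F : {fset G} | forall g, g \in F -> src g = x]] <= D%:E)%E.
    by apply: H; exists x.
  move/(esup0_le _ D0) => /(_ (col_norm a x s)%:E); rewrite lee_fin; apply.
  have Fs : perm_eq (enum_fset F) s.
    by apply: uniq_perm => // g; rewrite in_fset.
  exists F => [g /=|]; first by rewrite in_fset => /sx.
  by rewrite -(perm_col_norm a x Fs).
move=> [x ux <-]; apply/(esup0_le _ D0) => z [F /= HF <-].
by rewrite lee_fin; apply: H => //; exact: fset_uniq.
Qed.

End ColumnNorm.

(** * The norm |.|_b as a bound over finitely supported sections *)

Section NormB.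
Variables (R : realType) (G : etale_groupoid) (B : fell_bundle R G).
Implicit Types g h x d : G.
Implicit Types s t : seq G.
Implicit Types a b c f u : fell_section B.
Implicit Types S D T : {fset G}.
Local Notation fibre := (fibre B).
Local Notation "s '\insrc' x" := (forall g, g \in s -> src g = x) (at level 70).

Definition supported_in f S := forall g, g \notin S -> f g = 0.

Lemma finite_suppP f : finite_set (supp f) <-> exists S, supported_in f S.
Proof.
split=> [/finite_fsetP[S fS]|[S fS]].
  exists S => g gS; apply/eqP; apply: contraNT gS => fg.
  by have : supp f g by []; rewrite fS.
apply: (sub_finite_set (B := [set` S])); last exact: finite_fset.
by move=> g; rewrite /supp /=; apply: contraNT => /fS ->.
Qed.

Lemma conv_sum_supported a f S g : supported_in f S ->
  conv_sum a f g (\sum_(d <- S) conv_term a f g d).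
Proof. by move=> fS; apply: conv_sum_fin => d /fS f0 _; exact: conv_term0r. Qed.

Lemma convolution_supported a f S g : supported_in f S ->
  convolution a f g = \sum_(d <- S) conv_term a f g d.
Proof. by move=> fS; apply: convolution_unique; exact: conv_sum_supported. Qed.

Lemma norm2_bound_supported f S : supported_in f S ->
  exists2 D : R, 0 <= D & norm2_bound f D.
Proof.
move=> fS; exists (\sum_(g <- S) vnorm (f g)).
  by apply: sumr_ge0 => g _; exact: vnorm_ge0.
move=> x s us sx _; apply: le_trans (col_norm_le_sum _ sx) _.
pose t := [seq g <- s | g \in S].
have -> : \sum_(g <- s) vnorm (f g) = \sum_(g <- t) vnorm (f g).
  rewrite big_filter [RHS]big_mkcond; apply: eq_bigr => g _.
  by case: (boolP (g \in S)) => // /fS ->; rewrite vnorm0.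
have /(perm_big _)-> : perm_eq (enum_fset S) (t ++ [seq g <- S | g \notin t]).
  apply: perm_sub_cat; rewrite ?fset_uniq ?filter_uniq//.
  by move=> g; rewrite mem_filter => /andP[].
rewrite big_cat /= lerDl; apply: sumr_ge0 => g _; exact: vnorm_ge0.
Qed.

Lemma norm2_bound_le a (D D' : R) : D <= D' -> norm2_bound a D -> norm2_bound a D'.
Proof. by move=> DD' H x s us sx ux; apply: le_trans DD'; exact: H. Qed.

(** D is any bound for the norm of f instead of the norm itself, so neither a quotient nor an
    extended real appears. *)
Definition normb_bound a (C : R) : Prop :=
  forall f S (D : R), supported_in f S -> 0 <= D -> norm2_bound f D ->
    norm2_bound (convolution a f) (C * D).

Lemma normb_leP a (C : R) : 0 <= C -> (normb a <= C%:E)%E <-> normb_bound a C.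
Proof.
move=> C0; rewrite /normb (esup0_le _ C0); 
split=> [H f S D fS D0 fD|H _ [f /finite_suppP[S fS] <-]].
  have fin : finite_set (supp f) by apply/finite_suppP; exists S.
  have [E E0 fE] : exists2 E : R, 0 <= E & norm2 f = E%:E.
    have := esup0_ge0 _ : (0 <= norm2 f)%E.
    have := (norm2_leP f D0).2 fD.
    by case: (norm2 f) => // r _ r0; exists r.
  have ED : E <= D by rewrite -lee_fin -fE; apply/norm2_leP.
  have := H (norm2 (convolution a f) / norm2 f)%E; rewrite fE.
  move=> /(_ (ex_intro2 _ _ f fin (congr1 (fun z => (_ / z)%E) fE))).
  (* For E = 0 the quotient is bypassed: one-point columns show that f = 0, hence every value of the
     convolution is 0. *)
  have [E00|En0] := eqVneq E 0.
    move=> _; have f0 : f = 0.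
      apply: functional_extensionality_dep => g; apply: vnorm_eq0; apply/le_anti.
      rewrite vnorm_ge0 andbT -col_norm1.
      have : norm2_bound f 0 by apply/norm2_leP => //; rewrite fE E00.
      apply => //; last exact: units_src.
      by move=> h; rewrite inE => /eqP ->.
    move=> x s us sx ux; apply: (@le_trans _ _ 0); last exact: mulr_ge0.
    apply: le_trans (col_norm_le_sum _ sx) _.
    rewrite big1// => g _; rewrite (convolution_supported a g fS) big1 ?vnorm0// => d _.
    by rewrite conv_term0r// f0.
  have Ep : 0 < E by rewrite lt0r En0.
  rewrite inver (negbTE En0) lee_pdivrMr// => le1.
  apply/norm2_leP; first exact: mulr_ge0.
  by apply: le_trans le1 _; rewrite -EFinM lee_fin ler_wpM2l.
have [D D0 fD] := norm2_bound_supported fS.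
have [E E0 fE] : exists2 E : R, 0 <= E & norm2 f = E%:E.
  have := esup0_ge0 _ : (0 <= norm2 f)%E.
  have := (norm2_leP f D0).2 fD.
  by case: (norm2 f) => // r _ r0; exists r.
have fE' : norm2_bound f E by apply/norm2_leP => //; rewrite fE.
have := H f S E fS E0 fE'; rewrite -(norm2_leP _ (mulr_ge0 C0 E0)) fE inver.
have [->|En0] := eqVneq E 0.
  rewrite mulr0 => le0.
  have -> : norm2 (convolution a f) = 0%E.
    by apply/le_anti; rewrite le0 esup0_ge0.
  by rewrite mul0e lee_fin.
by move=> le1; rewrite lee_pdivrMr ?lt0r ?En0.
Qed.

Lemma convolutionDl a b f S : supported_in f S ->
  convolution (a + b) f = convolution a f + convolution b f.
Proof.
move=> fS; apply: functional_extensionality_dep => g.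
rewrite -[RHS]/(_ g + _ g) !(convolution_supported _ g fS) -big_split /=.
by apply: eq_bigr => d _; rewrite conv_termDl.
Qed.

Lemma convolutionZl (l : R[i]) a f S : supported_in f S ->
  convolution (l *: a) f = l *: convolution a f.
Proof.
move=> fS; apply: functional_extensionality_dep => g.
rewrite -[RHS]/(l *: _ g) !(convolution_supported _ g fS) scaler_sumr.
by apply: eq_bigr => d _; rewrite conv_termZl.
Qed.

Lemma norm2_boundD a b (D E : R) : norm2_bound a D -> norm2_bound b E ->
  norm2_bound (a + b) (D + E).
Proof.
move=> aD bE x s us sx ux; apply: le_trans (col_normD _ _ ux sx) _.
by apply: lerD; [exact: aD|exact: bE].
Qed.

Lemma norm2_boundZ (l : R[i]) a (D : R) : norm2_bound a D ->
  norm2_bound (l *: a) (complex.Re `|l| * D).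
Proof.
move=> aD x s us sx ux; rewrite col_normZ// ler_wpM2l ?Re_norm_ge0//; exact: aD.
Qed.

Lemma normb_boundD a b (C E : R) : normb_bound a C -> normb_bound b E ->
  normb_bound (a + b) (C + E).
Proof.
move=> aC bE f S D fS D0 fD; rewrite (convolutionDl _ _ fS) mulrDl.
by apply: norm2_boundD; [exact: aC fS D0 fD|exact: bE fS D0 fD].
Qed.

Lemma normb_boundZ (l : R[i]) a (C : R) : normb_bound a C ->
  normb_bound (l *: a) (complex.Re `|l| * C).
Proof.
move=> aC f S D fS D0 fD; rewrite (convolutionZl _ _ fS) -mulrA.
by apply: norm2_boundZ; exact: aC fS D0 fD.
Qed.

Lemma normb_bound_le a (C C' : R) : C <= C' -> normb_bound a C -> normb_bound a C'.
Proof.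
move=> CC' aC f S D fS D0 fD; apply: norm2_bound_le (aC _ _ _ fS D0 fD).
exact: ler_wpM2r.
Qed.

(* Supported at x, since [fib B g b] is 0 if b is not over g. *)
Definition single_section x (h : fibre x) : fell_section B := fun g => fib B g (fibre_coe h).

Lemma single_sectionE x (h : fibre x) : single_section h x = h.
Proof. exact: fibre_coeK. Qed.

Lemma single_section_supported x (h : fibre x) :
  supported_in (single_section h) [fset x]%fset.
Proof.
move=> g; rewrite inE => gx; rewrite /single_section /fib.
by case: pselect => // e; case/eqP: gx; rewrite -[LHS]e bproj_coe.
Qed.

Lemma norm2_bound_single x (h : fibre x) : norm2_bound (single_section h) (vnorm h).
Proof.
move=> y s us sy uy; apply: le_trans (col_norm_le_sum _ sy) _.
have h0 g : g != x -> vnorm (single_section h g) = 0.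
  by move=> gx; rewrite single_section_supported ?vnorm0// inE.
have [xs|xs] := boolP (x \in s).
  rewrite (bigD1_seq x)//= single_sectionE big1 ?addr0// => g; exact: h0.
rewrite big1_seq ?vnorm_ge0// => g /andP[_ gs]; apply: h0.
by apply: contraNneq xs => <-.
Qed.

Lemma convolution_single a x (h : fibre x) g : units x -> src g = x ->
  convolution a (single_section h) g = fprod g (a g) h.
Proof.
move=> ux gx; rewrite (convolution_supported _ _ (@single_section_supported _ h)).
rewrite big_seq_fset1 /conv_term ux gx eqxx single_sectionE.
have : gmul g (ginv x) = g by rewrite inv_unit// -gx gmul_src.
by move: (gmul _ _) => k ->.
Qed.

(* With h the column sum of a at x, a h has column sum h^3, of norm |h|^3. *)
Lemma normb_bound_norm2 a (C : R) : 0 <= C -> normb_bound a C -> norm2_bound a C.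
Proof.
move=> C0 aC x s us sx ux.
pose h := \sum_(g <- s) fip x (a g) (a g).
have cxx : composable x x by rewrite /composable rng_unit.
have ixx := inv_unit ux.
have mxx : gmul x x = x by rewrite -[X in gmul _ X]ux gmul_src.
have mVx : gmul (ginv x) x = x by exact: ux.
have hs : fadj x h = h.
  rewrite /h fadj_sum//; apply: eq_big_seq => g /sx gx; rewrite fadj_fip//.
have := aC _ _ _ (@single_section_supported _ h) (vnorm_ge0 h) (@norm2_bound_single _ h)
  x s us sx ux.
set af := convolution _ _ => le1.
have afE : col_norm af x s ^+ 2 = vnorm h ^+ 3.
  rewrite col_norm_sqr.
  have -> : \sum_(g <- s) fip x (af g) (af g) = fip x h (fprod x h h).
    rewrite {2}/h fprod_suml// fip_sumr//; apply: eq_big_seq => g gs.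
    have gx := sx _ gs; rewrite /af convolution_single//.
    have cgx : composable g x by rewrite /composable gx rng_unit.
    have mgx : gmul g x = g by rewrite -gx gmul_src.
    by rewrite (fip_prodl (l := x))// (fip_prodr (l := x)).
  have fE v w : fadj x v = v -> fip x v w = fprod x (v : fibre x) (w : fibre x).
    by move=> vs; rewrite fipE ixx vs.
  have hhs : fadj x (fprod x h h) = fprod x h h.
    by rewrite (fadj_prod (n := x) (l := x))// hs.
  have h2 : vnorm (fprod x h h) = vnorm h ^+ 2 by rewrite -fE// vnorm_fip.
  rewrite fE//; apply/le_anti/andP; split.
    apply: le_trans (vnorm_fprod _ _ _ _) _ => //.
    by rewrite h2 exprS.
  have [->|hn0] := eqVneq (vnorm h) 0; first by rewrite expr0n vnorm_ge0.
  have hp : 0 < vnorm h by rewrite lt0r hn0 vnorm_ge0.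
  rewrite -(ler_pM2l hp) -exprS.
  (* The lower bound for |h^3| comes from |h|^4 = |h^2 h^2| <= |h| |h^3|, where the equality is the
     C*-identity applied twice to the self-adjoint h. *)
  have -> : vnorm h ^+ 4 = vnorm (fprod x (fprod x h h) (fprod x h h)).
    by rewrite -fE// vnorm_fip// h2 -exprM.
  by rewrite (fprodA (n := x))//; exact: vnorm_fprod.
rewrite -(ler_pXn2r (ltn0Sn 1)) ?nnegrE ?col_norm_ge0// col_norm_sqr -/h.
have : vnorm h ^+ 3 <= (C * vnorm h) ^+ 2.
  by rewrite -afE lerXn2r ?nnegrE ?col_norm_ge0 ?mulr_ge0 ?vnorm_ge0.
have [->|hn0] := eqVneq (vnorm h) 0; first by rewrite sqr_ge0.
have hp : 0 < vnorm h ^+ 2 by rewrite exprn_gt0// lt0r hn0 vnorm_ge0.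
by rewrite exprS exprMn ler_pM2r.
Qed.

End NormB.

(** * Adjoints and products of |.|_b-bounded sections *)

Section BigCstar.
Variables (R : realType) (G : etale_groupoid) (B : fell_bundle R G).
Implicit Types g h x d : G.
Implicit Types s t : seq G.
Implicit Types a b c f u : fell_section B.
Implicit Types S D T : {fset G}.
Local Notation fibre := (fibre B).
Local Notation "s '\insrc' x" := (forall g, g \in s -> src g = x) (at level 70).

Lemma section_starE a g h : h = ginv g -> section_star a g = fadj g (a h).
Proof. by move=> ->. Qed.

Lemma section_starD a b : section_star (a + b) = section_star a + section_star b.
Proof.
apply: functional_extensionality_dep => g; rewrite -[RHS]/(_ g + _ g).
by rewrite !(section_starE _ (erefl (ginv g))) -fadjD// egpd_invK.
Qed.

Lemma section_starZ (l : R[i]) a : section_star (l *: a) = l^*%C *: section_star a.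
Proof.
apply: functional_extensionality_dep => g; rewrite -[RHS]/(_ *: _ g).
by rewrite !(section_starE _ (erefl (ginv g))) -fadjZ// egpd_invK.
Qed.

Lemma fip_section_star a g h (w : fibre h) k : rng g = rng h ->
  fip k (section_star a g) w = fprod k (a (ginv g)) w.
Proof.
by move=> gh; rewrite fipE (section_starE _ (erefl _)) fadjK// egpd_invK.
Qed.

(* The summands of [convolution a b] at g pair the column of a^* at the range of g
   with the column of b at the source of g. *)
Lemma conv_sum_le a b g s : uniq s ->
  vnorm (\sum_(d <- s) conv_term a b g d) <=
  col_norm (section_star a) (rng g) [seq gmul d (ginv g) | d <- s & src d == src g] *
  col_norm b (src g) [seq d <- s | src d == src g].
Proof.
move=> us; rewrite -big_mkcond -big_filter /=; set t := [seq d <- s | _].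
have tg : t \insrc src g by move=> d; rewrite mem_filter => /andP[/eqP].
rewrite -(ler_pXn2r (ltn0Sn 1)) ?nnegrE ?mulr_ge0 ?vnorm_ge0 ?col_norm_ge0//.
rewrite exprMn !col_norm_sqr big_map.
have -> : \sum_(d <- t) fprod g (a (gmul g (ginv d))) (b d) =
    \sum_(d <- t) fip g (section_star a (gmul d (ginv g))) (b d).
  apply: eq_big_seq => d /tg dg.
  have e : gmul g (ginv d) = ginv (gmul d (ginv g)).
    by rewrite inv_mul ?egpd_invK// /composable rng_inv.
  by rewrite fip_section_star ?rng_mulV// -e.
apply: fip_cauchy_schwarz => // d /tg dg.
rewrite rng_mulV//; split => //.
rewrite inv_mul ?egpd_invK ?gmulVK//; by rewrite /composable rng_inv.
Qed.

Lemma inv_mulV g h : src g = src h -> ginv (gmul g (ginv h)) = gmul h (ginv g).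
Proof. by move=> gh; rewrite inv_mul ?egpd_invK// /composable rng_inv. Qed.

Lemma convolution_seq a f g t : uniq t -> (forall d, d \notin t -> f d = 0) ->
  convolution a f g = \sum_(d <- t | src d == src g) fprod g (a (gmul g (ginv d))) (f d).
Proof.
move=> ut ft; rewrite big_mkcond (@convolution_supported _ _ _ a f [fset d in t]%fset).
  apply: perm_big; apply: uniq_perm => // d; by rewrite in_fset.
by move=> d; rewrite in_fset => /ft.
Qed.

Lemma convolution_supported_filter a f g S : supported_in f S ->
  convolution a f g =
  \sum_(d <- S | src d == src g) fprod g (a (gmul g (ginv d))) (f d).
Proof. by move=> fS; apply: convolution_seq => //; exact: fset_uniq. Qed.

Definition restrict_section s u : fell_section B := fun g => if g \in s then u g else 0.

Lemma restrict_section_supported s u :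
  supported_in (restrict_section s u) [fset g in s]%fset.
Proof. by move=> g; rewrite in_fset /restrict_section => /negbTE ->. Qed.

Lemma col_norm_restrict s u x t : t \insrc x ->
  col_norm (restrict_section s u) x t = col_norm u x [seq g <- t | g \in s].
Proof.
move=> tx; rewrite /col_norm big_filter [in RHS]big_mkcond.
congr (Num.sqrt (vnorm _)); apply: eq_big_seq => g /tx gx.
by rewrite /restrict_section; case: ifP => // _; rewrite fip0r.
Qed.

Lemma norm2_bound_restrict s u (D : R) : norm2_bound u D ->
  norm2_bound (restrict_section s u) D.
Proof.
move=> uD x t ut tx ux; rewrite col_norm_restrict//; apply: uD => //.
  exact: filter_uniq.
by move=> g; rewrite mem_filter => /andP[_ /tx].
Qed.

Lemma norm2_bound_restrict_col s u x : units x -> uniq s -> s \insrc x ->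
  norm2_bound (restrict_section s u) (col_norm u x s).
Proof.
move=> ux us sx y t ut ty uy; rewrite col_norm_restrict//.
have [xy|xy] := eqVneq x y.
  subst y; apply: col_norm_sub => //; first exact: filter_uniq.
  by move=> g; rewrite mem_filter => /andP[].
rewrite (_ : [seq g <- t | g \in s] = [::]).
  by rewrite /col_norm big_nil vnorm0 sqrtr0 sqrtr_ge0.
apply/eqP; rewrite -[_ == _]negbK -has_filter; apply/negP => /hasP[g gt gs].
by move: xy; rewrite -(sx _ gs) (ty _ gt) eqxx.
Qed.

(** Left convolution by a acts on a column as the matrix with entry a (p g^-1) at (p, g). This is
    the adjoint relation between the entries of a and those of a^*. *)
Lemma fip_adj a p g x (v : fibre g) (z : fibre p) : src p = x -> src g = x ->
  fip x (fprod p (a (gmul p (ginv g))) v) z =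
  fip x v (fprod g (section_star a (gmul g (ginv p))) z).
Proof.
move=> px gx; have pg : src p = src g by rewrite px.
rewrite (fip_prodl (l := g))//.
- by rewrite (fipE g) (section_starE _ (esym (inv_mulV (esym pg)))) inv_mulV.
- by rewrite /composable src_mulV.
- exact: gmulVK.
- exact: rng_mulV.
- by rewrite inv_mulV// gmulVK.
Qed.

(* <u, u> = <a v, f> for u = a^* f on the column s and v = u restricted to s. *)
Lemma normb_bound_star a (C : R) : 0 <= C -> normb_bound a C ->
  normb_bound (section_star a) C.
Proof.
move=> C0 aC f S D fS D0 fD x s us sx ux.
set u := convolution _ f; pose v := restrict_section s u; set E := col_norm u x s.
have vE : norm2_bound v E by exact: norm2_bound_restrict_col.
have E0 : 0 <= E by exact: col_norm_ge0.
have avE := aC _ _ _ (@restrict_section_supported s u) E0 vE.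
pose S' := [seq p <- S | src p == x].
have S'x : S' \insrc x by move=> p; rewrite mem_filter => /andP[/eqP].
have uS' : uniq S' by rewrite filter_uniq ?fset_uniq.
have key : \sum_(g <- s) fip x (u g) (u g) =
    \sum_(p <- S') fip x (convolution a v p) (f p).
  transitivity (\sum_(g <- s) \sum_(p <- S')
      fip x (u g) (fprod g (section_star a (gmul g (ginv p))) (f p))).
    apply: eq_big_seq => g /sx gx; rewrite {2}/u (convolution_supported_filter _ _ fS).
    rewrite fip_sumr// [RHS]big_filter; apply: eq_bigl => p; by rewrite gx.
  rewrite exchange_big /=; apply: eq_big_seq => p /S'x px.
  rewrite (@convolution_seq a v p s us); last first.
    by move=> d /negbTE ds; rewrite /v /restrict_section ds.
  rewrite fip_suml// [RHS]big_mkcond; apply: eq_big_seq => g gs.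
  have gx := sx _ gs; rewrite px gx eqxx fip_adj// /v /restrict_section gs.
  by [].
have le1 : E ^+ 2 <= (C * E) * D.
  rewrite /E col_norm_sqr key; apply: le_trans (fip_sum_le _ _ ux S'x) _.
  by apply: ler_pM; rewrite ?col_norm_ge0//; [exact: avE|exact: fD].
have [E00|En0] := eqVneq E 0; first by rewrite E00 mulr_ge0.
by move: le1; rewrite expr2 mulrAC ler_pM2r// lt0r En0.
Qed.

(* (a b) f is the pointwise limit of a ((b f)|_T) over the finite sets T. *)
Lemma normb_bound_mul a b (C C' : R) : 0 <= C -> 0 <= C' -> conv_defined a b ->
  normb_bound a C -> normb_bound b C' -> normb_bound (convolution a b) (C * C').
Proof.
move=> C0 C'0 /conv_defined_sum ab aC bC f S D fS D0 fD x s us sx ux.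
pose M := \sum_(p <- S) vnorm (f p).
apply: (@le_of_le_addM _ _ _ (\sum_(g <- s) M)) => e e0 _.
have /choice[F HF] : forall g, exists F : {fset G}, forall D : {fset G}, (F `<=` D)%fset ->
    vnorm (\sum_(d <- D) conv_term a b g d - convolution a b g) < e.
  by move=> g; exact: ab.
(* T collects the products d p with d in the finite set that approximates (a b) (g p^-1) within e,
   for all g in s and p in S at once. Reindexing T by d p^-1 then gives, for each such pair, a
   partial sum that is fine enough. *)
pose T := undup (flatten [seq flatten [seq [seq gmul d p | d <- F (gmul g (ginv p))]
  | p <- S] | g <- s]).
have TP g p d : g \in s -> p \in S -> d \in F (gmul g (ginv p)) -> gmul d p \in T.
  move=> gs pS dF; rewrite mem_undup; apply/flatten_mapP; exists g => //.
  by apply/flatten_mapP; exists p => //; apply/mapP; exists d.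
pose k := convolution b f; pose kT := restrict_section T k.
pose S' := [seq p <- S | src p == x]; pose T' := [seq d <- T | src d == x].
have S'x : S' \insrc x by move=> p; rewrite mem_filter => /andP[/eqP].
have T'x : T' \insrc x by move=> p; rewrite mem_filter => /andP[/eqP].
have kD : norm2_bound kT (C' * D) by apply: norm2_bound_restrict; exact: bC fS D0 fD.
have akD := aC _ _ _ (@restrict_section_supported T k) (mulr_ge0 C'0 D0) kD.
pose Q g p := \sum_(d <- T')
  fprod (gmul g (ginv p)) (a (gmul g (ginv d))) (b (gmul d (ginv p))).
have akE g : g \in s -> convolution a kT g = \sum_(p <- S') fprod g (Q g p) (f p).
  move=> gs; have gx := sx _ gs.
  rewrite (@convolution_seq a kT g T (undup_uniq _)); last first.
    by move=> d /negbTE dT; rewrite /kT /restrict_section dT.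
  rewrite gx -big_filter -/T'.
  transitivity (\sum_(d <- T') \sum_(p <- S')
     fprod g (fprod (gmul g (ginv p)) (a (gmul g (ginv d))) (b (gmul d (ginv p)))) (f p)).
    apply: eq_big_seq => d dT'; have dx := T'x _ dT'.
    have gd : src g = src d by rewrite gx.
    have -> : kT d = k d.
      by rewrite /kT /restrict_section; move: dT'; rewrite mem_filter => /andP[_ ->].
    rewrite /k (convolution_supported_filter _ _ fS) dx -big_filter -/S'.
    rewrite fprod_sumr ?gmulVK//; last by rewrite /composable src_mulV.
    apply: eq_big_seq => p /S'x px.
    have dp : src d = src p by rewrite px.
    have gp : src g = src p by rewrite px.
    rewrite (fprodA (n := d)) ?gmulVK//.
    - by rewrite /composable src_mulV ?rng_mulV.
    - by rewrite /composable src_mulV.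
    - rewrite -gmulA ?gmulVK//; last exact: composable_mulV.
      by rewrite /composable src_mulV.
  rewrite exchange_big /=; apply: eq_big_seq => p /S'x px.
  have gp : src g = src p by rewrite px.
  by rewrite fprod_suml ?gmulVK// /composable src_mulV.
have Qe g p : g \in s -> p \in S' -> vnorm (Q g p - convolution a b (gmul g (ginv p))) < e.
  move=> gs pS'; have gx := sx _ gs; have px := S'x _ pS'.
  have pS : p \in S by move: pS'; rewrite mem_filter => /andP[].
  have gp : src g = src p by rewrite px.
  pose Tp := [seq gmul d (ginv p) | d <- T'].
  have uTp : uniq Tp.
    rewrite map_inj_in_uniq ?filter_uniq ?undup_uniq// => d d' /T'x dx /T'x d'x dd.
    by rewrite -(gmulVK (g := d) (h := p)) ?px// dd gmulVK ?px.
  have TpS : ([fset d in Tp] `<=` F (gmul g (ginv p)) `|` [fset d in Tp])%fset by exact: fsubsetUr.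
  (* Elements of F (g p^-1) outside [Tp] have the wrong source and contribute 0: otherwise d p would
     lie in T' and d = (d p) p^-1 in [Tp]. *)
  suff -> : Q g p = \sum_(d <- (F (gmul g (ginv p)) `|` [fset d in Tp])%fset)
      conv_term a b (gmul g (ginv p)) d by apply: HF; exact: fsubsetUl.
  rewrite -(big_fset_incl _ TpS).
    have /(perm_big _)-> : perm_eq (enum_fset [fset d in Tp]%fset) Tp.
      by apply: uniq_perm => // d; rewrite in_fset.
    rewrite big_map; apply: eq_big_seq => d /T'x dx.
    have dp : src d = src p by rewrite px.
    rewrite /conv_term !src_mulV// eqxx.
    have -> // : gmul (gmul g (ginv p)) (ginv (gmul d (ginv p))) = gmul g (ginv d).
    rewrite inv_mulV// -gmulA ?gmulVK//; last exact: composable_mulV.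
    by rewrite /composable src_mulV.
  move=> d; rewrite in_fsetU => /orP[dF|->//]; rewrite in_fset => dT.
  rewrite /conv_term; case: eqP => // dp; move: dT.
  rewrite src_mulV// in dp.
  have dpc : composable d p by exact: dp.
  have -> : d \in Tp => //; apply/mapP; exists (gmul d p); last by rewrite egpd_mulKV.
  rewrite mem_filter (TP g)// andbT src_mul// px; exact: eqxx.
pose w := convolution (convolution a b) f - convolution a kT.
have wE g : g \in s -> vnorm (w g) <= e * M.
  move=> gs; have gx := sx _ gs.
  have -> : w g = \sum_(p <- S') fprod g (convolution a b (gmul g (ginv p)) - Q g p) (f p).
    rewrite -[w g]/(_ g - _ g) akE// (convolution_supported_filter _ _ fS) gx -big_filter -/S'.
    rewrite -sumrB; apply: eq_big_seq => p /S'x px.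
    have gp : src g = src p by rewrite px.
    have c : composable (gmul g (ginv p)) p by rewrite /composable src_mulV.
    by rewrite fprodDl ?gmulVK// fprodNl ?gmulVK.
  apply: le_trans (vnorm_sum _ _ _) _.
  apply: (@le_trans _ _ (\sum_(p <- S') e * vnorm (f p))).
    rewrite big_seq [leRHS]big_seq; apply: ler_sum => p pS'; have px := S'x _ pS'.
    have gp : src g = src p by rewrite px.
    have c : composable (gmul g (ginv p)) p by rewrite /composable src_mulV.
    apply: le_trans (vnorm_fprod _ _ c _) _; first by rewrite gmulVK.
    rewrite ler_wpM2r ?vnorm_ge0// -vnormN opprB; apply: ltW; exact: Qe.
  rewrite -mulr_sumr ler_wpM2l// ?(ltW e0)// /M big_filter big_mkcond.
  by apply: ler_sum => p _; case: ifP => // _; exact: vnorm_ge0.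
have -> : convolution (convolution a b) f = convolution a kT + w by rewrite addrC subrK.
apply: le_trans (col_normD _ _ ux sx) _; apply: lerD.
  by rewrite -mulrA; exact: akD.
apply: le_trans (col_norm_le_sum _ sx) _; rewrite mulr_sumr.
by rewrite big_seq [leRHS]big_seq; apply: ler_sum => g; exact: wE.
Qed.

End BigCstar.

(** Log-convexity makes the ratios of successive terms nondecreasing, so x k >= x 0 r^k for the
    first ratio r. A growth rate of at most m then forces r <= m, whatever the constant F is. *)
Lemma log_convex_le (R : realType) (x : nat -> R) (m F : R) :
  (forall k, 0 <= x k) -> 0 <= m -> (forall k, x k.+1 ^+ 2 <= x k * x k.+2) ->
  (forall k, x k <= F * m ^+ k) -> x 1%N <= m * x 0%N.
Proof.
move=> x0 m0 cvx bnd.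
have [x00|x0n] := eqVneq (x 0%N) 0.
  have := cvx 0%N; rewrite x00 mulr0 mul0r => h.
  by have /eqP : x 1%N ^+ 2 = 0 by [apply/le_anti; rewrite h sqr_ge0]; rewrite sqrf_eq0 => /eqP ->.
have x0p : 0 < x 0%N by rewrite lt0r x0n x0.
have [x10|x1n] := eqVneq (x 1%N) 0; first by rewrite x10 mulr_ge0// ltW.
have x1p : 0 < x 1%N by rewrite lt0r x1n x0.
pose r := x 1%N / x 0%N; have rp : 0 < r by rewrite divr_gt0.
have grow k : 0 < x k /\ r * x k <= x k.+1.
  elim: k => [|k [xk IH]]; first by rewrite /r divfK ?gt_eqF.
  have xk1 : 0 < x k.+1 by apply: lt_le_trans IH; rewrite mulr_gt0.
  split=> //; rewrite -(ler_pM2l xk1) mulrCA -expr2.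
  apply: le_trans (ler_wpM2l (ltW rp) (cvx k)) _.
  by rewrite mulrA ler_wpM2r.
have pow k : x 0%N * r ^+ k <= x k.
  elim: k => [|k IH]; first by rewrite expr0 mulr1.
  apply: le_trans (grow k).2; rewrite exprS mulrCA ler_wpM2l//; exact: ltW.
have mp : 0 < m.
  rewrite lt0r m0 andbT; apply: contraTneq x1p => m00; rewrite -leNgt.
  by have := bnd 1%N; rewrite m00 expr1 mulr0.
suff : r / m <= 1 by rewrite ler_pdivrMr// mul1r /r ler_pdivrMr.
apply: (@le1_of_pow_le _ _ (F / x 0%N)); first by rewrite divr_ge0 ?ltW.
move=> k; set n := (2 ^ k)%N.
have Fp : 0 <= F.
  by have := le_trans (ltW x0p) (bnd 0%N); rewrite expr0 mulr1.
apply: (@le_trans _ _ (F / x 0%N)); last by rewrite ler_peMr ?ler1n// divr_ge0// ltW.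
rewrite ler_pdivlMr// exprMn exprVn mulrC mulrA ler_pdivrMr ?exprn_gt0//.
exact: le_trans (pow n) (bnd n).
Qed.

(** * Diagonal multiplication and convergence of convolutions *)

Section BigCstarConv.
Variables (R : realType) (G : etale_groupoid) (B : fell_bundle R G).
Implicit Types g h x d : G.
Implicit Types s t : seq G.
Implicit Types a b c f u : fell_section B.
Implicit Types S D T : {fset G}.
Local Notation fibre := (fibre B).
Local Notation "s '\insrc' x" := (forall g, g \in s -> src g = x) (at level 70).

(* Cauchy-Schwarz gives log-convexity of k |-> |<(h^k f), (h^k f)>|, h = a^* a,
   whose growth rate is at most M^4. *)
Lemma fip_diag_le (I : eqType) (s : seq I) (al ph : I -> G)
    (a : forall i, fibre (al i)) (f : forall i, fibre (ph i)) x (M : R) :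
  units x -> 0 <= M -> (forall i, i \in s -> composable (al i) (ph i)) ->
  (forall i, i \in s -> src (ph i) = x) -> (forall i, i \in s -> vnorm (a i) <= M) ->
  vnorm (\sum_(i <- s) fip x (fprod (gmul (al i) (ph i)) (a i) (f i))
                             (fprod (gmul (al i) (ph i)) (a i) (f i))) <=
  M ^+ 2 * vnorm (\sum_(i <- s) fip x (f i) (f i)).
Proof.
move=> ux M0 Hc Hx HM.
pose h i := fip (rng (ph i)) (a i) (a i).
pose u := fix u k : forall i, fibre (ph i) := fun i =>
  if k is k'.+1 then fprod (ph i) (h i) (u k' i) else f i.
have uS k i : u k.+1 i = fprod (ph i) (h i) (u k i) by [].
pose N k := vnorm (\sum_(i <- s) fip x (u k i) (u k i)).
have hs i k (v : fibre (ph i)) : i \in s ->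
    fprod k (fadj (ginv (rng (ph i))) (h i)) v = fprod k (h i) v.
  move=> is_; have iu : ginv (rng (ph i)) = rng (ph i) by apply: inv_unit; exact: units_rng.
  rewrite iu /h fadj_fip//; exact: Hc.
have crp i : composable (rng (ph i)) (ph i) by exact: src_rng.
have hM i : i \in s -> vnorm (h i) <= M ^+ 2.
  move=> is_; rewrite /h vnorm_fip; last exact: Hc.
  by rewrite lerXn2r ?nnegrE ?vnorm_ge0// HM.
have cs j k : vnorm (\sum_(i <- s) fip x (u j i) (u k i)) ^+ 2 <= N j * N k.
  by apply: fip_cauchy_schwarz => //; [move=> i /Hx ix; split|exact: rng_unit].
have cvx k : N k.+1 ^+ 2 <= N k * N k.+2.
  apply: le_trans (cs k k.+2).
  have -> // : N k.+1 = vnorm (\sum_(i <- s) fip x (u k i) (u k.+2 i)).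
  congr vnorm; apply: eq_big_seq => i is_.
  have := Hc _ is_; move=> ci.
  rewrite {1}uS (fip_prodl (l := ph i))//.
  - by congr (fip x _ _); rewrite [RHS]uS fipE hs.
  - exact: gmul_rng.
  - exact: rng_rng.
  - by rewrite inv_unit ?gmul_rng//; exact: units_rng.
(* A crude termwise estimate suffices: its constant depends on the family, but [log_convex_le] keeps
   only the rate M^4. *)
have bnd k : N k <= \sum_(i <- s) vnorm (f i) ^+ 2 * (M ^+ 4) ^+ k.
  apply: le_trans (vnorm_sum _ _ _) _; rewrite big_seq [leRHS]big_seq.
  apply: ler_sum => i is_; rewrite vnorm_fip ?Hx//.
  have -> : (M ^+ 4) ^+ k = (M ^+ 2 ^+ k) ^+ 2 by rewrite -!exprM [in RHS]mulnCA mulnC.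
  rewrite -exprMn lerXn2r ?nnegrE ?mulr_ge0 ?vnorm_ge0 ?exprn_ge0//.
  elim: k => [|k IH]; first by rewrite expr0 mulr1.
  rewrite uS exprS mulrCA; apply: le_trans (vnorm_fprod _ _ _ _) _ => //; first exact: gmul_rng.
  by apply: ler_pM; rewrite ?vnorm_ge0// hM.
have N10 : N 1%N <= M ^+ 4 * N 0%N.
  apply: (@log_convex_le _ N _ (\sum_(i <- s) vnorm (f i) ^+ 2)) => //.
  - by move=> k; exact: vnorm_ge0.
  - exact: exprn_ge0.
  - by move=> k; rewrite mulr_suml.
(* The left side is the sum of the f_i^* h_i f_i. Its squared norm is at most N 0 N 1 by
   Cauchy-Schwarz, hence at most M^4 (N 0)^2 by [N10]. *)
have -> : \sum_(i <- s) fip x (fprod (gmul (al i) (ph i)) (a i) (f i))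
     (fprod (gmul (al i) (ph i)) (a i) (f i)) = \sum_(i <- s) fip x (u 0%N i) (u 1%N i).
  apply: eq_big_seq => i is_; have ci := Hc _ is_.
  rewrite (fip_prodl (l := ph i)) ?rng_mul ?egpd_mulVK//; congr (fip x _ _).
  by rewrite (fip_prodr (l := rng (ph i))).
rewrite -(ler_pXn2r (ltn0Sn 1)) ?nnegrE ?mulr_ge0 ?vnorm_ge0 ?exprn_ge0//.
apply: le_trans (cs 0%N 1%N) _; rewrite exprMn -exprM.
rewrite -/(N 0%N) expr2 mulrCA ler_wpM2l//; exact: vnorm_ge0.
Qed.

Lemma conv_sum_bound a b g s (A E : R) : norm2_bound (section_star a) A ->
  norm2_bound b E -> uniq s -> vnorm (\sum_(d <- s) conv_term a b g d) <= A * E.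
Proof.
move=> aA bE us; apply: le_trans (conv_sum_le _ _ _ us) _.
apply: ler_pM; rewrite ?col_norm_ge0//; last first.
  apply: bE; [exact: filter_uniq| |exact: units_src].
  by move=> d; rewrite mem_filter => /andP[/eqP].
apply: aA; [| |exact: units_rng].
  rewrite map_inj_in_uniq ?filter_uniq// => d d'.
  rewrite !mem_filter => /andP[/eqP dg _] /andP[/eqP d'g _] dd.
  by rewrite -(gmulVK dg) dd gmulVK.
by move=> d /mapP[d']; rewrite mem_filter => /andP[/eqP dg _] ->; rewrite src_mulV.
Qed.

(** Holds for sections supported on a slice and survives finite sums, although the whole support may
    be infinite; convolution with such a right factor is a finite sum at each arrow. *)
Definition col_finite c := forall x, exists S, forall d,
  src d = x -> d \notin S -> c d = 0.

Lemma conv_sum_col_finite a c g : col_finite c ->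
  exists S, convolution a c g = \sum_(d <- S) conv_term a c g d /\
            conv_sum a c g (convolution a c g).
Proof.
move=> /(_ (src g))[S HS]; exists S.
have H : conv_sum a c g (\sum_(d <- S) conv_term a c g d).
  by apply: conv_sum_fin => d dS dg; rewrite conv_term0r// HS.
by rewrite (convolution_unique H).
Qed.

Lemma conv_defined_approx a b (A : R) : 0 <= A -> norm2_bound (section_star a) A ->
  (forall e : R, 0 < e -> exists2 c, col_finite c & norm2_bound (b - c) e) ->
  conv_defined a b.
Proof.
move=> A0 aA bc g.
suff [l Hl] : exists l, conv_sum a b g l.
  by apply/cvg_ex; exists l; exact: conv_sum_cvg.
pose F (D : {fset G}) := \sum_(d <- D) conv_term a b g d.
have Fc : cauchy (F @ finite_subsets).
  apply: cauchy_exP => -[e i]; rewrite ltcE /= => /andP[/eqP -> e0].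
  have A1 : 0 < A + 1 by rewrite ltr_wpDl.
  have [c cfin cb] := bc _ (divr_gt0 e0 A1).
  have [S HS] := cfin (src g).
  exists (F S); exists S => // D SD /=.
  rewrite -ball_normE /= -normrN opprB vnormE ltcR.
  (* S contains the part of the support of c over src g, so beyond S the terms of a b and of a (b -
     c) coincide, and the tail is small by Cauchy-Schwarz. *)
  have -> : F D - F S = \sum_(d <- (D `\` S)%fset) conv_term a (b - c) g d.
    have -> : F D = F S + \sum_(d <- (D `\` S)%fset) conv_term a b g d.
      rewrite /F (perm_big (S ++ (D `\` S)%fset)) ?big_cat//=.
      apply: uniq_perm; rewrite ?fset_uniq//.
        rewrite cat_uniq !fset_uniq andbT /=; apply/hasPn => d.
        by rewrite inE => /andP[].
      move=> d; rewrite mem_cat inE; case: (boolP (d \in S)) => //= dS.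
      by rewrite (fsubsetP SD).
    rewrite addrC addKr; apply: eq_big_seq => d; rewrite inE => /andP[dS _].
    have [dg|dg] := eqVneq (src d) (src g); last by rewrite /conv_term (negbTE dg).
    rewrite conv_termDr [X in _ = _ + X]conv_term0r ?addr0//.
    by rewrite -[LHS]/(- c d) HS// oppr0.
  have le1 := conv_sum_bound g aA cb (fset_uniq (D `\` S)%fset).
  apply: (le_lt_trans le1).
  by rewrite mulrA ltr_pdivrMr// mulrDr mulr1 mulrC ltrDl.
have /cvg_ex[l /fibre_cvgP Hl] : cvg (F @ finite_subsets) by exact: cauchy_cvg.
by exists l => e /Hl[S _ HS]; exists S => D /HS.
Qed.

Lemma convolutionDr a b b' : conv_defined a b -> conv_defined a b' ->
  conv_defined a (b + b') /\ convolution a (b + b') = convolution a b + convolution a b'.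
Proof.
move=> /conv_defined_sum h /conv_defined_sum h'; apply: conv_sum_eq => g.
by apply: conv_sumD (h g) (h' g) _ => d; rewrite conv_termDr.
Qed.

Lemma convolutionDl_defined a a' b : conv_defined a b -> conv_defined a' b ->
  conv_defined (a + a') b /\ convolution (a + a') b = convolution a b + convolution a' b.
Proof.
move=> /conv_defined_sum h /conv_defined_sum h'; apply: conv_sum_eq => g.
by apply: conv_sumD (h g) (h' g) _ => d; rewrite conv_termDl.
Qed.

Lemma convolutionZ (k l : R[i]) a b : conv_defined a b ->
  conv_defined (k *: a) (l *: b) /\ convolution (k *: a) (l *: b) = (k * l) *: convolution a b.
Proof.
move=> /conv_defined_sum h; apply: conv_sum_eq => g.
by apply: conv_sumZ (h g) _ => d; rewrite conv_termZl conv_termZr scalerA.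
Qed.

Lemma convolution0l b : conv_defined 0 b /\ convolution 0 b = 0.
Proof.
apply: conv_sum_eq => g e e0; exists fset0 => D _.
by rewrite big1 ?subrr ?vnorm0// => d _; rewrite conv_term0l.
Qed.

Lemma convolution0r a : conv_defined a 0 /\ convolution a 0 = 0.
Proof.
apply: conv_sum_eq => g e e0; exists fset0 => D _.
by rewrite big1 ?subrr ?vnorm0// => d _; rewrite conv_term0r.
Qed.

End BigCstarConv.

(** * Topology of an etale groupoid *)

Lemma within_cvg_comp (X Y Z T : topologicalType) (A : set (X * Y)) (m : X * Y -> Z)
    (F : set_system T) (FF : Filter F) (u : T -> X) (v : T -> Y) (g : X) (h : Y) :
  {within A, continuous m} -> A (g, h) -> u @ F --> g -> v @ F --> h ->
  (\forall t \near F, A (u t, v t)) -> (fun t => m (u t, v t)) @ F --> m (g, h).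
Proof.
move=> /subspace_continuousP mc Agh ug vh Auv W /(mc _ Agh) mW.
have H : F (fun t => A (u t, v t) -> W (m (u t, v t))) by exact: (cvg_pair ug vh mW).
by apply: (filterS2 _ _ Auv H) => t At; exact.
Qed.

Section GroupoidTopology.
Variable G : etale_groupoid.
Implicit Types g h k x y : G.
Implicit Types O K L : set G.

Lemma gmul_cvg (T : topologicalType) (F : set_system T) (FF : Filter F)
    (u v : T -> G) g h : composable g h -> u @ F --> g -> v @ F --> h ->
  (\forall t \near F, composable (u t) (v t)) ->
  (fun t => gmul (u t) (v t)) @ F --> gmul g h.
Proof.
move=> gh ug vh c.
exact: (within_cvg_comp FF (@egpd_mul_cont G) gh ug vh c).
Qed.

Lemma src_continuous : continuous (@src G).
Proof.
move=> g; apply: gmul_cvg; [exact: composableVg|exact: egpd_inv_cont|exact: cvg_id|].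
by apply: nearW => t; exact: composableVg.
Qed.

Lemma rng_continuous : continuous (@rng G).
Proof.
have -> : @rng G = src \o ginv by apply/funext => g /=; rewrite egpd_invK.
move=> g; apply: continuous_comp; [exact: egpd_inv_cont|exact: src_continuous].
Qed.

(* The inverse of [src] on a slice O; outside src @` O the value is junk. *)
Definition src_section O y : G := xget y [set b | O b /\ src b = y].

Lemma src_sectionP O y : (src @` O) y -> O (src_section O y) /\ src (src_section O y) = y.
Proof.
move=> [b Ob yb]; apply: (@xgetPex _ y [set b | O b /\ src b = y]); by exists b.
Qed.

Lemma src_sectionK O b : set_inj O src -> O b -> src_section O (src b) = b.
Proof.
move=> Oi Ob; have [h1 h2] := @src_sectionP O (src b) (ex_intro2 _ _ b Ob erefl).
by apply: Oi => //; rewrite inE.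
Qed.

(** The inverse of an open injective map is continuous: a neighbourhood V of b is pulled back to the
    image of its intersection with O, which is open because [src] is. *)
Lemma src_section_cvg O b : open O -> set_inj O src -> O b ->
  src_section O @ src b --> b.
Proof.
move=> Oo Oi Ob W; rewrite nbhsE => -[V [Vo Vb] VW].
have : nbhs (src b) (src @` (V `&` O)).
  by apply: open_nbhs_nbhs; split; [exact/egpd_src_open/openI|exists b].
apply: filterS => y [c [Vc Oc] <-]; apply: VW.
by rewrite src_sectionK.
Qed.

Lemma near_src_section O b : open O -> O b ->
  \forall y \near src b, O (src_section O y) /\ src (src_section O y) = y.
Proof.
move=> Oo Ob; have : nbhs (src b) (src @` O).
  by apply: open_nbhs_nbhs; split; [exact: egpd_src_open|exists b].
by apply: filterS => y; exact: src_sectionP.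
Qed.

Definition setg_mul O P : set G :=
  [set g | exists a b, [/\ O a, P b, composable a b & g = gmul a b]].

Section Factor.
Variables (O : set G) (a b : G).
Hypotheses (Oo : open O) (Oi : set_inj O src) (Ob : O b) (ab : composable a b).

(* The factorization g = (g beta^-1) beta with beta in the slice O. *)
Definition rfactor g : G := src_section O (src g).

Lemma near_rfactor : \forall g \near gmul a b, O (rfactor g) /\ src (rfactor g) = src g.
Proof.
have := near_src_section Oo Ob; rewrite -(src_mul ab).
exact: (@src_continuous (gmul a b)).
Qed.

Lemma rfactorE : rfactor (gmul a b) = b.
Proof. by rewrite /rfactor src_mul// src_sectionK. Qed.

Lemma rfactor_cvg : rfactor @ gmul a b --> b.
Proof.
have := src_section_cvg Oo Oi Ob; rewrite -(src_mul ab) => h.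
exact: (cvg_comp _ _ (@src_continuous (gmul a b)) h).
Qed.

Lemma lfactor_cvg : (fun g => gmul g (ginv (rfactor g))) @ gmul a b --> a.
Proof.
rewrite -[X in _ --> X](egpd_mulKV ab); apply: gmul_cvg.
- by rewrite /composable rng_inv src_mul.
- exact: cvg_id.
- by apply: (cvg_comp _ _ rfactor_cvg); exact: egpd_inv_cont.
- by apply: filterS near_rfactor => g [_ rg]; rewrite /composable rng_inv rg.
Qed.

End Factor.

Lemma setg_mul_open O P : open O -> open P -> slice P -> open (setg_mul O P).
Proof.
move=> Oo Po [Pi _]; rewrite openE => _ [a [b [ Oa Pb ab ->]]]; rewrite /interior.
have h1 := near_rfactor Po Pb ab.
have h2 : \forall g \near gmul a b, O (gmul g (ginv (rfactor P g))).
  by apply: (lfactor_cvg Po Pi Pb ab); exact: open_nbhs_nbhs.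
apply: filterS2 h1 h2 => g [h1 h1'] h2.
exists (gmul g (ginv (rfactor P g))), (rfactor P g); split => //.
  by rewrite /composable src_mulV.
by rewrite gmulVK.
Qed.

Lemma setg_mul_slice O P : slice O -> slice P -> slice (setg_mul O P).
Proof.
move=> [ Os Or] [Ps Pr]; split=> g g'; rewrite !inE.
  move=> [a [b [ Oa Pb ab ->]]] [a' [b' [ Oa' Pb' ab' ->]]]; rewrite !src_mul// => bb'.
  have eb : b = b' by apply: Ps; rewrite ?inE.
  by subst b'; congr gmul; apply: Os; rewrite ?inE// ab ab'.
move=> [a [b [ Oa Pb ab ->]]] [a' [b' [ Oa' Pb' ab' ->]]]; rewrite !rng_mul// => aa'.
have ea : a = a' by apply: Or; rewrite ?inE.
by subst a'; congr gmul; apply: Pr; rewrite ?inE// -ab -ab'.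
Qed.

Lemma setg_mulS O P K L : K `<=` O -> L `<=` P -> setg_mul K L `<=` setg_mul O P.
Proof.
by move=> KO LP g [a [b [/KO Oa /LP Ob ab ->]]]; exists a, b.
Qed.

Lemma image_src_preimage K L (C : set G) : src @` K = C `&` units (G := G) ->
  L `&` rng @^-1` (src @` K) = L `&` rng @^-1` C.
Proof.
move=> KC; rewrite KC; apply/seteqP; split=> g /= [Lg]; first by case.
by move=> Cg; split=> //; split=> //; exact: units_rng.
Qed.

(** Without Hausdorff units the composable pairs need not be closed in K x L. Instead, the slice
    around K recovers the left factor from the right one, so the product is a continuous image of
    the part of L whose ranges lie in src[K]; that part is compact because src[K] is closed in the
    units. *)
Lemma setg_mul_compact K L : bicompact K -> bicompact L -> compact (setg_mul K L).
Proof.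
move=> [[[C Cc KC] _] _ [ O [ Oo [ Os _] KO]]] [_ Lc _].
pose M := L `&` rng @^-1` (src @` K).
pose th g := gmul (src_section O (rng g)) g.
have -> : setg_mul K L = th @` M.
  apply/seteqP; split=> [_ [a [b [Ka Lb ab ->]]]|_ [b [Lb [a Ka ab]] <-]].
    exists b; first by split=> //; exists a.
    by rewrite /th -ab src_sectionK//; exact: KO.
  exists a, b; split=> //.
  by rewrite /th -ab src_sectionK//; exact: KO.
apply: continuous_compact; last first.
  rewrite /M (image_src_preimage _ KC); apply: compact_closedI => //.
  by apply: preimage_closed => // g _; exact: rng_continuous.
apply: continuous_in_subspaceT => b; rewrite inE => -[Lb [a Ka ab]].
have Oa := KO _ Ka.
have h : src_section O \o rng @ b --> src_section O (rng b).
  apply: cvg_comp; first exact: rng_continuous.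
  by rewrite -ab (src_sectionK Os Oa); exact: src_section_cvg.
apply: gmul_cvg => //.
  by have [] := @src_sectionP O _ (ex_intro2 _ _ a Oa ab).
have := near_src_section Oo Oa; rewrite ab => hn.
have hb : \forall t \near b, O (src_section O (rng t)) /\ src (src_section O (rng t)) = rng t.
  exact: (@rng_continuous b _ hn).
by apply: filterS hb => g [].
Qed.

(** src[K L] is src[L] minus the sources of those arrows of the slice O whose range lies outside
    src[K]. The removed set is open since [src] is open, and injectivity of [src] on O prevents it
    from meeting src[K L]. *)
Lemma src_setg_mul_closed K L : bicompact K -> bicompact L ->
  closed_in_units (src @` setg_mul K L).
Proof.
move=> [[[C Cc KC] _] _ _] [[[D Dc LD] _] _ [ O [ Oo [ Os _] LO]]].
have LD' b : L b -> D (src b).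
  by move=> Lb; have [] : (D `&` units (G:=G)) (src b) by rewrite -LD; exists b.
exists (D `&` ~` (src @` (O `&` rng @^-1` (~` C)))).
  apply: closedI => //; apply: open_closedC; apply: egpd_src_open; apply: openI => //.
  by apply: open_comp; [move=> g _; exact: rng_continuous|exact: closed_openC].
apply/seteqP; split.
  move=> _ [_ [a [b [Ka Lb ab ->]]] <-]; rewrite src_mul//; split; last exact: units_src.
  split; first exact: LD'.
  move=> [w [ Ow wC] wb]; apply: wC.
  have -> : w = b by apply: Os; rewrite ?inE//; exact: LO.
  have [] // : (C `&` units (G:=G)) (rng b); by rewrite -KC; exists a.
move=> y [[Dy Cy] uy].
have [b Lb by_] : (src @` L) y by rewrite LD.
have : C (rng b).
  apply: contrapT => nC; apply: Cy; exists b => //; split=> //; exact: LO.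
move=> Cb; have [a Ka ab] : (src @` K) (rng b) by rewrite KC; split=> //; exact: units_rng.
by exists (gmul a b); [exists a, b|rewrite src_mul].
Qed.

Definition setg_inv K : set G := ginv @` K.

Lemma src_setg_inv K : src @` setg_inv K = rng @` K.
Proof.
apply/seteqP; split=> [_ [_ [g Kg <-] <-]|_ [g Kg <-]].
  by exists g; rewrite ?src_inv.
by exists (ginv g); [exists g|rewrite src_inv].
Qed.

Lemma rng_setg_inv K : rng @` setg_inv K = src @` K.
Proof.
apply/seteqP; split=> [_ [_ [g Kg <-] <-]|_ [g Kg <-]].
  by exists g; rewrite ?rng_inv.
by exists (ginv g); [exists g|rewrite rng_inv].
Qed.

Lemma bicompact_inv K : bicompact K -> bicompact (setg_inv K).
Proof.
move=> [[Ks Kr] Kc [ O [ Oo [ Os Or] KO]]]; split.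
- by rewrite /biclosed src_setg_inv rng_setg_inv.
- by apply: continuous_compact => //; apply: continuous_subspaceT; exact: egpd_inv_cont.
exists (setg_inv O); split.
- have -> : setg_inv O = ginv @^-1` O.
    apply/seteqP; split=> [_ [g Og <-]|g Og] /=; first by rewrite egpd_invK.
    by exists (ginv g) => //; rewrite egpd_invK.
  by apply: open_comp => // g _; exact: egpd_inv_cont.
- split=> g g'; rewrite !inE => -[h Oh <-] [h' Oh' <-].
    by rewrite !src_inv => e; congr ginv; apply: Or; rewrite ?inE.
  by rewrite !rng_inv => e; congr ginv; apply: Os; rewrite ?inE.
- exact: image_subset.
Qed.

Lemma rng_setg_mul K L :
  rng @` setg_mul K L = src @` setg_mul (setg_inv L) (setg_inv K).
Proof.
apply/seteqP; split.
  move=> _ [_ [a [b [Ka Lb ab ->]]] <-].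
  exists (gmul (ginv b) (ginv a)).
    by exists (ginv b), (ginv a); split=> //; [exists b|exists a|exact: composable_inv].
  by rewrite src_mul ?src_inv ?rng_mul//; exact: composable_inv.
move=> _ [_ [_ [_ [[b Lb <-] [a Ka <-] ba ->]]] <-].
have ab : composable a b by move: ba; rewrite /composable src_inv rng_inv.
exists (gmul a b); first by exists a, b.
by rewrite src_mul ?src_inv ?rng_mul.
Qed.

Lemma bicompact_mul K L : bicompact K -> bicompact L -> bicompact (setg_mul K L).
Proof.
move=> Kb Lb; split.
- split; first exact: src_setg_mul_closed.
  by rewrite rng_setg_mul; apply: src_setg_mul_closed; exact: bicompact_inv.
- exact: setg_mul_compact.
have [_ _ [ O [ Oo Os KO]]] := Kb; have [_ _ [P [Po Ps LP]]] := Lb.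
exists (setg_mul O P); split; [exact: setg_mul_open|exact: setg_mul_slice|].
exact: setg_mulS.
Qed.

End GroupoidTopology.

(** * Continuous sections with bicompact support *)

Section LinearSpan.
Variables (K : realType) (V : lmodType K[i]) (A : set V).

Lemma linear_span_sub : A `<=` linear_span A.
Proof.
move=> v Av; exists 1%N, (fun=> 1), (fun=> v); split=> //.
by rewrite big_ord1 scale1r.
Qed.

Lemma linear_span0 : linear_span A 0.
Proof. by exists 0%N, (fun=> 0), (fun=> 0); split=> [[]//|]; rewrite big_ord0. Qed.

Lemma linear_spanZ (k : K[i]) v : linear_span A v -> linear_span A (k *: v).
Proof.
move=> [n [l [u [Au ->]]]]; exists n, (fun i => k * l i), u; split=> //.
by rewrite scaler_sumr; apply: eq_bigr => i _; rewrite scalerA.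
Qed.

Lemma linear_spanD v w : linear_span A v -> linear_span A w -> linear_span A (v + w).
Proof.
move=> [n [l [u [Au ->]]]] [n' [l' [u' [Au' ->]]]].
exists (n + n')%N, (fun i => match fintype.split i with inl j => l j | inr j => l' j end),
  (fun i => match fintype.split i with inl j => u j | inr j => u' j end).
split=> [i|]; first by case: fintype.split.
rewrite big_split_ord /=; congr (_ + _); apply: eq_bigr => i _.
  by rewrite (unsplitK (inl i)).
by rewrite (unsplitK (inr i)).
Qed.

Lemma linear_span_ind (P : V -> Prop) : P 0 -> (forall v w, P v -> P w -> P (v + w)) ->
  (forall k v, P v -> P (k *: v)) -> A `<=` P -> linear_span A `<=` P.
Proof.
move=> P0 PD PZ AP _ [n [l [u [Au ->]]]].
by elim/big_ind: _ => // i _; apply: PZ; exact: AP.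
Qed.

End LinearSpan.

Section ContC.
Variables (R : realType) (G : etale_groupoid) (B : fell_bundle R G).
Implicit Types g h x d : G.
Implicit Types a b c f u : fell_section B.
Implicit Types S D T : {fset G}.
Implicit Types K L O : set G.
Local Notation fibre := (fibre B).

Lemma not_supp K a g : supp a `<=` K -> ~ K g -> a g = 0.
Proof.
by move=> aK nK; apply/eqP; apply/negPn/negP => ag; apply: nK; exact: aK.
Qed.

Lemma col_finite_slice K a : set_inj K src -> supp a `<=` K -> col_finite a.
Proof.
move=> Ki aK x; have [[k [Kk kx]]|nk] := pselect (exists k, K k /\ src k = x).
  exists [fset k]%fset => d dx; rewrite inE => /eqP dk; apply: not_supp aK _ => Kd.
  by apply: dk; apply: Ki; rewrite ?inE// dx kx.
by exists fset0 => d dx _; apply: not_supp aK _ => Kd; apply: nk; exists d.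
Qed.

Lemma cont_on_bounded K a : compact K -> cont_on K a ->
  exists2 M : R, 0 <= M & forall g, vnorm (a g) <= M.
Proof.
move=> Kc [aK ac].
have : \forall r \near (+oo : set_system R), K `<=` [set g | vnorm (a g) < r].
  (* The near-covering form of compactness, with r tending to infinity as second filter, turns a
     bound near each point of K into a uniform one. *)
  have := (@compact_near_coveringP _ K).1 Kc R (+oo : set_system R)
    (fun r => [set g | vnorm (a g) < r]) _; apply => g Kg.
  have h1 : \forall g' \near g, vnorm (a g') < vnorm (a g) + 1.
    have : nbhs (section_fun a g) [set b | bnorm b < vnorm (a g) + 1].
      apply: open_nbhs_nbhs; split; first exact: (bb_norm_usc (fell_banach_bundle B)).
      by rewrite /= bnorm_coe ltrDl.
    move=> /(ac g (mem_set Kg)); rewrite /nbhs /=; apply: filterS => g' /=.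
    by rewrite bnorm_coe.
  exists ([set g' | vnorm (a g') < vnorm (a g) + 1], [set r | vnorm (a g) + 1 < r]).
    by split; [exact: h1|exact: (nbhs_pinfty_gt (num_real _))].
  by move=> [g' r] /= [h2 h3]; exact: lt_trans h3.
move=> H; have H0 := nbhs_pinfty_gt (num_real (0 : R)).
have /filter_ex[r [Kr r0]] : \forall r \near (+oo : set_system R),
    K `<=` [set g | vnorm (a g) < r] /\ 0 < r by exact: filterI.
exists r; first exact: ltW.
move=> g; have [/Kr/ltW//|nK] := pselect (K g).
by rewrite (not_supp aK nK) vnorm0 ltW.
Qed.

(** Injectivity of [rng] on K leaves at most one contributing factorization of g, with left factor
    [al g] and right factor [ph g]; injectivity of [src] makes [ph] injective on a column. So a acts
    as an injective relabelling followed by a diagonal multiplication, which [fip_diag_le]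
    controls. *)
Lemma normb_bound_slice K a (M : R) : slice K -> supp a `<=` K -> 0 <= M ->
  (forall g, vnorm (a g) <= M) -> normb_bound a M.
Proof.
move=> [Ks Kr] aK M0 aM f S D fS D0 fD x s us sx ux.
pose al g := xget g [set k | K k /\ rng k = rng g].
pose ph g := gmul (ginv (al g)) g.
pose P g := `[< exists k, K k /\ rng k = rng g >].
have alP g : P g -> K (al g) /\ rng (al g) = rng g.
  move=> /asboolP ex; exact: (@xgetPex _ g [set k | K k /\ rng k = rng g] ex).
have cal g : P g -> composable (al g) (ph g).
  by move=> /alP[_ e]; rewrite /composable rng_mul ?rng_inv//; exact: composable_Vmul.
have alph g : P g -> gmul (al g) (ph g) = g.
  by move=> /alP[_ e]; rewrite gmulV_l.
have sph g : P g -> src (ph g) = src g.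
  by move=> Pg; rewrite -[in RHS](alph _ Pg) src_mul//; exact: cal.
set u := convolution a f.
have uE g : P g -> u g = fprod g (a (al g)) (f (ph g)).
  move=> Pg; have [Kal ral] := alP _ Pg.
  have := @conv_sum_fin _ _ _ a f g [fset ph g]%fset; rewrite big_seq_fset1.
  have eal : gmul g (ginv (ph g)) = al g.
    by rewrite -{1}(alph _ Pg) egpd_mulKV//; exact: cal.
  have -> : conv_term a f g (ph g) = fprod g (a (al g)) (f (ph g)).
    by rewrite /conv_term sph// eqxx eal.
  move=> H; apply: convolution_unique; apply: H => d; rewrite inE => /eqP dph dg.
  apply: conv_term0l; apply: not_supp aK _ => Kd; apply: dph.
  have e : gmul g (ginv d) = al g by apply: Kr; rewrite ?inE// rng_mulV.
  by rewrite /ph -e inv_mulV// gmulVK.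
have u0 g : ~~ P g -> u g = 0.
  move=> /asboolP nP; have := @conv_sum_fin _ _ _ a f g fset0.
  rewrite big_seq_fset0 => H; apply: convolution_unique; apply: H => d _ dg.
  apply: conv_term0l; apply: not_supp aK _ => Kd; apply: nP.
  by exists (gmul g (ginv d)); rewrite rng_mulV.
pose s' := [seq g <- s | P g].
have s'P g : g \in s' -> P g by rewrite mem_filter => /andP[].
have s's g : g \in s' -> g \in s by rewrite mem_filter => /andP[].
have s'x g : g \in s' -> src (ph g) = x by move=> gs; rewrite sph ?s'P//; exact/sx/s's.
rewrite -(ler_pXn2r (ltn0Sn 1)) ?nnegrE ?mulr_ge0 ?col_norm_ge0// col_norm_sqr.
have -> : \sum_(g <- s) fip x (u g) (u g) = \sum_(g <- s')
    fip x (fprod (gmul (al g) (ph g)) (a (al g)) (f (ph g)))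
          (fprod (gmul (al g) (ph g)) (a (al g)) (f (ph g))).
  rewrite big_filter [RHS]big_mkcond; apply: eq_big_seq => g gs.
  case: ifPn => Pg; last by rewrite u0// fip0r//; exact: sx.
  by rewrite uE//; move: (alph _ Pg); move: (gmul _ _) => k ->.
apply: le_trans
  (@fip_diag_le _ _ B _ s' al ph (fun g => a (al g)) (fun g => f (ph g)) x M ux M0 _ s'x _) _.
- by move=> g gs; apply: cal; exact: s'P.
- by move=> g _; exact: aM.
rewrite exprMn ler_wpM2l ?sqr_ge0//.
have := fD x [seq ph g | g <- s'].
have uph : uniq [seq ph g | g <- s'].
  rewrite map_inj_in_uniq ?filter_uniq// => g g' /s'P Pg /s'P Pg' e.
  have [K1 r1] := alP _ Pg; have [K2 r2] := alP _ Pg'.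
  rewrite -(alph _ Pg) -(alph _ Pg') -e; congr gmul; apply: Ks; rewrite ?inE//.
  by rewrite (cal _ Pg) e -(cal _ Pg').
move=> /(_ uph) h.
have {}h : col_norm f x [seq ph g | g <- s'] <= D.
  by apply: h => // _ /mapP[g gs ->]; exact: s'x.
have : col_norm f x [seq ph g | g <- s'] ^+ 2 <= D ^+ 2.
  by rewrite lerXn2r ?nnegrE ?col_norm_ge0.
by rewrite col_norm_sqr big_map.
Qed.

Lemma cont_on_star K a : cont_on K a -> cont_on (setg_inv K) (section_star a).
Proof.
move=> [aK ac]; split=> [g /eqP ag|g].
  exists (ginv g); last exact: egpd_invK.
  apply: aK; apply/eqP => a0; apply: ag.
  by rewrite (section_starE _ (erefl (ginv g))) a0 fadj0// egpd_invK.
rewrite inE => -[k Kk <-].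
have -> : section_fun (section_star a) = @fstar R G B \o (section_fun a \o ginv).
  apply/funext => h; rewrite /section_fun /= (section_starE _ (erefl (ginv h))).
  by rewrite coe_fadj// egpd_invK.
apply: continuous_comp; last exact: fell_star_cont.
apply: continuous_comp; first exact: egpd_inv_cont.
by apply: ac; rewrite inE egpd_invK.
Qed.

Lemma fmul_cvg (T : topologicalType) (F : set_system T) (FF : Filter F)
    (u v : T -> btotal B) (p q : btotal B) : fdom p q -> u @ F --> p -> v @ F --> q ->
  (\forall t \near F, fdom (u t) (v t)) ->
  (fun t => fmul (u t) (v t)) @ F --> fmul p q.
Proof.
move=> pq up vq c.
exact: (within_cvg_comp FF (@fell_mul_cont R G B) pq up vq c).
Qed.

Lemma cont_on_mul K L a b : bicompact K -> bicompact L -> cont_on K a -> cont_on L b ->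
  conv_defined a b /\ cont_on (setg_mul K L) (convolution a b).
Proof.
move=> [_ _ [ O [Oo [Os _] KO]]] [_ _ [ P [Po [Ps _] LP]]] [aK ac] [bL bc].
have Ls : set_inj L src.
  by move=> g h; rewrite !inE => Lg Lh; apply: Ps; rewrite inE; exact: LP.
have bfin := col_finite_slice Ls bL.
have abd : conv_defined a b.
  suff [] : conv_defined a b /\ convolution a b = convolution a b by [].
  by apply: conv_sum_eq => g; have [S []] := conv_sum_col_finite a g bfin.
split=> //; split.
  move=> g /eqP abg; apply: contrapT => ng; apply: abg.
  apply: convolution_unique.
  have := @conv_sum_fin _ _ _ a b g fset0; rewrite big_seq_fset0; apply => d _ dg.
  have [Ld|nLd] := pselect (L d); last by rewrite conv_term0r// (not_supp bL nLd).
  have [Kd|nKd] := pselect (K (gmul g (ginv d))); last first.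
    by rewrite conv_term0l// (not_supp aK nKd).
  exfalso; apply: ng; exists (gmul g (ginv d)), d; split=> //; last by rewrite gmulVK.
  by rewrite /composable src_mulV.
move=> g0; rewrite inE => -[al [be [Kal Lbe cab ->]]].
have Pbe := LP _ Lbe.
pose bt := rfactor P.
pose at_ g := gmul g (ginv (bt g)).
have nr := near_rfactor Po Pbe cab.
(* Continuity at points of K L is continuity on the whole groupoid, so the one-term formula must
   hold at all nearby g, also outside K L. It does: only the right factor in the slice P can
   contribute, and the product is 0 wherever a or b vanishes. *)
have E : \forall g \near gmul al be,
    section_fun (convolution a b) g = fmul (section_fun a (at_ g)) (section_fun b (bt g)).
  apply: filterS nr => g [Pg sg]; rewrite /section_fun.
  have -> : convolution a b g = fprod g (a (at_ g)) (b (bt g)).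
    have := @conv_sum_fin _ _ _ a b g [fset bt g]%fset; rewrite big_seq_fset1.
    have -> : conv_term a b g (bt g) = fprod g (a (at_ g)) (b (bt g)).
      by rewrite /conv_term [src (bt g)]sg eqxx.
    move=> H; apply: convolution_unique; apply: H => d; rewrite inE => /eqP dbt dg.
    apply: conv_term0r; apply: not_supp bL _ => Ld; apply: dbt; apply: Ps; rewrite ?inE//.
      exact: LP.
    by rewrite dg -sg.
  rewrite coe_fprod//; last by rewrite gmulVK.
  by rewrite /composable src_mulV.
have E0 := nbhs_singleton E.
have btE : bt (gmul al be) = be by exact: rfactorE.
have atE : at_ (gmul al be) = al by rewrite /at_ btE egpd_mulKV.
rewrite /continuous_at E0 atE btE.
suff : (fun g => fmul (section_fun a (at_ g)) (section_fun b (bt g))) @ gmul al be -->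
    fmul (section_fun a al) (section_fun b be).
  apply: cvg_trans; apply: near_eq_cvg; by apply: filterS E => g ->.
apply: fmul_cvg.
- by rewrite /fdom !bproj_coe.
- apply: (cvg_comp _ _ (lfactor_cvg Po Ps Pbe cab)); apply: ac; exact: mem_set.
- apply: (cvg_comp _ _ (rfactor_cvg Po Ps Pbe cab)); apply: bc; exact: mem_set.
- apply: filterS nr => g [_ sg]; rewrite /fdom !bproj_coe /composable.
  by rewrite /at_ src_mulV.
Qed.

Local Notation generator := [set a | exists2 K : set G, bicompact K & cont_on K a].

Lemma cont_c_col_finite c : cont_c c -> col_finite c.
Proof.
apply: linear_span_ind c => [x|v w hv hw x|k v hv x|v [K [_ _ [ O [_ [Os _] KO]]] [vK _]]].
- by exists fset0.
- have [S HS] := hv x; have [S' HS'] := hw x; exists (S `|` S')%fset => d dx.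
  rewrite inE negb_or => /andP[dS dS'].
  by rewrite -[LHS]/(v d + w d) HS// HS'// addr0.
- have [S HS] := hv x; exists S => d dx dS.
  by rewrite -[LHS]/(k *: v d) HS// scaler0.
- apply: (@col_finite_slice O) => //; exact: subset_trans KO.
Qed.

Lemma normb_bound0 : normb_bound (0 : fell_section B) 0.
Proof.
move=> f S D fS D0 fD x s us sx ux; have [_ ->] := convolution0l f.
rewrite mul0r; apply: le_trans (col_norm_le_sum _ sx) _.
by rewrite big1// => g _; rewrite vnorm0.
Qed.

Lemma cont_c_normb c : cont_c c -> exists2 C : R, 0 <= C & normb_bound c C.
Proof.
move: c; apply: (@linear_span_ind _ _ _ (fun c => exists2 C : R, 0 <= C & normb_bound c C)) =>
    [|v w [C C0 vC] [E E0 wE]|k v [C C0 vC]|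
    v [K [_ Kc [ O [_ Os KO]]] vK]].
- by exists 0 => //; exact: normb_bound0.
- by exists (C + E); [exact: addr_ge0|exact: normb_boundD].
- by exists (complex.Re `|k| * C); [rewrite mulr_ge0 ?Re_norm_ge0|exact: normb_boundZ].
- have [M M0 vM] := cont_on_bounded Kc vK; exists M => //.
  by apply: (normb_bound_slice Os) => //; apply: subset_trans KO; case: vK.
Qed.

Lemma cont_c_star c : cont_c c -> cont_c (section_star c).
Proof.
move: c; apply: (@linear_span_ind _ _ _ (fun c => cont_c (section_star c))) =>
  [|v w hv hw|k v hv|v [K Kb vK]].
- have -> : section_star 0 = 0 :> fell_section B.
    by apply: (addIr (section_star (0 : fell_section B))); rewrite -section_starD !add0r.
  exact: linear_span0.
- by rewrite section_starD; exact: linear_spanD.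
- by rewrite section_starZ; exact: linear_spanZ.
- apply: linear_span_sub; exists (setg_inv K); [exact: bicompact_inv|exact: cont_on_star].
Qed.

Lemma cont_c_mul c (d : fell_section B) : cont_c c -> cont_c d ->
  conv_defined c d /\ cont_c (convolution c d).
Proof.
move=> + dc; move: c; apply: (@linear_span_ind _ _ _
  (fun c => conv_defined c d /\ cont_c (convolution c d))) =>
  [|v w [dv hv] [dw hw]|k v [dv hv]|v [K Kb vK]].
- by have [h ->] := convolution0l d; split=> //; exact: linear_span0.
- by have [h ->] := convolutionDl_defined dv dw; split=> //; exact: linear_spanD.
- have [] := convolutionZ k 1 dv; rewrite scale1r mulr1 => h ->.
  by split=> //; exact: linear_spanZ.
move: d dc; apply: (@linear_span_ind _ _ _
  (fun d : fell_section B => conv_defined v d /\ cont_c (convolution v d))) =>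
  [|w z [dw hw] [dz hz]|k w [dw hw]|w [L Lb wL]].
- by have [h ->] := convolution0r v; split=> //; exact: linear_span0.
- by have [h ->] := convolutionDr dw dz; split=> //; exact: linear_spanD.
- have [] := convolutionZ 1 k dw; rewrite scale1r mul1r => h ->.
  by split=> //; exact: linear_spanZ.
have [h1 h2] := cont_on_mul Kb Lb vK wL; split=> //.
by apply: linear_span_sub; exists (setg_mul K L) => //; exact: bicompact_mul.
Qed.

End ContC.

(** * The closure is a C*-subalgebra *)

Section ReducedCstar.
Variables (R : realType) (G : etale_groupoid) (B : fell_bundle R G).
Implicit Types a b c : fell_section B.

Lemma reduced_cstarP a : reduced_cstar B a <->
  forall e : R, 0 < e -> exists2 c, cont_c c & normb_bound (a - c) e.
Proof.
split=> H e e0.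
  have [c cc /ltW h] := H _ e0; exists c => //; apply/normb_leP => //; exact: ltW.
have e2 : 0 < e / 2 by rewrite divr_gt0.
have [c cc h] := H _ e2; exists c => //.
apply: (@le_lt_trans _ _ (e / 2)%:E); first by apply/normb_leP => //; exact: ltW.
by rewrite lte_fin; lra.
Qed.

Lemma reduced_cstar_normb a : reduced_cstar B a -> exists2 C : R, 0 <= C & normb_bound a C.
Proof.
move=> /reduced_cstarP/(_ 1 ltr01)[c cc ac].
have [C C0 cC] := cont_c_normb cc; exists (1 + C); first exact: addr_ge0.
by rewrite -[a](subrK c); exact: normb_boundD.
Qed.

Lemma reduced_cstar_star a : reduced_cstar B a -> reduced_cstar B (section_star a).
Proof.
move=> /reduced_cstarP H; apply/reduced_cstarP => e e0; have [c cc h] := H _ e0.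
exists (section_star c); first exact: cont_c_star.
have -> : section_star a - section_star c = section_star (a - c).
  apply: (addIr (section_star c)); by rewrite subrK -section_starD subrK.
apply: normb_bound_star => //; exact: ltW.
Qed.

Lemma reduced_cstarD a b : reduced_cstar B a -> reduced_cstar B b -> reduced_cstar B (a + b).
Proof.
move=> /reduced_cstarP Ha /reduced_cstarP Hb; apply/reduced_cstarP => e e0.
have e2 : 0 < e / 2 by rewrite divr_gt0.
have [c cc h] := Ha _ e2; have [d dd h'] := Hb _ e2.
exists (c + d); first exact: linear_spanD.
rewrite opprD addrACA; apply: normb_bound_le (normb_boundD h h'); lra.
Qed.

Lemma reduced_cstarZ (l : R[i]) a : reduced_cstar B a -> reduced_cstar B (l *: a).
Proof.
move=> /reduced_cstarP Ha; apply/reduced_cstarP => e e0.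
have l0 := Re_norm_ge0 l.
have l1 : 0 < complex.Re `|l| + 1 by rewrite ltr_wpDl.
have [c cc h] := Ha _ (divr_gt0 e0 l1).
exists (l *: c); first exact: linear_spanZ.
rewrite -scalerBr; apply: normb_bound_le (normb_boundZ l h).
by rewrite mulrA ler_pdivrMr// mulrC ler_wpM2l ?lerDl// ltW.
Qed.

Lemma reduced_cstarB a b : reduced_cstar B a -> reduced_cstar B b -> reduced_cstar B (a - b).
Proof.
by move=> ra rb; rewrite -scaleN1r; exact: reduced_cstarD ra (reduced_cstarZ (-1) rb).
Qed.

Lemma cont_c_reduced c : cont_c c -> reduced_cstar B c.
Proof.
move=> cc; apply/reduced_cstarP => e e0; exists c => //; rewrite subrr.
by apply: (@normb_bound_le _ _ _ _ 0); [exact: ltW|exact: normb_bound0].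
Qed.

(** The left factor enters through the columns of its adjoint, the right one through approximation
    by sections with finite columns; both are measured by |.|_2, which |.|_b dominates. *)
Lemma reduced_cstar_conv_defined a b :
  reduced_cstar B a -> reduced_cstar B b -> conv_defined a b.
Proof.
move=> /reduced_cstar_star/reduced_cstar_normb[A A0 aA] /reduced_cstarP Hb.
apply: (conv_defined_approx A0); first exact: normb_bound_norm2.
move=> e e0; have [c cc h] := Hb _ e0; exists c; first exact: cont_c_col_finite.
by apply: normb_bound_norm2 => //; exact: ltW.
Qed.

Lemma reduced_cstar_mul a b : reduced_cstar B a -> reduced_cstar B b ->
  reduced_cstar B (convolution a b).
Proof.
move=> ra rb; have [A A0 aA] := reduced_cstar_normb ra.
have [E E0 bE] := reduced_cstar_normb rb.
apply/reduced_cstarP => e e0.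
(* The error in a b - c d = a (b - d) + (a - c) d is at most A r + r (E + r), and r <= 1 bounds this
   by r (A + E + 1). *)
pose r := Num.min 1 (e / (A + E + 1)).
have S0 : 0 < A + E + 1 by rewrite ltr_wpDl// addr_ge0.
have r0 : 0 < r by rewrite lt_min ltr01 divr_gt0.
have r1 : r <= 1 by rewrite ge_min lexx.
have rS : r * (A + E + 1) <= e by rewrite -ler_pdivlMr// ge_min lexx orbT.
have [c cc ac] := (reduced_cstarP a).1 ra _ r0.
have [d dd bd] := (reduced_cstarP b).1 rb _ r0.
have dE : normb_bound d (E + r).
  have -> : d = b + (-1) *: (b - d) by rewrite scaleN1r opprB addrCA subrr addr0.
  apply: (normb_boundD bE); have := normb_boundZ (-1) bd.
  by rewrite normrN1 mul1r.
have rd := cont_c_reduced dd; have rc := cont_c_reduced cc.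
have rbd := reduced_cstarB rb rd; have rac := reduced_cstarB ra rc.
have [cdd cdc] := cont_c_mul cc dd.
exists (convolution c d) => //.
have -> : convolution a b - convolution c d =
    convolution a (b - d) + convolution (a - c) d.
  have [_ h1] := convolutionDr (reduced_cstar_conv_defined ra rbd)
    (reduced_cstar_conv_defined ra rd).
  have [_ h2] := convolutionDl_defined (reduced_cstar_conv_defined rac rd) cdd.
  apply: (addIr (convolution c d)); rewrite subrK -addrA -h2 subrK -h1 subrK.
  by [].
have n1 := normb_bound_mul A0 (ltW r0) (reduced_cstar_conv_defined ra rbd) aA bd.
have n2 := normb_bound_mul (ltW r0) (addr_ge0 E0 (ltW r0))
  (reduced_cstar_conv_defined rac rd) ac dE.
apply: normb_bound_le (normb_boundD n1 n2).
apply: le_trans rS; rewrite [A * r]mulrC -mulrDr ler_wpM2l ?(ltW r0)//; lra.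
Qed.

End ReducedCstar.

Theorem theorem3p9 (R : realType) (G : etale_groupoid) (B : fell_bundle R G) :
  is_cstar_subalgebra (big_cstar B) (reduced_cstar B).
Proof.
split.
- move=> a ra; have rs := reduced_cstar_star ra; split.
  + have [C C0 aC] := reduced_cstar_normb ra.
    by apply: (@le_lt_trans _ _ C%:E); [apply/normb_leP|exact: ltry].
  + exact: reduced_cstar_conv_defined.
  + exact: reduced_cstar_conv_defined.
- by apply: cont_c_reduced; exact: linear_span0.
- exact: reduced_cstarD.
- exact: reduced_cstarZ.
- move=> a b ra rb; split; first exact: reduced_cstar_conv_defined.
  exact: reduced_cstar_mul.
- exact: reduced_cstar_star.
- move=> a [_ H]; apply/reduced_cstarP => e e0.
  have e2 : 0 < e / 2 by rewrite divr_gt0.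
  have [c /reduced_cstarP rc /ltW h] := H _ e2.
  have [d dd h'] := rc _ e2; exists d => //.
  have -> : a - d = (a - c) + (c - d) by rewrite addrA subrK.
  have h'' : normb_bound (a - c) (e / 2) by apply/normb_leP => //; exact: ltW.
  by apply: normb_bound_le (normb_boundD h'' h'); lra.
Qed.
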